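(* Let $k$ be a commutative Noetherian ring, $G$ a finite group, and $V$ a finitely generated $\mathrm{FI}_G$-module over $k$. Let $G_s$ be the endomorphism group of the object $[s]$ of $\mathrm{FI}_G$, $s\ge 0$. Then $V$ is $\sharp$-filtered if and only if it satisfies one of the following equivalent conditions: (1) $\mathrm{Tor}_i^{k\mathrm{FI}_G}(kG_s,V)=0$ for all $i\ge 1$ and all $s\ge 0$; (2) $\mathrm{Tor}_1^{k\mathrm{FI}_G}(kG_s,V)=0$ for all $s\ge 0$; (3) there is some $i\ge 1$ such that $\mathrm{Tor}_i^{k\mathrm{FI}_G}(kG_s,V)=0$ for all $s\ge 0$; (4) $\mathrm{Ext}^i_{k\mathrm{FI}_G}(kG_s,V)=0$ for all $i,s\ge 0$; (5) $\mathrm{Ext}^i_{k\mathrm{FI}_G}(T,V)=0$ for all $i\ge 0$ and all finitely generated torsion modules $T$.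
   Context: The category $\mathrm{FI}_G$ has objects $[n]=\{1,\dots,n\}$, $n\ge 0$, and morphisms $[n]\to[m]$ the pairs $(f,g)$ with $f:[n]\to[m]$ an injection and $g:[n]\to G$ a map of sets; composition is $(f,g)\circ(f',g')=(f\circ f',h)$ with $h(x)=g'(x)g(f'(x))$. Thus $\mathrm{End}([n])=G_n=G\wr\mathfrak{S}_n$. An $\mathrm{FI}_G$-module over $k$ is a covariant functor $V$ from $\mathrm{FI}_G$ to $k$-modules, with $V_n:=V([n])$; equivalently it is a graded module $V=\bigoplus_n e_nV$ over the category algebra $k\mathrm{FI}_G=\bigoplus_{n\le m}k[\mathrm{Hom}([n],[m])]$, where $e_n$ is the identity of $[n]$. Ext is taken in the category of all $\mathrm{FI}_G$-modules. A module $V$ is finitely generated if some finite subset of $\bigsqcup_n V_n$ lies in no proper submodule. $kG_s$ is regarded as a left or right $k\mathrm{FI}_G$-module concentrated in degree $s$, i.e. as the degree-$s$ summand of $k\mathrm{FI}_G/\mathfrak{m}$, where $\mathfrak{m}=\bigoplus_{n<m}k[\mathrm{Hom}([n],[m])]$ (so all morphisms $[n]\to[m]$ with $n<m$ act by zero). For a $kG_n$-module $W$, the basic filtered module $M(W)$ is $M(W)_m = k[\mathrm{Hom}([n],[m])]\otimes_{kG_n}W$, with morphisms acting by composition on the first factor. A module $V$ is $\sharp$-filtered if it has a finite filtration $0=V^{(-1)}\subseteq V^{(0)}\subseteq\dots\subseteq V^{(r)}=V$ with $V^{(i)}/V^{(i-1)}\cong M(W^{(i)})$ for some $kG_i$-module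 $W^{(i)}$ for each $i\ge0$. An element $v\in V_n$ is torsion if it is in the kernel of the map induced by some morphism $[n]\to[m]$ with $m>n$; $V$ is a torsion module if all its elements are torsion. *)

(* Defs.v *)
From HB Require Import structures.
From mathcomp Require Import all_boot all_algebra fingroup generic_quotient finmap.
From mathcomp Require Import boolp classical_sets functions cardinality fsbigop.

Set Implicit Arguments.
Unset Strict Implicit.
Unset Printing Implicit Defensive.

Import GRing.Theory.
Local Open Scope classical_set_scope.
Local Open Scope ring_scope.

Section LinearAlgebra.
Variable k : comPzRingType.
Implicit Types V W U : lmodType k.

Definition mk_linear V W (f : V -> W) (Hf : linear f) : {linear V -> W} :=
  HB.pack f (GRing.isLinear.Build k V W *:%R f Hf).

Lemma linear_eqP V W (f g : {linear V -> W}) : f =1 g <-> f = g.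
Proof.
split=> [fg|-> //]; case: f fg => f cf; case: g => g cg /= fg.
have fgE : f = g by apply/funext.
case: _ / fgE in cg fg *; congr GRing.Linear.Pack.
case: cf cg => -[a1] [b1] [-[a2] [b2]].
by congr GRing.Linear.Class; congr (_ _); apply: Prop_irrelevance.
Qed.

Section MkSubmod.
Variables (V : lmodType k) (P : V -> Prop).
Hypotheses (P0 : P 0) (PL : forall a x y, P x -> P y -> P (a *: x + y)).
Definition submod_pred : {pred V} := [pred x | `[< P x >]].
Fact submod_pred_closed : subsemimod_closed submod_pred.
Proof.
apply/GRing.submod_closed_semi; split; first exact/asboolP.
by move=> a x y /asboolP Px /asboolP Py; apply/asboolP/PL.
Qed.
Definition mk_submod : submodClosed V := HB.pack submod_pred
  (GRing.isSubmodClosed.Build k V submod_pred submod_pred_closed).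
Lemma mk_submodE x : (x \in mk_submod) <-> P x.
Proof. by split=> /asboolP. Qed.
End MkSubmod.

Section Submodules.
Variables V W U : lmodType k.
Implicit Types (f : {linear V -> W}) (S : submodClosed V).

Fact ker_closed f a x y : f x = 0 -> f y = 0 -> f (a *: x + y) = 0.
Proof. by move=> fx fy; rewrite linearP fx fy scaler0 addr0. Qed.
Definition ker f : submodClosed V :=
  @mk_submod V (fun x => f x = 0) (raddf0 f) (@ker_closed f).

Fact im_closed0 f : exists x, f x = 0. Proof. by exists 0; rewrite linear0. Qed.
Fact im_closedP f a y y' :
  (exists x, f x = y) -> (exists x, f x = y') -> exists x, f x = a *: y + y'.
Proof. by move=> [x <-] [x' <-]; exists (a *: x + x'); rewrite linearP. Qed.
Definition im f : submodClosed W :=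
  @mk_submod W (fun y => exists x, f x = y) (im_closed0 f) (@im_closedP f).

Fact preim_closed0 f (T : submodClosed W) : f 0 \in T.
Proof. by rewrite linear0 rpred0. Qed.
Fact preim_closedP f (T : submodClosed W) a x y :
  f x \in T -> f y \in T -> f (a *: x + y) \in T.
Proof. by move=> fx fy; rewrite linearP rpredD// rpredZ. Qed.
Definition preim_submod f (T : submodClosed W) : submodClosed V :=
  @mk_submod V (fun x => f x \in T) (preim_closed0 f T) (@preim_closedP f T).

Lemma kerE f x : (x \in ker f) <-> f x = 0.
Proof. exact: mk_submodE. Qed.
Lemma imE f y : (y \in im f) <-> exists x, f x = y.
Proof. exact: mk_submodE. Qed.
Lemma preimE f (T : submodClosed W) x : (x \in preim_submod f T) <-> f x \in T.
Proof. exact: mk_submodE. Qed.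

Definition in_span (A : V -> Prop) (x : V) : Prop :=
  forall S, (forall a, A a -> a \in S) -> x \in S.
Fact span_closed0 A : in_span A 0. Proof. by move=> S _; apply: rpred0. Qed.
Fact span_closedP A a x y :
  in_span A x -> in_span A y -> in_span A (a *: x + y).
Proof. by move=> Ax Ay S AS; rewrite rpredD ?rpredZ ?Ax ?Ay. Qed.
Definition span A : submodClosed V :=
  @mk_submod V (in_span A) (@span_closed0 A) (@span_closedP A).
Lemma spanE A x : (x \in span A) <-> in_span A x.
Proof. exact: mk_submodE. Qed.
End Submodules.

Section SubLmod.
Variables (V : lmodType k) (S : submodClosed V).
Record sub_type := SubMk { sub_val : V; sub_valP : sub_val \in S }.
HB.instance Definition _ := [isSub for sub_val].
HB.instance Definition _ := [Choice of sub_type by <:].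
Definition as_zmod : {pred V} := S.
HB.instance Definition _ := GRing.isZmodClosed.Build V as_zmod
  (GRing.submod_closedB (GRing.submodClosedP S)).
HB.instance Definition _ :=
  GRing.SubChoice_isSubLmodule.Build k V _ sub_type (GRing.subsemimodClosedP S).
Definition sub_lmod : lmodType k := sub_type.
Definition sub_incl : {linear sub_lmod -> V} := \val.

Variables (W : lmodType k) (f : {linear W -> V}) (fS : forall x, f x \in S).
Fact sub_corestr_linear : linear (fun x => SubMk (fS x) : sub_lmod).
Proof. by move=> a x y; apply/val_inj; rewrite /= !linearE. Qed.
Definition sub_corestr : {linear W -> sub_lmod} := mk_linear sub_corestr_linear.
End SubLmod.

Section QuotLmod.
Variables (V : lmodType k) (S : submodClosed V).
Definition quot_type := {ideal_quot as_zmod S}.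
HB.instance Definition _ := GRing.Zmodule.on quot_type.
Definition quot_pr (x : V) : quot_type := \pi_({ideal_quot as_zmod S})%qT x.

Lemma quot_prP x y : quot_pr x = quot_pr y <-> x - y \in S.
Proof.
rewrite -[_ \in S]/(_ \in as_zmod S) Quotient.idealrBE /quot_pr.
by split=> [->|/eqP].
Qed.
Lemma quot_repr q : quot_pr (repr q) = q. Proof. exact: reprK. Qed.
Lemma quot_prD x y : quot_pr (x + y) = quot_pr x + quot_pr y.
Proof. exact: raddfD. Qed.

Definition quot_scale (a : k) (q : quot_type) : quot_type := quot_pr (a *: repr q).
Lemma quot_scaleE a x : quot_scale a (quot_pr x) = quot_pr (a *: x).
Proof. by apply/quot_prP; rewrite -scalerBr rpredZ//; apply/quot_prP/quot_repr. Qed.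
Fact quot_scaleA a b q : quot_scale a (quot_scale b q) = quot_scale (a * b) q.
Proof. by rewrite -(quot_repr q) !quot_scaleE scalerA. Qed.
Fact quot_scale1 : left_id 1 quot_scale.
Proof. by move=> q; rewrite -(quot_repr q) quot_scaleE scale1r. Qed.
Fact quot_scaleDr : right_distributive quot_scale +%R.
Proof.
move=> a p q; rewrite -(quot_repr p) -(quot_repr q) -quot_prD !quot_scaleE.
by rewrite scalerDr quot_prD.
Qed.
Fact quot_scaleDl q : {morph quot_scale^~ q : a b / a + b}.
Proof.
by move=> a b; rewrite -(quot_repr q) !quot_scaleE scalerDl quot_prD.
Qed.
HB.instance Definition _ := GRing.Zmodule_isLmodule.Build k quot_type
  quot_scaleA quot_scale1 quot_scaleDr quot_scaleDl.
Definition quot_lmod : lmodType k := quot_type.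
Fact quot_pi_linear : linear (quot_pr : V -> quot_lmod).
Proof. by move=> a x y; rewrite quot_prD -quot_scaleE. Qed.
Definition quot_pi : {linear V -> quot_lmod} := mk_linear quot_pi_linear.

Lemma quot_ind (P : quot_lmod -> Prop) : (forall x, P (quot_pi x)) -> forall q, P q.
Proof. by move=> H q; rewrite -(quot_repr q). Qed.

Section Lift.
Variables (W : lmodType k) (f : {linear V -> W}).
Hypothesis fS : forall x, x \in S -> f x = 0.
Definition quot_lift_fun (q : quot_lmod) : W := f (repr (q : quot_type)).
Lemma quot_lift_funE x : quot_lift_fun (quot_pi x) = f x.
Proof.
by apply/eqP; rewrite -subr_eq0 -linearB fS//; apply/quot_prP/quot_repr.
Qed.
Fact quot_lift_linear : linear quot_lift_fun.
Proof.
move=> a; elim/quot_ind=> x; elim/quot_ind=> y.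
by rewrite -linearP !quot_lift_funE linearP.
Qed.
Definition quot_lift : {linear quot_lmod -> W} := mk_linear quot_lift_linear.
Lemma quot_liftE x : quot_lift (quot_pi x) = f x.
Proof. exact: quot_lift_funE. Qed.
End Lift.
End QuotLmod.

(* The homology at the middle term; [comp g f = 0] is not needed to form it. *)
Definition homology V W U (f : {linear V -> W}) (g : {linear W -> U}) :
    lmodType k :=
  quot_lmod (preim_submod (sub_incl (ker g)) (im f)).

Section FreeLmod.
Variable X : Type.
Fact fin_supp_closed0 : finite_set [set x | (0 : X -> k^o) x <> 0].
Proof. by rewrite (_ : [set x | _] = set0)//; apply/seteqP; split. Qed.
Fact fin_supp_closedP (a : k) (u v : X -> k^o) :
  finite_set [set x | u x <> 0] -> finite_set [set x | v x <> 0] ->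
  finite_set [set x | (a *: u + v) x <> 0].
Proof.
move=> fu fv; apply: (@sub_finite_set _ _ ([set x | u x <> 0] `|` [set x | v x <> 0])).
  move=> x /=; apply: contra_notP => /not_orP[/contrapT ux /contrapT vx].
  by rewrite fctE /= -[(a *: u) x]/(a *: u x) ux vx scaler0 addr0.
by rewrite finite_setU.
Qed.
Definition free_lmod : lmodType k :=
  sub_lmod (@mk_submod (X -> k^o : lmodType k)
    (fun u => finite_set [set x | u x <> 0]) fin_supp_closed0 fin_supp_closedP).

Fact delta_fin_supp (x : X) :
  finite_set [set y | (fun y => `[< x = y >]%:R : k^o) y <> 0].
Proof.
apply: (@sub_finite_set _ _ [set x]); last exact: finite_set1.
by move=> y /=; case: asboolP.
Qed.
Definition delta (x : X) : free_lmod :=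
  SubMk (proj2 (mk_submodE _ _ _) (delta_fin_supp x)).
Lemma free_valP a (u v : free_lmod) x :
  sub_val (a *: u + v) x = a * sub_val u x + sub_val v x.
Proof.
have /= -> := linearP (sub_incl _ : {linear free_lmod -> (X -> k^o : lmodType k)}) a u v.
by [].
Qed.
Lemma free_valZ a (u : free_lmod) x : sub_val (a *: u) x = a * sub_val u x.
Proof. by rewrite -[a *: u]addr0 free_valP addr0. Qed.

Section Lift.
Variables (V : lmodType k) (u : X -> V).
Definition free_lift_fun (a : free_lmod) : V :=
  \sum_(x \in [set: {classic X}]) (sub_val a x : k) *: u x.

Lemma free_supp (a : free_lmod) :
  exists A : {fset {classic X}}, forall x : {classic X}, x \notin A -> sub_val a x = 0.
Proof.
have /mk_submodE fa := sub_valP a.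
exists (fset_set [set x : {classic X} | sub_val a x <> 0]) => x.
by rewrite in_fset_set// notin_setE => /contrapT.
Qed.
Lemma free_lift_funE (a : free_lmod) (A : {fset {classic X}}) :
  (forall x : {classic X}, x \notin A -> sub_val a x = 0) ->
  free_lift_fun a = \sum_(x <- A) (sub_val a x : k) *: u x.
Proof. by move=> aA; apply: fsbigTE => x /aA ->; rewrite scale0r. Qed.
Fact free_lift_linear : linear free_lift_fun.
Proof.
move=> c a b; have [A aA] := free_supp a; have [B bB] := free_supp b.
pose D := (A `|` B)%fset.
have aD x : x \notin D -> sub_val a x = 0 by rewrite inE negb_or => /andP[/aA].
have bD x : x \notin D -> sub_val b x = 0 by rewrite inE negb_or => /andP[_ /bB].
rewrite (free_lift_funE aD) (free_lift_funE bD) (@free_lift_funE _ D).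
  rewrite scaler_sumr -big_split; apply: eq_bigr => x _ /=.
  by rewrite scalerA -scalerDl.
move=> x xD; 
rewrite free_valP.
by rewrite aD// bD// mulr0 addr0.
Qed.
Definition free_lift : {linear free_lmod -> V} := mk_linear free_lift_linear.
Lemma free_lift_delta x : free_lift (delta x) = u x.
Proof.
rewrite /= (@free_lift_funE _ [fset (x : {classic X})]%fset).
  by rewrite big_seq_fset1 /= asboolT// scale1r.
move=> y; rewrite inE /=; case: asboolP => [->|//]; by rewrite eqxx.
Qed.
End Lift.

Lemma free_deltaE (a : free_lmod) (A : {fset {classic X}}) :
  (forall x : {classic X}, x \notin A -> sub_val a x = 0) ->
  a = \sum_(x <- A) (sub_val a x : k) *: delta x.
Proof.
move=> aA; apply/val_inj/funext => y.
rewrite (raddf_sum (sub_incl _)) fct_sumE /=.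
have E (x : {classic X}) : sub_val ((sub_val a x : k) *: delta x) y
    = if x == y :> {classic X} then sub_val a y else 0.
  rewrite free_valZ /=.
  by case: eqP => [->|ne]; [rewrite asboolT// mulr1 | rewrite asboolF// mulr0].
rewrite (eq_bigr _ (fun x _ => E x)).
have [yA|yA] := boolP ((y : {classic X}) \in A).
  by rewrite (big_fsetD1 (y : {classic X}))//= eqxx big1_seq ?addr0// => x /andP[_];
    rewrite !inE => /andP[/negPf ->].
rewrite aA// big1_seq// => x /andP[_ xA]; case: eqP => // xy.
Qed.
Lemma free_ext V (f g : {linear free_lmod -> V}) :
  (forall x, f (delta x) = g (delta x)) -> f =1 g.
Proof.
move=> fg a; have [A aA] := free_supp a; rewrite (free_deltaE aA) !linear_sum.
by apply: eq_bigr => x _; rewrite !linearZ fg.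
Qed.
End FreeLmod.
End LinearAlgebra.

Section FreeMap.
Variable k : comPzRingType.
Definition free_map X Y (h : X -> Y) : {linear free_lmod k X -> free_lmod k Y} :=
  free_lift (fun x => delta k (h x)).
Lemma free_map_delta X Y (h : X -> Y) x : free_map h (delta k x) = delta k (h x).
Proof. exact: free_lift_delta. Qed.
End FreeMap.

Record category := Category {
  obj :> Type;
  hom : obj -> obj -> Type;
  idm : forall x, hom x x;
  cmp : forall x y z, hom y z -> hom x y -> hom x z;
  cmp1m : forall x y (f : hom x y), cmp (idm y) f = f;
  cmpm1 : forall x y (f : hom x y), cmp f (idm x) = f;
  cmpA : forall x y z t (h : hom z t) (g : hom y z) (f : hom x y),
    cmp h (cmp g f) = cmp (cmp h g) f }.
Arguments idm {c} x.

Section Modules.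
Variables (k : comPzRingType) (C : category).

(* A left [kC]-module, graded by the objects of [C], is a functor to
   [k]-modules; a right one is a contravariant functor. *)
Record left_module := LeftModule {
  lob :> C -> lmodType k;
  lact : forall x y, hom x y -> {linear lob x -> lob y};
  lact1 : forall x v, lact (idm x) v = v;
  lactM : forall x y z (g : hom y z) (f : hom x y) v,
    lact (cmp g f) v = lact g (lact f v) }.

Record right_module := RightModule {
  rob :> C -> lmodType k;
  ract : forall x y, hom x y -> {linear rob y -> rob x};
  ract1 : forall x v, ract (idm x) v = v;
  ractM : forall x y z (g : hom y z) (f : hom x y) v,
    ract (cmp g f) v = ract f (ract g v) }.

Arguments lact {l x y} _.
Arguments ract {r x y} _.

Record lhom (V W : left_module) := LHom {
  lfun :> forall x, V x -> W x;
  lfun_linear : forall x, linear (@lfun x);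
  lfun_nat : forall x y (f : hom x y) v, lfun (lact f v) = lact f (lfun v) }.

Record rhom (M N : right_module) := RHom {
  rfun :> forall x, M x -> N x;
  rfun_linear : forall x, linear (@rfun x);
  rfun_nat : forall x y (f : hom x y) v, rfun (ract f v) = ract f (rfun v) }.

Arguments lfun {V W} _ _ _.
Arguments rfun {M N} _ _ _.

HB.instance Definition _ V W (f : lhom V W) x :=
  GRing.isLinear.Build k (V x) (W x) *:%R (f x) (@lfun_linear V W f x).
HB.instance Definition _ M N (f : rhom M N) x :=
  GRing.isLinear.Build k (M x) (N x) *:%R (f x) (@rfun_linear M N f x).

Definition llin V W (f : lhom V W) x : {linear V x -> W x} := f x.

Lemma lhomP V W (f g : lhom V W) : (forall x v, f x v = g x v) -> f = g.
Proof.
case: f g => f fl fn [g gl gn] /= fg.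
have E : f = g by apply/functional_extensionality_dep => x; apply/funext/fg.
by case: _ / E in gl gn *; congr LHom; apply: Prop_irrelevance.
Qed.

Definition lhom_id V : lhom V V :=
  @LHom V V (fun x v => v) (fun x a u v => erefl) (fun x y f v => erefl).
Definition rhom_id M : rhom M M :=
  @RHom M M (fun x v => v) (fun x a u v => erefl) (fun x y f v => erefl).

Section LhomComp.
Variables (V W U : left_module) (g : lhom W U) (f : lhom V W).
Fact lhom_comp_linear x : linear (fun v => g x (f x v)).
Proof. by move=> a u v; rewrite !linearP. Qed.
Fact lhom_comp_nat x y (h : hom x y) v : g y (f y (lact h v)) = lact h (g x (f x v)).
Proof. by rewrite !lfun_nat. Qed.
Definition lhom_comp : lhom V U := LHom lhom_comp_linear lhom_comp_nat.
End LhomComp.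

Section LhomLmod.
Variables V W : left_module.
HB.instance Definition _ := gen_eqMixin (lhom V W).
HB.instance Definition _ := gen_choiceMixin (lhom V W).
Implicit Types f g h : lhom V W.

Fact lhom0_linear x : linear (fun _ : V x => 0 : W x).
Proof. by move=> a u v; rewrite scaler0 addr0. Qed.
Fact lhom0_nat x y (p : hom x y) (v : V x) : (0 : W y) = lact p (0 : W x).
Proof. by rewrite linear0. Qed.
Definition lhom0 : lhom V W := LHom lhom0_linear lhom0_nat.

Fact lhom_opp_linear f x : linear (fun v => - f x v).
Proof. by move=> a u v; rewrite linearP opprD scalerN. Qed.
Fact lhom_opp_nat f x y (p : hom x y) v : - f y (lact p v) = lact p (- f x v).
Proof. by rewrite lfun_nat linearN. Qed.
Definition lhom_opp f : lhom V W := LHom (lhom_opp_linear f) (lhom_opp_nat f).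

Fact lhom_add_linear f g x : linear (fun v => f x v + g x v).
Proof. by move=> a u v; rewrite !linearP scalerDr addrACA. Qed.
Fact lhom_add_nat f g x y (p : hom x y) v :
  f y (lact p v) + g y (lact p v) = lact p (f x v + g x v).
Proof. by rewrite !lfun_nat linearD. Qed.
Definition lhom_add f g : lhom V W :=
  LHom (lhom_add_linear f g) (lhom_add_nat f g).

Fact lhom_scale_linear a f x : linear (fun v => a *: f x v).
Proof. by move=> b u v; rewrite linearP scalerDr !scalerA mulrC. Qed.
Fact lhom_scale_nat a f x y (p : hom x y) v :
  a *: f y (lact p v) = lact p (a *: f x v).
Proof. by rewrite lfun_nat linearZ. Qed.
Definition lhom_scale a f : lhom V W :=
  LHom (lhom_scale_linear a f) (lhom_scale_nat a f).

Fact lhom_addA : associative lhom_add.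
Proof. by move=> f g h; apply: lhomP => x v /=; rewrite addrA. Qed.
Fact lhom_addC : commutative lhom_add.
Proof. by move=> f g; apply: lhomP => x v /=; rewrite addrC. Qed.
Fact lhom_add0 : left_id lhom0 lhom_add.
Proof. by move=> f; apply: lhomP => x v /=; rewrite add0r. Qed.
Fact lhom_addN : left_inverse lhom0 lhom_opp lhom_add.
Proof. by move=> f; apply: lhomP => x v /=; rewrite addNr. Qed.
HB.instance Definition _ := GRing.isZmodule.Build (lhom V W)
  lhom_addA lhom_addC lhom_add0 lhom_addN.

Fact lhom_scaleA a b f : lhom_scale a (lhom_scale b f) = lhom_scale (a * b) f.
Proof. by apply: lhomP => x v /=; rewrite scalerA. Qed.
Fact lhom_scale1 : left_id 1 lhom_scale.
Proof. by move=> f; apply: lhomP => x v /=; rewrite scale1r. Qed.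
Fact lhom_scaleDr : right_distributive lhom_scale +%R.
Proof. by move=> a f g; apply: lhomP => x v /=; rewrite scalerDr. Qed.
Fact lhom_scaleDl f : {morph lhom_scale^~ f : a b / a + b}.
Proof. by move=> a b; apply: lhomP => x v /=; rewrite scalerDl. Qed.
HB.instance Definition _ := GRing.Zmodule_isLmodule.Build k (lhom V W)
  lhom_scaleA lhom_scale1 lhom_scaleDr lhom_scaleDl.
End LhomLmod.

Definition Hom V W : lmodType k := lhom V W.

Section Precomp.
Variables (V W U : left_module) (d : lhom V W).
Fact precomp_linear : linear (fun g : Hom W U => lhom_comp g d : Hom V U).
Proof. by move=> a f g; apply: lhomP. Qed.
Definition precomp : {linear Hom W U -> Hom V U} := mk_linear precomp_linear.
End Precomp.

Definition liso V W := exists f : lhom V W, forall x, bijective (f x).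

Record submodule (V : left_module) := Submodule {
  sec :> forall x, submodClosed (V x);
  sec_act : forall x y (f : hom x y) v, v \in sec x -> lact f v \in sec y }.

Section SubQuot.
Variables (V : left_module) (S : submodule V).

Fact sub_act_in x y (f : hom x y) (v : sub_lmod (S x)) : lact f (sub_incl _ v) \in S y.
Proof. exact: (sec_act _ (sub_valP v)). Qed.
Fact sub_act_linear x y (f : hom x y) :
  linear (fun v => SubMk (sub_act_in f v) : sub_lmod (S y)).
Proof. by move=> a u v; apply: val_inj; rewrite /= !linearP. Qed.
Definition sub_act x y (f : hom x y) := mk_linear (sub_act_linear f).
Fact sub_act1 x v : sub_act (idm x) v = v.
Proof. by apply: val_inj; rewrite /= lact1. Qed.
Fact sub_actM x y z (g : hom y z) (f : hom x y) v :
  sub_act (cmp g f) v = sub_act g (sub_act f v).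
Proof. by apply: val_inj; rewrite /= lactM. Qed.
Definition sub_mod : left_module := LeftModule sub_act1 sub_actM.

Definition sub_mod_incl : lhom sub_mod V :=
  @LHom sub_mod V (fun x => sub_incl (S x)) (fun x => linearP (sub_incl (S x)))
    (fun x y f v => erefl).

Fact quot_act_ker x y (f : hom x y) v : v \in S x -> (quot_pi (S y) \o lact f) v = 0.
Proof.
move=> vS; rewrite /= -(linear0 (quot_pi (S y))); apply/quot_prP.
by rewrite subr0 sec_act.
Qed.
Definition quot_act x y (f : hom x y) : {linear quot_lmod (S x) -> quot_lmod (S y)} :=
  quot_lift (@quot_act_ker x y f).
Fact quot_actE x y (f : hom x y) v :
  quot_act f (quot_pi _ v) = quot_pi _ (lact f v).
Proof. exact: quot_liftE. Qed.
Fact quot_act1 x v : quot_act (idm x) v = v.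
Proof. by elim/quot_ind: v => v; rewrite quot_actE lact1. Qed.
Fact quot_actM x y z (g : hom y z) (f : hom x y) v :
  quot_act (cmp g f) v = quot_act g (quot_act f v).
Proof. by elim/quot_ind: v => v; rewrite !quot_actE lactM. Qed.
Definition quot_mod : left_module := LeftModule quot_act1 quot_actM.
End SubQuot.

Section Preim.
Variables (V W : left_module) (f : lhom V W) (S : submodule W).
Fact preim_act x y (h : hom x y) v :
  v \in preim_submod (llin f x) (S x) -> lact h v \in preim_submod (llin f y) (S y).
Proof. by rewrite !preimE /= lfun_nat => /(sec_act h). Qed.
Definition preim_mod : submodule V := Submodule preim_act.
End Preim.

Section Kernel.
Variables (V W : left_module) (f : lhom V W).
Fact ker_act x y (h : hom x y) v :
  v \in ker (llin f x) -> lact h v \in ker (llin f y).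
Proof. by rewrite !kerE /= lfun_nat => ->; rewrite linear0. Qed.
Definition ker_mod : submodule V := Submodule ker_act.
End Kernel.

(* [T / S], for [S] contained in [T]. *)
Definition subquotient V (T S : submodule V) : left_module :=
  quot_mod (preim_mod (sub_mod_incl T) S).

Section Tensor.
Variables (N : right_module) (V : left_module).

Definition pairs := {x : C & (N x * V x)%type}.
Definition pair_at x n v : pairs := existT _ x (n, v).

Inductive tensor_rel : free_lmod k pairs -> Prop :=
| TensorL x a n n' v :
    tensor_rel (delta k (pair_at (x := x) (a *: n + n') v)
      - (a *: delta k (pair_at n v) + delta k (pair_at n' v)))
| TensorR x a n v v' :
    tensor_rel (delta k (pair_at (x := x) n (a *: v + v'))
      - (a *: delta k (pair_at n v) + delta k (pair_at n v')))
| TensorB x y (f : hom x y) n v :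
    tensor_rel (delta k (pair_at (ract f n) v) - delta k (pair_at n (lact f v))).

Definition tensor : lmodType k := quot_lmod (span tensor_rel).
Definition pure x (n : N x) (v : V x) : tensor := quot_pi _ (delta k (pair_at n v)).

Lemma tensor_ext (U : lmodType k) (f g : {linear tensor -> U}) :
  (forall x (n : N x) v, f (pure n v) = g (pure n v)) -> f =1 g.
Proof.
move=> fg; elim/quot_ind; apply: (@free_ext k pairs U (f \o quot_pi _) (g \o quot_pi _)).
by move=> [x [n v]]; apply: fg.
Qed.

Lemma pure_rel u v : tensor_rel (u - v) ->
  quot_pi (span tensor_rel) u = quot_pi (span tensor_rel) v.
Proof. by move=> r; apply/quot_prP/spanE => S; apply. Qed.
Lemma pureL x v : linear (fun n : N x => pure n v).
Proof. by move=> a n n'; rewrite -linearP; apply/pure_rel/TensorL. Qed.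
Lemma pureR x (n : N x) : linear (pure n).
Proof. by move=> a v v'; rewrite -linearP; apply/pure_rel/TensorR. Qed.
Lemma pureB x y (f : hom x y) (n : N y) v : pure (ract f n) v = pure n (lact f v).
Proof. exact/pure_rel/TensorB. Qed.

Section Lift.
Variables (U : lmodType k) (b : forall x, N x -> V x -> U).
Hypotheses (bL : forall x v, linear (fun n => b (x := x) n v))
  (bR : forall x n, linear (b (x := x) n))
  (bB : forall x y (f : hom x y) n v, b (ract f n) v = b n (lact f v)).
Definition tensor_lift_free : {linear free_lmod k pairs -> U} :=
  free_lift (fun p : pairs => b (projT2 p).1 (projT2 p).2).
Fact tensor_lift_ker u : u \in span tensor_rel -> tensor_lift_free u = 0.
Proof.
move=> /spanE H; apply/kerE/H => w.
case=> [x a n n' v|x a n v v'|x y f n v]; apply/kerE;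
  rewrite linearB ?(linearP tensor_lift_free) !free_lift_delta /=;
  apply/eqP; rewrite subr_eq0; apply/eqP.
- exact: (bL v).
- exact: (bR n).
- exact: bB.
Qed.
Definition tensor_lift : {linear tensor -> U} := quot_lift tensor_lift_ker.
Lemma tensor_liftE x n v : tensor_lift (pure n v) = b (x := x) n v.
Proof. by rewrite quot_liftE; apply: free_lift_delta. Qed.
End Lift.
End Tensor.

Section TensorMap.
Variables (N N' : right_module) (V V' : left_module) (f : rhom N N') (g : lhom V V').
Fact tensor_map_L x v : linear (fun n => pure (f x n) (g x v)).
Proof. by move=> a n n'; rewrite linearP pureL. Qed.
Fact tensor_map_R x n : linear (fun v => pure (f x n) (g x v)).
Proof. by move=> a v v'; rewrite linearP pureR. Qed.
Fact tensor_map_B x y (h : hom x y) n v :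
  pure (f x (ract h n)) (g x v) = pure (f y n) (g y (lact h v)).
Proof. by rewrite rfun_nat pureB lfun_nat. Qed.
Definition tensor_map : {linear tensor N V -> tensor N' V'} :=
  tensor_lift tensor_map_L tensor_map_R tensor_map_B.
Lemma tensor_mapE x (n : N x) v : tensor_map (pure n v) = pure (f x n) (g x v).
Proof. exact: tensor_liftE. Qed.
End TensorMap.

Definition projective (P : left_module) : Prop :=
  forall (V W : left_module) (p : lhom V W) (f : lhom P W),
    (forall x w, exists v, p x v = w) ->
    exists g : lhom P V, lhom_comp p g = f.

Record resolution (V : left_module) := Resolution {
  res :> nat -> left_module;
  res_d : forall i, lhom (res i.+1) (res i);
  res_aug : lhom (res 0) V;
  res_proj : forall i, projective (res i);
  res_surj : forall x v, exists u, res_aug x u = v;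
  res_exact0 : forall x u, res_aug x u = 0 <-> exists w, res_d 0 x w = u;
  res_exactS : forall i x u, res_d i x u = 0 <-> exists w, res_d i.+1 x w = u }.

(* The differential out of degree [i], which is zero for [i = 0]. *)
Definition res_out V (P : resolution V) i : lhom (P i) (P i.-1) :=
  match i with 0 => 0 : Hom (P 0) (P 0) | j.+1 => res_d P j end.

Definition Tor_of V (P : resolution V) (N : right_module) (i : nat) : lmodType k :=
  homology (tensor_map (rhom_id N) (res_d P i))
           (tensor_map (rhom_id N) (res_out P i)).

Definition Ext_of T (P : resolution T) (V : left_module) (i : nat) : lmodType k :=
  homology (precomp V (res_out P i)) (precomp V (res_d P i)).

Section Cover.
Variable V : left_module.

Definition cover_basis y := {x : C & (V x * hom x y)%type}.
Definition cover_ob y : lmodType k := free_lmod k (cover_basis y).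
Definition basis_act y z (f : hom y z) (b : cover_basis y) : cover_basis z :=
  existT _ (projT1 b) ((projT2 b).1, cmp f (projT2 b).2).
Definition cover_act y z (f : hom y z) : {linear cover_ob y -> cover_ob z} :=
  free_map k (basis_act f).
Fact cover_act1 y u : cover_act (idm y) u = u.
Proof.
apply: (free_ext (g := idfun)) => -[x [v f]].
by rewrite /cover_act free_map_delta /basis_act /= cmp1m.
Qed.
Fact cover_actM x y z (g : hom y z) (f : hom x y) u :
  cover_act (cmp g f) u = cover_act g (cover_act f u).
Proof.
apply: (free_ext (g := cover_act g \o cover_act f)) => -[t [v h]].
rewrite -[RHS]/(cover_act g (cover_act f _)) /cover_act !free_map_delta.
by rewrite /basis_act /= cmpA.
Qed.
(* The sum of the modules [kC e_x] over all objects [x] and elements of [V x]. *)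
Definition cover : left_module := LeftModule cover_act1 cover_actM.

Section CoverHom.
Variables (W : left_module) (w : forall x, V x -> W x).
Definition cover_hom_fun y : {linear cover_ob y -> W y} :=
  free_lift (fun b : cover_basis y => lact (projT2 b).2 (w (projT2 b).1)).
Fact cover_hom_nat y z (f : hom y z) (u : cover y) :
  cover_hom_fun z (lact f u) = lact f (cover_hom_fun y u).
Proof.
apply: (free_ext (f := cover_hom_fun z \o cover_act f)
                 (g := lact f \o cover_hom_fun y)) => -[x [v h]].
rewrite -[RHS]/(lact f _) -[LHS]/(free_lift _ (free_map k (basis_act f) _)).
by rewrite free_map_delta !free_lift_delta /= lactM.
Qed.
Definition cover_hom : lhom cover W :=
  @LHom cover W cover_hom_fun (fun y => linearP (cover_hom_fun y)) cover_hom_nat.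
End CoverHom.
Definition cover_unit x (v : V x) : cover x := delta k (existT _ x (v, idm x)).
Lemma cover_homE W w x v : @cover_hom W w x (cover_unit v) = w x v.
Proof. by rewrite -[LHS]/(free_lift _ _) free_lift_delta /= lact1. Qed.
Lemma cover_ext W (f g : lhom cover W) :
  (forall x (v : V x), f x (cover_unit v) = g x (cover_unit v)) -> f = g.
Proof.
move=> fg; apply: lhomP => y; apply: (free_ext (f := llin f y) (g := llin g y)).
move=> [x [v h]]; have -> : delta k (existT _ x (v, h)) = lact (l := cover) h (cover_unit v).
  by rewrite -[RHS]/(free_map k (basis_act h) _) free_map_delta /basis_act /= cmpm1.
by rewrite -[LHS]/(f y _) -[RHS]/(g y _) !lfun_nat fg.
Qed.

Definition cover_aug : lhom cover V := cover_hom (fun x v => v).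
Lemma cover_aug_surj x v : exists u, cover_aug x u = v.
Proof. by exists (cover_unit v); rewrite cover_homE. Qed.

Lemma cover_projective : projective cover.
Proof.
move=> W U p f psurj.
have [g gE] : exists g : forall x, V x -> W x, forall x v, p x (g x v) = f x (cover_unit v).
  by exists (fun x v => sval (cid (psurj x (f x (cover_unit v))))) => x v; case: cid.
by exists (cover_hom g); apply: cover_ext => x v; rewrite -gE -[g x v]cover_homE.
Qed.
End Cover.

Section StdResolution.
Variable V : left_module.
(* The kernels of the successive covers; [syzygy 0] is [V] itself. *)
Definition syzygy (i : nat) : left_module :=
  iter i (fun W => sub_mod (ker_mod (cover_aug W))) V.
Definition std_d i : lhom (cover (syzygy i.+1)) (cover (syzygy i)) :=
  lhom_comp (sub_mod_incl _) (cover_aug (syzygy i.+1)).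
Fact std_d_ker i x u : cover_aug (syzygy i) x u = 0 <-> exists w, std_d i x w = u.
Proof.
split=> [u0|[w <-]]; last first.
  exact: (proj1 (kerE (llin (cover_aug (syzygy i)) x) _) (sub_valP _)).
have uK : u \in ker (llin (cover_aug (syzygy i)) x) by apply/kerE.
have [w wE] := cover_aug_surj (V := syzygy i.+1) (SubMk uK : syzygy i.+1 x).
by exists w; apply: (congr1 (sub_incl _) wE).
Qed.
Fact std_exactS i x u : std_d i x u = 0 <-> exists w, std_d i.+1 x w = u.
Proof.
rewrite -std_d_ker; split=> [u0|u0]; first exact: val_inj.
exact: etrans (congr1 (sub_incl _) u0) (linear0 _).
Qed.
Definition std_resolution : resolution V :=
  @Resolution V (fun i => cover (syzygy i)) std_d (cover_aug V)
    (fun i => @cover_projective (syzygy i)) (@cover_aug_surj V)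
    (@std_d_ker 0) std_exactS.
End StdResolution.

Definition Tor (i : nat) (N : right_module) (V : left_module) : lmodType k :=
  Tor_of (std_resolution V) N i.
Definition Ext (i : nat) (T V : left_module) : lmodType k :=
  Ext_of (std_resolution T) V i.
End Modules.
Arguments lact {k C l x y} _.
Arguments ract {k C r x y} _.
Arguments lfun {k C V W} _ _ _.
Arguments rfun {k C M N} _ _ _.

Section EndCat.
Variables (k : comPzRingType) (C : category).

(* The one-object category with endomorphisms [hom x x]; its left modules are
   the left [k[hom x x]]-modules. *)
Definition end_cat (x : C) : category :=
  @Category unit (fun _ _ => hom x x) (fun _ => idm x) (fun _ _ _ => @cmp C x x x)
    (fun _ _ => @cmp1m C x x) (fun _ _ => @cmpm1 C x x)
    (fun _ _ _ _ => @cmpA C x x x x).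

Section FreeHom.
Variables x y : C.
Definition hom_act (s : hom x x) : {linear free_lmod k (hom x y) -> free_lmod k (hom x y)} :=
  free_map k (fun f => cmp f s).
Fact hom_act1 u : hom_act (idm x) u = u.
Proof.
by apply: (free_ext (g := idfun)) => f; rewrite /hom_act free_map_delta cmpm1.
Qed.
Fact hom_actM s t u : hom_act (cmp s t) u = hom_act t (hom_act s u).
Proof.
apply: (free_ext (g := hom_act t \o hom_act s)) => f.
by rewrite -[RHS]/(hom_act t (hom_act s _)) /hom_act !free_map_delta cmpA.
Qed.
(* [k[hom x y]] as a right [k[hom x x]]-module. *)
Definition free_hom : right_module k (end_cat x) :=
  @RightModule k (end_cat x) (fun _ => free_lmod k (hom x y))
    (fun _ _ => hom_act) (fun _ => hom_act1) (fun _ _ _ => hom_actM).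
End FreeHom.

Section PostComp.
Variables (x y z : C) (g : hom y z).
Definition post_fun : {linear free_lmod k (hom x y) -> free_lmod k (hom x z)} :=
  free_map k (cmp g).
Fact post_nat (s : hom x x) u : post_fun (hom_act y s u) = hom_act z s (post_fun u).
Proof.
apply: (free_ext (f := post_fun \o hom_act y s) (g := hom_act z s \o post_fun)) => f.
rewrite -[LHS]/(post_fun (hom_act y s _)) -[RHS]/(hom_act z s (post_fun _)).
by rewrite /post_fun /hom_act !free_map_delta cmpA.
Qed.
Definition post : rhom (free_hom x y) (free_hom x z) :=
  @RHom k (end_cat x) (free_hom x y) (free_hom x z) (fun _ => post_fun)
    (fun _ => linearP post_fun) (fun _ _ => post_nat).
End PostComp.

Section Basic.
Variables (x : C) (W : left_module k (end_cat x)).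
Definition basic_act y z (g : hom y z) :
    {linear tensor (free_hom x y) W -> tensor (free_hom x z) W} :=
  tensor_map (post x g) (lhom_id W).
Lemma free_hom_pure_ext y (U : lmodType k) (f g : {linear tensor (free_hom x y) W -> U}) :
  (forall (h : hom x y) w, f (@pure _ _ (free_hom x y) W tt (delta k h) w)
    = g (@pure _ _ (free_hom x y) W tt (delta k h) w)) -> f =1 g.
Proof.
move=> fg; apply: tensor_ext => -[] n w.
pose p := mk_linear (@pureL k (end_cat x) (free_hom x y) W tt w).
by apply: (free_ext (f := f \o p) (g := g \o p)) => h; apply: fg.
Qed.
Fact basic_act1 y v : basic_act (idm y) v = v.
Proof.
apply: (free_hom_pure_ext (g := idfun)) => h w.
rewrite /basic_act tensor_mapE -[RHS]/(pure _ _); congr (pure _ _).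
by rewrite -[LHS]/(free_map k (cmp (idm y)) _) free_map_delta cmp1m.
Qed.
Fact basic_actM y z t (g : hom z t) (f : hom y z) v :
  basic_act (cmp g f) v = basic_act g (basic_act f v).
Proof.
apply: (free_hom_pure_ext (g := basic_act g \o basic_act f)) => h w.
rewrite -[RHS]/(basic_act g (basic_act f _)) /basic_act !tensor_mapE.
by congr (pure _ _); rewrite -[LHS]/(free_map k (cmp (cmp g f)) _)
  -[RHS]/(free_map k (cmp g) (free_map k (cmp f) _)) !free_map_delta cmpA.
Qed.
(* [M(W)], with [M(W) y = k[hom x y]] tensored with [W] over [k[hom x x]]. *)
Definition basic : left_module k C := LeftModule basic_act1 basic_actM.
End Basic.
End EndCat.

Section FI.
Variable gT : finGroupType.

Definition FI_hom (n m : nat) : Type :=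
  {p : {ffun 'I_n -> 'I_m} * {ffun 'I_n -> gT} | injectiveb p.1}.
Definition FI_inj n m (p : FI_hom n m) : {ffun 'I_n -> 'I_m} := (val p).1.
Definition FI_lab n m (p : FI_hom n m) : {ffun 'I_n -> gT} := (val p).2.

Lemma FI_homP n m (p q : FI_hom n m) :
  FI_inj p =1 FI_inj q -> FI_lab p =1 FI_lab q -> p = q.
Proof.
case: p q => [[f g] fi] [[f' g'] fi'] /= ff gg; apply/val_inj => /=.
by congr (_, _); apply/ffunP.
Qed.

Fact FI_id_inj n : injectiveb [ffun x : 'I_n => x].
Proof. by apply/injectiveP => x y; rewrite !ffunE. Qed.
Definition FI_id n : FI_hom n n := exist _ ([ffun x => x], [ffun=> 1%g]) (FI_id_inj n).

Fact FI_comp_inj l n m (p : FI_hom n m) (q : FI_hom l n) :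
  injectiveb [ffun x => FI_inj p (FI_inj q x)].
Proof.
apply/injectiveP => x y; rewrite !ffunE.
by move=> /(injectiveP _ (valP p)) /(injectiveP _ (valP q)).
Qed.
Definition FI_comp l n m (p : FI_hom n m) (q : FI_hom l n) : FI_hom l m :=
  exist _ ([ffun x => FI_inj p (FI_inj q x)],
           [ffun x => (FI_lab q x * FI_lab p (FI_inj q x))%g]) (FI_comp_inj p q).

Fact FI_comp1m n m (p : FI_hom n m) : FI_comp (FI_id m) p = p.
Proof. by apply: FI_homP => x; rewrite /= !ffunE ?mulg1. Qed.
Fact FI_compm1 n m (p : FI_hom n m) : FI_comp p (FI_id n) = p.
Proof. by apply: FI_homP => x; rewrite /= !ffunE ?mul1g. Qed.
Fact FI_compA i j l m (p : FI_hom l m) (q : FI_hom j l) (r : FI_hom i j) :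
  FI_comp p (FI_comp q r) = FI_comp (FI_comp p q) r.
Proof. by apply: FI_homP => x; rewrite /= !ffunE //= mulgA. Qed.

Definition FI : category := Category FI_comp1m FI_compm1 FI_compA.

Lemma FI_hom_leq n m (p : FI_hom n m) : (n <= m)%N.
Proof. by have := leq_card _ (injectiveP _ (valP p)); rewrite !card_ord. Qed.

Section Modules.
Variable k : comPzRingType.

(* [kG_s] in degree [m] is free on the morphisms [s -> m] if [m = s], and zero
   otherwise; a morphism acts by composition if this stays in degree [s], and
   by zero otherwise. *)
Section LeftGroupModule.
Variable s : nat.
Definition kGl_basis (m : nat) : Type := {f : FI_hom s m | m == s}.
Definition kGl_act m m' (a : FI_hom m m') :
    {linear free_lmod k (kGl_basis m) -> free_lmod k (kGl_basis m')} :=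
  free_lift (fun b => oapp (@delta k _) 0
    (insub (FI_comp a (val b)) : option (kGl_basis m'))).
Fact kGl_act1 m u : kGl_act (FI_id m) u = u.
Proof.
apply: (free_ext (g := idfun)) => b.
by rewrite /kGl_act free_lift_delta FI_comp1m valK.
Qed.
Fact kGl_actM m1 m2 m3 (a : FI_hom m2 m3) (b : FI_hom m1 m2) u :
  kGl_act (FI_comp a b) u = kGl_act a (kGl_act b u).
Proof.
apply: (free_ext (g := kGl_act a \o kGl_act b)) => -[f m1s].
rewrite -[RHS]/(kGl_act a (kGl_act b _)) /kGl_act !free_lift_delta.
case/orP: (orbN (m2 == s)) => m2s.
  by rewrite (insubT (fun _ => m2 == s) m2s) [oapp _ _ (Some _)]/= free_lift_delta
    FI_compA.
rewrite (@insubN _ (fun _ => m2 == s) _ _ m2s) [oapp _ _ None]/= linear0 insubN//.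
apply: contra m2s => /eqP m3s; rewrite eqn_leq -{1}m3s (FI_hom_leq a).
by rewrite -(eqP m1s) (FI_hom_leq b).
Qed.
Definition kGl : left_module k FI :=
  @LeftModule k FI (fun m => free_lmod k (kGl_basis m)) kGl_act kGl_act1 kGl_actM.
End LeftGroupModule.

Section RightGroupModule.
Variable s : nat.
Definition kGr_basis (n : nat) : Type := {f : FI_hom n s | n == s}.
Definition kGr_act n n' (a : FI_hom n n') :
    {linear free_lmod k (kGr_basis n') -> free_lmod k (kGr_basis n)} :=
  free_lift (fun b => oapp (@delta k _) 0
    (insub (FI_comp (val b) a) : option (kGr_basis n))).
Fact kGr_act1 n u : kGr_act (FI_id n) u = u.
Proof.
apply: (free_ext (g := idfun)) => b.
by rewrite /kGr_act free_lift_delta FI_compm1 valK.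
Qed.
Fact kGr_actM n1 n2 n3 (a : FI_hom n2 n3) (b : FI_hom n1 n2) u :
  kGr_act (FI_comp a b) u = kGr_act b (kGr_act a u).
Proof.
apply: (free_ext (g := kGr_act b \o kGr_act a)) => -[f n3s].
rewrite -[RHS]/(kGr_act b (kGr_act a _)) /kGr_act !free_lift_delta.
case/orP: (orbN (n2 == s)) => n2s.
  by rewrite (insubT (fun _ => n2 == s) n2s) [oapp _ _ (Some _)]/= free_lift_delta
    FI_compA.
rewrite (@insubN _ (fun _ => n2 == s) _ _ n2s) [oapp _ _ None]/= linear0 insubN//.
apply: contra n2s => /eqP n1s; rewrite eqn_leq -{2}n1s (FI_hom_leq b).
by rewrite -(eqP n3s) (FI_hom_leq a).
Qed.
Definition kGr : right_module k FI :=
  @RightModule k FI (fun n => free_lmod k (kGr_basis n)) kGr_act kGr_act1 kGr_actM.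
End RightGroupModule.

Implicit Types V : left_module k FI.

Definition finitely_generated V : Prop :=
  exists s : seq {n : nat & V n}, forall S : submodule V,
    (forall p, p \in s -> projT2 p \in S (projT1 p)) -> forall n v, v \in S n.

Definition torsion V : Prop :=
  forall (n : FI) (v : V n),
    exists (m : FI) (f : hom n m), ((n : nat) < m)%N /\ lact f v = 0.

(* [F i] is the term of index [i - 1] of the filtration. *)
Definition sharp_filtered V : Prop :=
  exists (r : nat) (F : nat -> submodule V),
    [/\ forall n v, v \in F 0 n <-> v = 0,
        forall n v, v \in F r.+1 n,
        forall i, (i <= r)%N -> forall n v, v \in F i n -> v \in F i.+1 n
      & forall i, (i <= r)%N -> exists W : left_module k (end_cat (i : FI)),
          liso (subquotient (F i.+1) (F i)) (basic W)].
End Modules.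
End FI.

Definition noetherian (k : comPzRingType) : Prop :=
  forall I : submodClosed (k^o : lmodType k),
    exists s : seq k^o, I =i span (fun x => x \in s).

Definition is_zero (k : comPzRingType) (M : lmodType k) : Prop :=
  forall x : M, x = 0.

(* Main.v *)
(* The equation Tor_1(kG_s, V) = 0 for all s says that m (x) - keeps short exact
   sequences ending in V left exact. A module generated in one degree n with this
   property is M(V_n), and truncating by generation degree peels such quotients
   off V; since M(W) is Tor-acyclic, this gives the equivalence with (1) and (2).

   Let Sigma V be the shift of V and D V the cokernel of V -> Sigma V. For V = M(W)
   with W in degree n, the map V -> Sigma V is injective and D V is again of the
   form M(W') in degree n - 1. If T vanishes in large degrees, T -> Sigma^N T is
   zero for large N, hence Ext(T, V) -> Ext(T, Sigma^N V) is zero; for filtered V it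
   is also injective, by induction on the generation degree applied to D V. So
   filtered modules satisfy (4) and (5).

   Conversely, for V finitely generated Sigma^N V is filtered for large N: by
   noetherianity V -> Sigma V becomes injective after shifting, and if D V is
   filtered and V -> Sigma V injective then V is filtered. Under (4), V embeds in
   Sigma^N V with a cokernel of smaller generation degree which still satisfies
   (4), so V is filtered by induction. Finally (3) says that some finitely
   generated syzygy of V is filtered, so that V satisfies (4). *)
From HB Require Import structures.
From mathcomp Require Import all_boot all_algebra fingroup perm.
From mathcomp Require Import boolp.
Require Import Defs.

Set Implicit Arguments.
Unset Strict Implicit.
Unset Printing Implicit Defensive.

Import GRing.Theory.
Local Open Scope ring_scope.

(** * Exact sequences *)

(** Tensoring V with kG_s leaves V_s modulo the images of morphisms from lower degrees. Tor is
    therefore handled through [decomposable] elements and through all presentations at once; the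
    resolution by covers, whose terms need not be finitely generated, returns only in a final
    comparison. Noetherianity is proved by induction on the degree n of M(W): M(W) is a direct
    summand of its shift, with a complement that embeds in D M(W). Projecting the shift of a
    submodule X back to M(W) enlarges X, and after finitely many rounds the result is generated by
    its part in degree n. Two facts drive the inductions on the generation degree. D lowers it by
    one, since a morphism that misses the new point dies in D V and one that hits it loses a point
    of its source; and D preserves exactness as soon as the quotient embeds in its shift. Condition
    (3) says nothing about V directly. Along a presentation K -> P -> V with P free and finitely
    generated, K is finitely generated and satisfies the condition for i - 1; once K is filtered, K
    and P satisfy (4), hence so does V. *)

Lemma quot_pi_eq0 (k : comPzRingType) (V : lmodType k) (S : submodClosed V) v :
  quot_pi S v = 0 <-> v \in S.
Proof. by rewrite -(linear0 (quot_pi S)) -[X in X <-> _]/(quot_pr _ v = _) quot_prP subr0. Qed.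

Section Exactness.
Variables (k : comPzRingType) (C : category).
Implicit Types A B P Q U V W : left_module k C.

Lemma lhomB V W (f : lhom V W) x u v : f x (u - v) = f x u - f x v.
Proof. exact: (linearB (llin f x)). Qed.
Lemma lhomD V W (f : lhom V W) x u v : f x (u + v) = f x u + f x v.
Proof. exact: (linearD (llin f x)). Qed.
Lemma lhomN V W (f : lhom V W) x u : f x (- u) = - f x u.
Proof. exact: (linearN (llin f x)). Qed.
Lemma lhomL V W (f : lhom V W) x a u v : f x (a *: u + v) = a *: f x u + f x v.
Proof. exact: (linearP (llin f x)). Qed.
Lemma lhom0E V W (f : lhom V W) x : f x 0 = 0.
Proof. exact: (linear0 (llin f x)). Qed.

Definition injective_hom V W (f : lhom V W) := forall x v, f x v = 0 -> v = 0.
Definition surjective_hom V W (f : lhom V W) := forall x w, exists v, f x v = w.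
Definition exact_at V W U (f : lhom V W) (g : lhom W U) :=
  forall x w, g x w = 0 <-> exists v, f x v = w.

Record ses A B D (f : lhom A B) (g : lhom B D) : Prop := Ses {
  ses_inj : injective_hom f;
  ses_exact : exact_at f g;
  ses_surj : surjective_hom g }.

Lemma injective_homP V W (f : lhom V W) :
  injective_hom f -> forall x, injective (f x).
Proof.
move=> fi x u v uv; apply/eqP; rewrite -subr_eq0; apply/eqP/(fi x).
by rewrite lhomB uv subrr.
Qed.

Lemma exact_comp0 V W U (f : lhom V W) (g : lhom W U) :
  exact_at f g -> forall x v, g x (f x v) = 0.
Proof. by move=> fg x v; apply/fg; exists v. Qed.

Lemma lhom_compA V W U X (h : lhom U X) (g : lhom W U) (f : lhom V W) :
  lhom_comp h (lhom_comp g f) = lhom_comp (lhom_comp h g) f.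
Proof. exact: lhomP. Qed.

Lemma lhom_eqE V W (f g : lhom V W) : f = g -> forall x v, f x v = g x v.
Proof. by move->. Qed.

Lemma ker_ses V W (g : lhom V W) : surjective_hom g ->
  ses (sub_mod_incl (ker_mod g)) g.
Proof.
move=> gs; split=> // [x v v0|x w]; first exact: val_inj.
split=> [w0|[v <-]]; last exact: (proj1 (kerE (llin g x) _) (sub_valP v)).
by exists (SubMk (proj2 (kerE (llin g x) w) w0)).
Qed.

Definition quot_hom V (S : submodule V) : lhom V (quot_mod S) :=
  @LHom k C V (quot_mod S) (fun x => quot_pi (S x)) (fun x => linearP (quot_pi (S x)))
    (fun x y f v => esym (quot_actE S f v)).

Lemma quot_hom_surj V (S : submodule V) : surjective_hom (quot_hom S).
Proof. by move=> x; apply: quot_ind => v; exists v. Qed.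

Lemma quot_homP V (S : submodule V) x v : quot_hom S x v = 0 <-> v \in S x.
Proof. exact: quot_pi_eq0. Qed.

Lemma quot_ses V (S : submodule V) : ses (sub_mod_incl S) (quot_hom S).
Proof.
split=> [x v v0|x w|]; [exact: val_inj| |exact: quot_hom_surj].
rewrite quot_homP; split=> [wS|[v <-]]; last exact: sub_valP.
by exists (SubMk wS).
Qed.

Section Factor.
Variables (V W U : left_module k C) (f : lhom V W) (g : lhom U W).
Hypotheses (fi : injective_hom f) (gf : forall x u, exists v, f x v = g x u).
Definition factor_fun x u := sval (cid (gf (x := x) u)).
Lemma factor_funE x u : f x (factor_fun u) = g x u.
Proof. by rewrite /factor_fun; case: cid. Qed.
Fact factor_linear x : linear (@factor_fun x).
Proof. by move=> a u v; apply: (injective_homP fi); rewrite lhomL !factor_funE lhomL. Qed.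
Fact factor_nat x y (h : hom x y) u : factor_fun (lact h u) = lact h (factor_fun u).
Proof. by apply: (injective_homP fi); rewrite lfun_nat !factor_funE lfun_nat. Qed.
Definition factor : lhom U V := LHom factor_linear factor_nat.
Lemma factorE x u : f x (factor x u) = g x u.
Proof. exact: factor_funE. Qed.
End Factor.

(** [f] is in general not onto [W], so projectivity is applied to its corestriction to the kernel of
    [g], which is surjective by exactness. *)
Lemma lift_exact P V W U (f : lhom V W) (g : lhom W U) (h : lhom P W) :
  projective P -> exact_at f g -> (forall x u, g x (h x u) = 0) ->
  exists h', lhom_comp f h' = h.
Proof.
move=> Pproj fg gh.
pose i := sub_mod_incl (ker_mod g).
have ii : injective_hom i by move=> x v v0; apply: val_inj.
have iV x v : exists u, i x u = f x v.
  by exists (SubMk (proj2 (kerE (llin g x) _) (exact_comp0 fg v))).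
have iP x v : exists u, i x u = h x v.
  by exists (SubMk (proj2 (kerE (llin g x) _) (gh x v))).
have [|h' h'E] := Pproj _ _ (factor ii iV) (factor ii iP).
  move=> x w; have [v vE] := proj1 (fg x _) (proj1 (kerE (llin g x) _) (sub_valP w)).
  by exists v; apply: (injective_homP ii); rewrite factorE vE.
exists h'; apply: lhomP => x v /=.
by rewrite -[LHS](factorE ii iV) (lhom_eqE h'E v : factor ii iV x _ = _) factorE.
Qed.

Section Product.
Variables V W : left_module k C.
Fact prod_act_linear x y (f : hom x y) :
  linear (fun p : V x * W x => (lact f p.1, lact f p.2) : V y * W y).
Proof. by move=> a [u v] [u' v']; rewrite /= !linearP. Qed.
Definition prod_act x y (f : hom x y) := mk_linear (prod_act_linear f).
Fact prod_act1 x (p : V x * W x) : prod_act (idm x) p = p.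
Proof. by case: p => u v; rewrite /= !lact1. Qed.
Fact prod_actM x y z (g : hom y z) (f : hom x y) (p : V x * W x) :
  prod_act (cmp g f) p = prod_act g (prod_act f p).
Proof. by rewrite /= !lactM. Qed.
Definition prod_mod : left_module k C :=
  @LeftModule k C (fun x => (V x * W x)%type) prod_act prod_act1 prod_actM.

Definition pr1_mod : lhom prod_mod V :=
  @LHom k C prod_mod V (fun x => fst) (fun x a u v => erefl) (fun x y f v => erefl).
Definition pr2_mod : lhom prod_mod W :=
  @LHom k C prod_mod W (fun x => snd) (fun x a u v => erefl) (fun x y f v => erefl).

Section Pair.
Variables (U : left_module k C) (f : lhom U V) (g : lhom U W).
Fact pair_linear x : linear (fun u => (f x u, g x u) : prod_mod x).
Proof. by move=> a u v; rewrite !lhomL. Qed.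
Fact pair_nat x y (h : hom x y) u :
  (f y (lact h u), g y (lact h u)) = lact h ((f x u, g x u) : prod_mod x).
Proof. by rewrite !lfun_nat. Qed.
Definition pair_hom : lhom U prod_mod := LHom pair_linear pair_nat.
End Pair.

Definition copair_hom U (f : lhom V U) (g : lhom W U) : lhom prod_mod U :=
  lhom_comp f pr1_mod + lhom_comp g pr2_mod.

Lemma prod_projective : projective V -> projective W -> projective prod_mod.
Proof.
move=> Vp Wp A B p f ps.
have [g gE] := Vp _ _ p (lhom_comp f (pair_hom (lhom_id V) 0)) ps.
have [h hE] := Wp _ _ p (lhom_comp f (pair_hom 0 (lhom_id W))) ps.
exists (copair_hom g h); apply: lhomP => x [v w] /=.
have E1 : p x (g x v) = f x (v, 0) by apply: (lhom_eqE gE).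
have E2 : p x (h x w) = f x (0, w) by apply: (lhom_eqE hE).
rewrite -[LHS]/(p x (g x v + h x w)) lhomD E1 E2 -lhomD.
by congr (f x (_, _)); rewrite ?addr0 ?add0r.
Qed.
End Product.

Lemma projective_retract P Q (i : lhom Q P) (r : lhom P Q) :
  (forall x v, r x (i x v) = v) -> projective P -> projective Q.
Proof.
move=> ri Pp V W p f ps; have [g gE] := Pp _ _ p (lhom_comp f r) ps.
exists (lhom_comp g i); apply: lhomP => x v /=.
by rewrite (lhom_eqE gE (i x v) : p x _ = _) /= ri.
Qed.

Lemma ses_split P A B (f : lhom A B) (g : lhom B P) : ses f g -> projective P ->
  exists (s : lhom P B) (r : lhom B A), [/\ forall x v, g x (s x v) = v,
    forall x v, r x (f x v) = v & forall x v, f x (r x v) = v - s x (g x v)].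
Proof.
move=> [fi fg gs] Pp; have [s sE] := Pp _ _ g (lhom_id P) gs.
have {}sE x v : g x (s x v) = v by apply: (lhom_eqE sE).
pose h : lhom B B := lhom_id B - lhom_comp s g.
have hE x v : h x v = v - s x (g x v) by [].
have hf x v : exists u, f x u = h x v.
  by apply/fg; rewrite hE lhomB sE subrr.
exists s, (factor fi hf); split=> // x v; last by rewrite factorE.
by apply: (injective_homP fi); rewrite factorE hE (exact_comp0 fg) lhom0E subr0.
Qed.

Lemma ses_projective P A B (f : lhom A B) (g : lhom B P) : ses f g ->
  projective P -> projective B -> projective A.
Proof. by move=> s Pp; have [_ [r [_ rf _]]] := ses_split s Pp; apply: projective_retract rf. Qed.

Section Pullback.
Variables (U U' W : left_module k C) (g : lhom U W) (g' : lhom U' W).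
Definition pullback_eq : lhom (prod_mod U U') W := copair_hom g (- g').
Definition pullback := sub_mod (ker_mod pullback_eq).
Definition pullback1 : lhom pullback U := lhom_comp (pr1_mod U U') (sub_mod_incl _).
Definition pullback2 : lhom pullback U' := lhom_comp (pr2_mod U U') (sub_mod_incl _).
Lemma pullbackP x (u : pullback x) : g x (pullback1 x u) = g' x (pullback2 x u).
Proof. by have /kerE/eqP := sub_valP u; rewrite subr_eq0 => /eqP. Qed.
Lemma pullback_ex x u u' : g x u = g' x u' ->
  exists v : pullback x, pullback1 x v = u /\ pullback2 x v = u'.
Proof.
move=> uu'; have H : ((u, u') : prod_mod U U' x) \in ker (llin pullback_eq x).
  by apply/kerE; rewrite /= -[LHS]/(g x u - g' x u') uu' subrr.
by exists (SubMk H).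
Qed.
Lemma pullback_eq0 x (v : pullback x) : pullback1 x v = 0 -> pullback2 x v = 0 -> v = 0.
Proof.
case: v => -[u u'] uP; rewrite /pullback1 /pullback2 /= => u0 u'0.
by apply: val_inj; rewrite /= u0 u'0.
Qed.
Section Lift.
Variables (A : left_module k C) (a : lhom A U) (a' : lhom A U').
Hypothesis aa' : forall x v, g x (a x v) = g' x (a' x v).
Fact pullback_lift_ex : exists l : lhom A pullback,
  (forall x v, pullback1 x (l x v) = a x v) /\ (forall x v, pullback2 x (l x v) = a' x v).
Proof.
have ii : injective_hom (sub_mod_incl (ker_mod pullback_eq)) by move=> x v v0; apply: val_inj.
have H x v : exists u, sub_mod_incl (ker_mod pullback_eq) x u = pair_hom a a' x v.
  by have [u [u1 u2]] := pullback_ex (aa' v); exists u; rewrite /= -u1 -u2; case: u {u1 u2} => -[].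
exists (factor ii H); split=> x v; first exact: (congr1 fst (factorE ii H v)).
exact: (congr1 snd (factorE ii H v)).
Qed.
End Lift.
(** Base change does not alter the kernel. Together with [pullback_ses1] this lets two presentations
    of one module be compared through their pullback. *)
Lemma pullback_ses2 K (f : lhom K U) : ses f g -> surjective_hom g' ->
  exists f' : lhom K pullback, ses f' pullback2 /\ forall x v, pullback1 x (f' x v) = f x v.
Proof.
move=> [fi fg gs] g's; have [|f' [f1 f2]] := @pullback_lift_ex K f 0.
  by move=> x v; rewrite (exact_comp0 fg) -[RHS]/(g' x 0) lhom0E.
exists f'; split=> //; split.
- by move=> x v f'v0; apply: (fi x); rewrite -f1 f'v0 lhom0E.
- move=> x w; split=> [w0|[v <-]]; last exact: f2.
  have /fg[v vE] : g x (pullback1 x w) = 0 by rewrite pullbackP w0 lhom0E.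
  exists v; apply/eqP; rewrite -subr_eq0; apply/eqP/pullback_eq0.
    by rewrite lhomB f1 vE subrr.
  by rewrite lhomB f2 w0 subr0.
- move=> x u'; have [u uE] := gs x (g' x u').
  by have [v [_ v2]] := pullback_ex uE; exists v.
Qed.
Lemma pullback_ses1 K (f : lhom K U') : ses f g' -> surjective_hom g ->
  exists f' : lhom K pullback, ses f' pullback1 /\ forall x v, pullback2 x (f' x v) = f x v.
Proof.
move=> [fi fg gs] g's; have [|f' [f1 f2]] := @pullback_lift_ex K 0 f.
  by move=> x v; rewrite (exact_comp0 fg) -[LHS]/(g x 0) lhom0E.
exists f'; split=> //; split.
- by move=> x v f'v0; apply: (fi x); rewrite -f2 f'v0 lhom0E.
- move=> x w; split=> [w0|[v <-]]; last exact: f1.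
  have /fg[v vE] : g' x (pullback2 x w) = 0 by rewrite -pullbackP w0 lhom0E.
  exists v; apply/eqP; rewrite -subr_eq0; apply/eqP/pullback_eq0.
    by rewrite lhomB f1 w0 subr0.
  by rewrite lhomB f2 vE subrr.
- move=> x u'; have [u uE] := gs x (g x u').
  by have [v [v1 _]] := pullback_ex (esym uE); exists v.
Qed.
End Pullback.


End Exactness.

(** * Vanishing of Tor *)

Section Homology.
Variables (k : comPzRingType) (gT : finGroupType).
Notation module := (left_module k (FI gT)).
Implicit Types A B D K P Q U V W : module.

(* [decomposable v] says that [v] lies in [m V]. *)
Inductive decomposable V (s : nat) : V s -> Prop :=
| Decomposable0 : decomposable (0 : V s)
| DecomposableS n (f : @hom (FI gT) n s) (u : V n) v : (n < s)%N ->
    decomposable v -> decomposable (lact f u + v).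

Section Decomposable.
Variable V : module.
Lemma decomposable_act n s (f : @hom (FI gT) n s) (u : V n) :
  (n < s)%N -> @decomposable V s (lact f u).
Proof. by move=> ns; rewrite -[lact f u]addr0; apply: DecomposableS => //; apply: Decomposable0. Qed.
Lemma decomposableD s (u v : V s) :
  decomposable u -> decomposable v -> decomposable (u + v).
Proof.
move=> du dv; elim: du => [|n f w u' ns _ IH]; first by rewrite add0r.
by rewrite -addrA; apply: DecomposableS.
Qed.
Lemma decomposableZ s a (u : V s) : decomposable u -> decomposable (a *: u).
Proof.
elim=> [|n f w u' ns _ IH]; first by rewrite scaler0; apply: Decomposable0.
by rewrite scalerDr -linearZ; apply: DecomposableS.
Qed.
Lemma decomposableN s (u : V s) : decomposable u -> decomposable (- u).
Proof. by rewrite -scaleN1r; apply: decomposableZ. Qed.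
Lemma decomposableB s (u v : V s) :
  decomposable u -> decomposable v -> decomposable (u - v).
Proof. by move=> du dv; apply: decomposableD => //; apply: decomposableN. Qed.
Lemma decomposable_lact s t (g : @hom (FI gT) s t) (u : V s) : 
  decomposable u -> @decomposable V t (lact g u).
Proof.
elim=> [|n f w u' ns _ IH]; first by rewrite linear0; apply: Decomposable0.
rewrite linearD -lactM; apply: DecomposableS => //.
exact: leq_trans ns (FI_hom_leq g).
Qed.
End Decomposable.

Lemma decomposable_hom V W (f : lhom V W) s (v : V s) :
  decomposable v -> decomposable (f s v).
Proof.
elim=> [|n h u w ns _ IH]; first by rewrite lhom0E; apply: Decomposable0.
by rewrite lhomD lfun_nat; apply: DecomposableS.
Qed.

Lemma decomposable_lift V W (f : lhom V W) s (w : W s) : surjective_hom f ->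
  decomposable w -> exists2 v, decomposable v & f s v = w.
Proof.
move=> fs; elim=> [|n h u w' ns _ [v dv fv]].
  by exists 0; [apply: Decomposable0|rewrite lhom0E].
have [u' u'E] := fs _ u; exists (lact h u' + v).
  exact: DecomposableS.
by rewrite lhomD lfun_nat u'E fv.
Qed.

(* Generation in degrees less than [d], by Nakayama's lemma. *)
Definition generated_lt (d : nat) V :=
  forall s (v : V s), (d <= s)%N -> decomposable v.

Lemma generated_lt0 V : generated_lt 0 V -> forall s (v : V s), v = 0.
Proof.
move=> V0; elim/ltn_ind => s IH v; elim: (V0 s v (leq0n s)) => // n f u w ns _ ->.
by rewrite (IH n ns u) linear0 addr0.
Qed.

Lemma generated_lt_surj d V W (f : lhom V W) : surjective_hom f ->
  generated_lt d V -> generated_lt d W.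
Proof.
by move=> fs gV s w ds; have [v <-] := fs s w; apply/decomposable_hom/gV.
Qed.

(* A version of [Tor_1(kG_s, V) = 0] for all [s]: as [kG_s] tensored with [V] is
   [V s] modulo the decomposable elements, it says that [m] tensored with any
   short exact sequence ending in [V] remains left exact. *)
Definition tor1_vanish V :=
  forall K U (f : lhom K U) (g : lhom U V), ses f g ->
  forall s (x : K s), decomposable (f s x) -> decomposable x.

(* [tor_vanish j V] stands for [Tor_(j+1)(kG_s, V) = 0] for all [s]. *)
Fixpoint tor_vanish (j : nat) V : Prop :=
  if j is j'.+1 then
    forall K P (f : lhom K P) (g : lhom P V), ses f g -> projective P -> tor_vanish j' K
  else tor1_vanish V.

Lemma tor_vanish_proj P j : projective P -> tor_vanish j P.
Proof.
elim: j P => [|j IH] P Pp K U f g fg.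
  move=> s x dx; have [_ [r [_ rf _]]] := ses_split fg Pp.
  by rewrite -(rf s x); apply: decomposable_hom.
by move=> Up; apply: IH; apply: ses_projective fg Pp Up.
Qed.

Lemma cover_ses V : exists Q L (f : lhom L Q) (g : lhom Q V), projective Q /\ ses f g.
Proof.
exists (cover V), _, (sub_mod_incl (ker_mod (cover_aug V))), (cover_aug V); split; first exact: cover_projective.
exact/ker_ses/cover_aug_surj.
Qed.

(* [L] is the kernel of [Q -> D] and [K'] that of [U x Q -> B]. *)
Lemma presentation_ses A B D K U (i : lhom A B) (p : lhom B D) (f : lhom K U)
    (g : lhom U A) : ses i p -> ses f g ->
  exists Q L K' (l : lhom L Q) (q : lhom Q D) (f' : lhom K' (prod_mod U Q))
    (g' : lhom (prod_mod U Q) B) (a : lhom K K') (b : lhom K' L),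
  [/\ projective Q, ses l q, ses f' g', ses a b &
    forall s x, f' s (a s x) = (f s x, 0)].
Proof.
move=> [ii ip ps] [fi fg gs]; have [Q [L [l [q [Qp lq]]]]] := cover_ses D.
have [q' q'E] := Qp _ _ _ q ps.
have {}q'E s y : p s (q' s y) = q s y by apply: (lhom_eqE q'E).
(* Horseshoe cover of [B]: [g] covers the copy of [A], and the lift [q'] of [q] reaches the rest. *)
pose h := copair_hom (lhom_comp i g) q'.
have hE s u y : h s (u, y) = i s (g s u) + q' s y by [].
have hs : surjective_hom h.
  move=> s b; have [y yE] := ses_surj lq (p s b).
  have /ip[a aE] : p s (b - q' s y) = 0 by rewrite lhomB q'E yE subrr.
  by have [u uE] := gs s a; exists (u, y); rewrite hE uE aE subrK.
have := ker_ses hs; set f' := sub_mod_incl _ => f'h.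
have [a0 aE] : exists a : lhom K (sub_mod (ker_mod h)), forall s x, f' s (a s x) = (f s x, 0).
  have H s x : exists v, f' s v = pair_hom f (0 : Hom K Q) s x.
    by apply/(ses_exact f'h); rewrite hE (exact_comp0 fg) !lhom0E addr0.
  by exists (factor (ses_inj f'h) H) => s x; apply: (factorE (ses_inj f'h) H).
have [b bE] : exists b : lhom (sub_mod (ker_mod h)) L, forall s x, l s (b s x) = (f' s x).2.
  have H s x : exists v, l s v = lhom_comp (pr2_mod U Q) f' s x.
    apply/(ses_exact lq); rewrite -[LHS]/(q s (f' s x).2); have := exact_comp0 (ses_exact f'h) x.
    case: (f' s x) => u y; rewrite hE /= => /(congr1 (p s)).
    by rewrite lhomD q'E (exact_comp0 ip) add0r lhom0E.
  by exists (factor (ses_inj lq) H) => s x; apply: (factorE (ses_inj lq) H).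
exists Q, L, _, l, q, f', h, a0, b; split=> //; split.
- by move=> s x ax0; apply: (fi s); have := aE s x; rewrite ax0 lhom0E => -[].
- move=> s x; split=> [bx0|[v <-]].
    have x2 : (f' s x).2 = 0 by rewrite -bE bx0 lhom0E.
    have e : i s (g s (f' s x).1) = 0.
      have := exact_comp0 (ses_exact f'h) x.
      by rewrite -[LHS]/(i s (g s (f' s x).1) + q' s (f' s x).2) x2 lhom0E addr0.
    move/(ii s)/fg: e => [v vE]; exists v; apply: (injective_homP (ses_inj f'h)).
    by rewrite aE vE -x2; case: (f' s x).
  by apply: (ses_inj lq); rewrite bE aE.
- move=> s y; have /ip[a aE'] : p s (q' s (l s y)) = 0.
    by rewrite q'E (exact_comp0 (ses_exact lq)).
  have [u uE] := gs s a.
  have /(ses_exact f'h)[x xE] : h s (- u, l s y) = 0.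
    by rewrite hE !lhomN uE aE' addNr.
  by exists x; apply: (injective_homP (ses_inj lq)); rewrite bE xE.
Qed.

(** The piece Tor_(j+2)(D) -> Tor_(j+1)(A) -> Tor_(j+1)(B) of the long exact sequence. The sequence
    K -> K' -> L of [presentation_ses] reduces [j.+1] to [j]; for [j = 0] decomposability is carried
    from [U] to [K'] by [B] and from [K'] to [K] by [L]. *)
Lemma tor_vanish_sub j A B D (i : lhom A B) (p : lhom B D) : ses i p ->
  tor_vanish j B -> tor_vanish j.+1 D -> tor_vanish j A.
Proof.
elim: j A B D i p => [|j IH] A B D i p ip tB tD K U f g fg.
  have [Q [L [K' [l [q [f' [g' [a [b [Qp lq fg' ab aE]]]]]]]]]] := presentation_ses ip fg.
  move=> s x dx; apply: (tD _ _ _ _ lq Qp _ _ _ _ ab); apply: (tB _ _ _ _ fg').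
  have -> : f' s (a s x) = pair_hom (lhom_id U) (0 : Hom U Q) s (f s x) by rewrite aE.
  exact: decomposable_hom.
move=> Up; have [Q [L [K' [l [q [f' [g' [a [b [Qp lq fg' ab _]]]]]]]]]] := presentation_ses ip fg.
apply: (IH _ _ _ _ _ ab); last exact: tD lq Qp.
by apply: (tB _ _ _ _ fg'); apply: prod_projective.
Qed.

(** [U'] is the preimage of [A] in [U]: the presentation of [B] splits into one of [A] by [U'] and
    one of [D] with kernel [U']. *)
Lemma ses_preim A B D U K (i : lhom A B) (p : lhom B D) (f : lhom K U) (g : lhom U B) :
  ses i p -> ses f g ->
  exists U' (i' : lhom U' U) (f' : lhom K U') (g' : lhom U' A),
    [/\ ses i' (lhom_comp p g), ses f' g' & forall s x, i' s (f' s x) = f s x].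
Proof.
move=> [ii ip ps] [fi fg gs].
have pgs : surjective_hom (lhom_comp p g).
  by move=> s d; have [b <-] := ps s d; have [u <-] := gs s b; exists u.
have := ker_ses pgs; set i' := sub_mod_incl _ => i'P.
have H1 s x : exists u, i' s u = f s x.
  by apply/(ses_exact i'P); rewrite /= (exact_comp0 fg) lhom0E.
have H2 s x : exists a, i s a = lhom_comp g i' s x.
  by apply/ip; have := exact_comp0 (ses_exact i'P) x.
exists _, i', (factor (ses_inj i'P) H1), (factor ii H2); split=> //; last first.
  by move=> s x; apply: factorE.
split.
- by move=> s x x0; apply: (fi s); rewrite -(factorE (ses_inj i'P) H1) x0 lhom0E.
- move=> s x; split=> [x0|[v <-]].
    have /fg[v vE] : g s (i' s x) = 0.
      by rewrite -[LHS]/(lhom_comp g i' s x) -(factorE ii H2) x0 lhom0E.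
    by exists v; apply: (injective_homP (ses_inj i'P)); rewrite factorE.
  by apply: (ii s); rewrite factorE -[LHS]/(g s (i' s _)) factorE (exact_comp0 fg).
- move=> s a; have [u uE] := gs s (i s a).
  have /(ses_exact i'P)[v vE] : lhom_comp p g s u = 0 by rewrite -[LHS]/(p s (g s u)) uE (exact_comp0 ip).
  by exists v; apply: (injective_homP ii); rewrite factorE -[LHS]/(g s (i' s v)) vE.
Qed.

(** For [j = 0], decomposability descends from [U] to [U'] by [D] and from [U'] to [K] by [A]. For
    larger [j], the kernel [U'] of the projective presentation of [D] has vanishing Tor, and it maps
    onto [A] with kernel [K]. *)
Lemma tor_vanish_ext j A B D (i : lhom A B) (p : lhom B D) : ses i p ->
  tor_vanish j A -> tor_vanish j D -> tor_vanish j B.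
Proof.
case: j => [|j] ip tA tD K U f g fg;
  have [U' [i' [f' [g' [i'P fg' E]]]]] := ses_preim ip fg.
  by move=> s x dx; apply: (tA _ _ _ _ fg'); apply: (tD _ _ _ _ i'P); rewrite E.
by move=> Up; apply: (tor_vanish_sub fg') tA; apply: tD i'P Up.
Qed.

(** Schanuel's argument: the pullback of [P] and [P'] over [V] is an extension of [P'] by [K] and of
    [P] by [K'], so vanishing passes from the given kernel to any other. *)
Lemma tor_vanish_syzygy j K P V (f : lhom K P) (g : lhom P V) : ses f g ->
  projective P -> tor_vanish j K -> tor_vanish j.+1 V.
Proof.
move=> fg Pp tK K' P' f' g' fg' P'p.
have [a [aP _]] := pullback_ses2 fg (ses_surj fg').
have [b [bP _]] := pullback_ses1 fg' (ses_surj fg).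
have tX := tor_vanish_ext aP tK (tor_vanish_proj j P'p).
exact: tor_vanish_sub bP tX (tor_vanish_proj j.+1 Pp).
Qed.

(** One projective presentation is enough to test all sequences. With [h] lifting [g], each
    decomposable [u] of [U] is [f' z + h y] with [y] and [z] decomposable; if [u] comes from [K'],
    then [y] comes from [K], where the hypothesis applies. *)
Lemma tor1_vanishP K P V (f : lhom K P) (g : lhom P V) : ses f g -> projective P ->
  (forall s x, decomposable (f s x) -> decomposable x) -> tor1_vanish V.
Proof.
move=> fg Pp H K' U f' g' fg' s x dx.
have [h hE] := Pp _ _ _ g (ses_surj fg').
have {}hE t y : g' t (h t y) = g t y by apply: (lhom_eqE hE).
have Hd t u : decomposable u -> exists y z, [/\ decomposable y, decomposable z,
    g' t u = g t y & u = f' t z + h t y].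
  elim=> [|n a w v nt _ [y [z [dy dz E1 vE]]]].
    exists 0, 0; rewrite !lhom0E addr0.
    by split=> //; apply: Decomposable0.
  have [p pE] := ses_surj fg (g' n w).
  have /(ses_exact fg')[z' z'E] : g' n (w - h n p) = 0 by rewrite lhomB hE pE subrr.
  exists (lact a p + y), (lact a z' + z); split.
  - exact: DecomposableS.
  - exact: DecomposableS.
  - by rewrite !lhomD !lfun_nat pE -E1.
  - by rewrite vE !lhomD !lfun_nat z'E linearB addrACA subrK.
have [y [z [dy dz E1 E2]]] := Hd _ _ dx.
have /(ses_exact fg)[w wE] : g s y = 0 by rewrite -E1 (exact_comp0 (ses_exact fg')).
have hK t v : exists v', f' t v' = lhom_comp h f t v.
  by apply/(ses_exact fg'); rewrite /= hE (exact_comp0 (ses_exact fg)).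
have -> : x = z + factor (ses_inj fg') hK s w.
  by apply: (injective_homP (ses_inj fg')); rewrite lhomD factorE /= wE.
by apply: decomposableD => //; apply/decomposable_hom/H; rewrite wE.
Qed.

(** The last hypothesis says that the image of [i], tensored with kG_s, still embeds in [B] tensored
    with kG_s, so that Tor_1 of [B] maps onto Tor_1 of [D]. The form is that of a right exact
    sequence because it is applied to differences, where injectivity on the left may fail. *)
Lemma tor1_vanish_quot A B D (i : lhom A B) (p : lhom B D) :
  exact_at i p -> surjective_hom p -> tor1_vanish B ->
  (forall s x, decomposable (i s x) -> exists2 y, decomposable y & i s y = i s x) ->
  tor1_vanish D.
Proof.
move=> ip ps tB H K U f g fg s x dx.
have [a [aP aE]] := pullback_ses2 fg ps.
have p1s : surjective_hom (pullback1 g p).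
  by move=> t u; have [b bE] := ps t (g t u); have [v [v1 _]] := pullback_ex (esym bE); exists v.
have [v dv vE] := decomposable_lift p1s dx.
have /ip[w wE] : p s (pullback2 g p s v) = 0.
  by rewrite -pullbackP vE (exact_comp0 (ses_exact fg)).
have [|y dy yE] := H s w; first by rewrite wE; apply: decomposable_hom.
have [t z|b [b1 b2]] := @pullback_lift_ex _ _ _ _ _ g p _ (0 : Hom A U) i.
  by rewrite (exact_comp0 ip) -[LHS]/(g t 0) lhom0E.
apply: (tB _ _ _ _ aP).
have -> : a s x = v - b s y.
  apply/eqP; rewrite -subr_eq0; apply/eqP/pullback_eq0.
    by rewrite !lhomB aE vE b1 subr0 subrr.
  by rewrite !lhomB (exact_comp0 (ses_exact aP)) b2 yE wE subrr subr0.
by apply: decomposableB => //; apply: decomposable_hom.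
Qed.

Lemma ses_iso A B D D' (i : lhom A B) (p : lhom B D) (f : lhom D D') :
  (forall s, bijective (f s)) -> ses i p -> ses i (lhom_comp f p).
Proof.
move=> fb [ii ip ps]; split=> // [s w|s d].
  rewrite -ip /=; split=> [H|->]; last by rewrite lhom0E.
  by apply: (bij_inj (fb s)); rewrite H lhom0E.
by have [h _ fh] := fb s; have [b bE] := ps s (h d); exists b; rewrite /= bE fh.
Qed.

Lemma tor_vanish_iso j V W : liso V W -> tor_vanish j W -> tor_vanish j V.
Proof.
move=> [f fb]; case: j => [|j] tW K U a b ab; first exact: tW (ses_iso fb ab).
by move=> Up; apply: tW (ses_iso fb ab) Up.
Qed.

Lemma tor_vanish_zero j V : (forall s (v : V s), v = 0) -> tor_vanish j V.
Proof.
move=> V0; apply: tor_vanish_proj => W U p f ps; exists 0; apply: lhomP => s v.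
by rewrite (V0 _ v) !lhom0E.
Qed.

Lemma generated_lt_ext d A B D (i : lhom A B) (p : lhom B D) : exact_at i p ->
  surjective_hom p ->  generated_lt d A -> generated_lt d D -> generated_lt d B.
Proof.
move=> ip ps gA gD s b ds.
have [b' db' b'E] := decomposable_lift ps (gD s (p s b) ds).
have /ip[a aE] : p s (b - b') = 0 by rewrite lhomB b'E subrr.
by rewrite -[b](subrK b') -aE; apply: decomposableD => //; apply/decomposable_hom/gA.
Qed.

End Homology.

(** * Morphisms of FI_G *)

Section Morphisms.
Variable gT : finGroupType.
Notation hom n m := (@hom (FI gT) n m).
Notation comp f g := (@cmp (FI gT) _ _ _ f g).

Fact FI_mk_inj n m (f : 'I_n -> 'I_m) : injective f -> injectiveb (finfun f).
Proof. by move=> fi; apply/injectiveP => x y; rewrite !ffunE => /fi. Qed.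
Definition FI_mk n m (f : 'I_n -> 'I_m) (fi : injective f) (g : 'I_n -> gT) : hom n m :=
  exist _ (finfun f, finfun g) (FI_mk_inj fi).
Lemma FI_mk_injE n m f fi g x : FI_inj (@FI_mk n m f fi g) x = f x.
Proof. by rewrite /FI_inj /= ffunE. Qed.
Lemma FI_mk_labE n m f fi g x : FI_lab (@FI_mk n m f fi g) x = g x.
Proof. by rewrite /FI_lab /= ffunE. Qed.
Lemma FI_inj_inj n m (f : hom n m) : injective (FI_inj f).
Proof. exact: (injectiveP _ (valP f)). Qed.
Lemma FI_comp_injE l n m (f : hom n m) (g : hom l n) x :
  FI_inj (comp f g) x = FI_inj f (FI_inj g x).
Proof. by rewrite /FI_inj /= ffunE. Qed.
Lemma FI_comp_labE l n m (f : hom n m) (g : hom l n) x :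
  FI_lab (comp f g) x = (FI_lab g x * FI_lab f (FI_inj g x))%g.
Proof. by rewrite /FI_lab /= ffunE. Qed.
Lemma FI_id_injE n x : FI_inj (idm n : hom n n) x = x.
Proof. by rewrite /FI_inj /= ffunE. Qed.
Lemma FI_id_labE n x : FI_lab (idm n : hom n n) x = 1%g.
Proof. by rewrite /FI_lab /= ffunE. Qed.
Definition FI_E := (FI_mk_injE, FI_mk_labE, FI_comp_injE, FI_comp_labE, FI_id_injE, FI_id_labE).

Lemma FI_monic l n m (f : hom n m) (g h : hom l n) : comp f g = comp f h -> g = h.
Proof.
move=> E; have gh : FI_inj g =1 FI_inj h.
  move=> x; apply: (@FI_inj_inj _ _ f).
  by have := congr1 (fun p => FI_inj p x) E; rewrite !FI_E.
apply: FI_homP => // x; apply: (mulIg (FI_lab f (FI_inj g x))).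
by have := congr1 (fun p => FI_lab p x) E; rewrite !FI_E gh.
Qed.

Lemma FI_end_inv n (s : hom n n) : exists t, comp s t = idm _ /\ comp t s = idm _.
Proof.
have sb := injF_bij (@FI_inj_inj _ _ s); case: sb => t ts st.
have ti : injective t := can_inj st.
pose t' := FI_mk ti (fun x => (FI_lab s (t x))^-1%g).
have E : comp s t' = idm _ by apply: FI_homP => x; rewrite !FI_E ?st // mulVg.
exists t'; split=> //; apply: (@FI_monic _ _ _ s).
by rewrite cmpA E cmp1m cmpm1.
Qed.

(** The new point of [n.+1] is [ord0], here and in [FI_succ], which extends a morphism by the
    identity on that point. *)
Definition FI_lift n : hom n n.+1 := FI_mk (@lift_inj _ ord0) (fun=> 1%g).

Section Succ.
Variables (n m : nat) (f : hom n m).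
Definition FI_succ_inj (x : 'I_n.+1) : 'I_m.+1 :=
  oapp (fun i => lift ord0 (FI_inj f i)) ord0 (unlift ord0 x).
Fact FI_succ_injP : injective FI_succ_inj.
Proof.
rewrite /FI_succ_inj => x y.
case: (unliftP ord0 x) => [i|] ->; case: (unliftP ord0 y) => [j|] -> //=.
by move=> /lift_inj/FI_inj_inj ->.
Qed.
Definition FI_succ : hom n.+1 m.+1 :=
  FI_mk FI_succ_injP (fun x => oapp (FI_lab f) 1%g (unlift ord0 x)).
Lemma FI_succ0 : FI_inj FI_succ ord0 = ord0.
Proof. by rewrite FI_E /FI_succ_inj unlift_none. Qed.
Lemma FI_succ_lift i : FI_inj FI_succ (lift ord0 i) = lift ord0 (FI_inj f i).
Proof. by rewrite FI_E /FI_succ_inj liftK. Qed.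
Lemma FI_succ_lab0 : FI_lab FI_succ ord0 = 1%g.
Proof. by rewrite FI_E unlift_none. Qed.
Lemma FI_succ_lab i : FI_lab FI_succ (lift ord0 i) = FI_lab f i.
Proof. by rewrite FI_E liftK. Qed.
End Succ.

Lemma FI_lift_injE n i : FI_inj (FI_lift n) i = lift ord0 i.
Proof. by rewrite FI_E. Qed.
Lemma FI_lift_labE n i : FI_lab (FI_lift n) i = 1%g.
Proof. by rewrite FI_E. Qed.

Definition FI_SE := (FI_comp_injE, FI_comp_labE, FI_id_injE, FI_id_labE, FI_succ0,
  FI_succ_lift, FI_succ_lab0, FI_succ_lab, FI_lift_injE, FI_lift_labE).

Lemma FI_succ_ext n m (f g : hom n.+1 m) :
  FI_inj f ord0 = FI_inj g ord0 -> FI_lab f ord0 = FI_lab g ord0 ->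
  comp f (FI_lift n) = comp g (FI_lift n) -> f = g.
Proof.
move=> i0 l0 E; apply: FI_homP => x; case: (unliftP ord0 x) => [i|] -> //.
  by have := congr1 (fun p => FI_inj p i) E; rewrite !FI_SE.
by have := congr1 (fun p => FI_lab p i) E; rewrite !FI_SE !mul1g.
Qed.

Lemma FI_succ_nat n m (f : hom n m) : comp (FI_succ f) (FI_lift n) = comp (FI_lift m) f.
Proof. by apply: FI_homP => x; rewrite !FI_SE ?mul1g ?mulg1. Qed.
Lemma FI_succ_id n : FI_succ (idm n) = idm _.
Proof.
by apply: FI_succ_ext; rewrite ?FI_SE // FI_succ_nat cmp1m cmpm1.
Qed.
Lemma FI_succ_comp l n m (f : hom n m) (g : hom l n) :
  FI_succ (comp f g) = comp (FI_succ f) (FI_succ g).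
Proof.
apply: FI_succ_ext; rewrite ?FI_SE ?mulg1 //.
by rewrite FI_succ_nat -!cmpA FI_succ_nat !cmpA FI_succ_nat.
Qed.

Lemma FI_succ_inj_eq n m (f g : hom n m) : FI_succ f = FI_succ g -> f = g.
Proof.
move=> E; apply: (@FI_monic _ _ _ (FI_lift m)).
by rewrite -!FI_succ_nat E.
Qed.

Lemma FI_lift_factor n m (f : hom n m.+1) :
  (forall x, FI_inj f x != ord0) -> exists f', f = comp (FI_lift m) f'.
Proof.
move=> f0; have H x : exists y, FI_inj f x = lift ord0 y.
  by case: (unliftP ord0 (FI_inj f x)) (f0 x) => [y ->|->]; [exists y|rewrite eqxx].
pose f' x := sval (cid (H x)).
have f'E x : FI_inj f x = lift ord0 (f' x) by rewrite /f'; case: cid.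
have fi : injective f' by move=> x y E; apply: (@FI_inj_inj _ _ f); rewrite !f'E E.
exists (FI_mk fi (FI_lab f)); apply: FI_homP => x; rewrite !FI_E //.
by rewrite mulg1.
Qed.

Definition FI_tperm m (i j : 'I_m) : hom m m := FI_mk (@perm_inj _ (tperm i j)) (fun=> 1%g).
Lemma FI_tpermK m (i j : 'I_m) : comp (FI_tperm i j) (FI_tperm i j) = idm _.
Proof. by apply: FI_homP => x; rewrite !FI_E ?tpermK ?mulg1. Qed.

(** With [FI_lift_factor] this gives the dichotomy behind the shift: a morphism into [m.+1] either
    misses the new point and factors through [FI_lift], or hits it and is, up to an automorphism of
    its source, some [FI_succ f']. *)
Lemma FI_succ_factor n m (f : hom n m.+1) x : FI_inj f x = ord0 ->
  exists n' (e : n = n'.+1) (f' : hom n' m) (s : hom n n'.+1), f = comp (FI_succ f') s.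
Proof.
case: n f x => [|n] f x fx; first by case: x fx.
(* [s0] moves [x] to the new point and absorbs the label of [f] there, as [FI_succ] only allows the
   label 1. *)
pose s0 : hom n.+1 n.+1 := FI_mk (@perm_inj _ (tperm x ord0))
  (fun y => if y == x then FI_lab f x else 1%g).
have [t [st ts]] := FI_end_inv s0.
have s0x : FI_inj s0 x = ord0 by rewrite FI_E tpermL.
have tx : FI_inj t ord0 = x.
  by rewrite -s0x -FI_comp_injE ts FI_id_injE.
have [|f' f'E] := @FI_lift_factor _ _ (comp (comp f t) (FI_lift n)).
  move=> y; rewrite !FI_SE -fx -tx; apply/eqP => /FI_inj_inj/FI_inj_inj.
  by move=> /(congr1 val).
exists n, erefl, f', s0; suff E : comp f t = FI_succ f'.
  by rewrite -E -cmpA ts cmpm1.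
apply: FI_succ_ext; last by rewrite f'E FI_succ_nat.
  by rewrite !FI_SE tx.
rewrite !FI_SE tx; have := congr1 (fun p => FI_lab p ord0) st.
rewrite FI_id_labE FI_comp_labE tx => <-.
by rewrite (FI_mk_labE _ _ x) eqxx.
Qed.

(** Morphisms in different orbits under precomposition by automorphisms stay in different orbits
    after [FI_succ]; the coefficient maps of a difference rest on this. *)
Lemma FI_succ_comp_inv n m (f h : hom n m) (s : hom n.+1 n.+1) :
  FI_succ f = comp (FI_succ h) s -> exists s', s = FI_succ s' /\ f = comp h s'.
Proof.
move=> E; have s0 : FI_inj s ord0 = ord0.
  apply: (@FI_inj_inj _ _ (FI_succ h)); rewrite FI_succ0 -FI_comp_injE -E.
  by rewrite FI_succ0.
have l0 : FI_lab s ord0 = 1%g.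
  have := congr1 (fun p => FI_lab p ord0) E; rewrite !FI_SE s0 => ->.
  by rewrite FI_succ_lab0 mulg1.
have [|s' s'E] := @FI_lift_factor _ _ (comp s (FI_lift n)).
  by move=> y; rewrite !FI_SE -{2}s0; apply/eqP => /FI_inj_inj/(congr1 val).
have sE : s = FI_succ s'.
  by apply: FI_succ_ext; rewrite ?FI_SE // s'E FI_succ_nat.
by exists s'; split=> //; apply: FI_succ_inj_eq; rewrite FI_succ_comp -sE.
Qed.

Lemma FI_missing n m (f : hom n m) : (n < m)%N -> exists y, forall x, FI_inj f x != y.
Proof.
move=> nm; have : (#|codom (FI_inj f)| < #|'I_m|)%N.
  by rewrite card_codom ?card_ord //; apply: FI_inj_inj.
rewrite ltnNge => /negP H; apply: contrapT => /forallNP H'; apply: H.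
apply/subset_leq_card/subsetP => y _; have /existsNP[x /negP/negPn/eqP <-] := H' y.
exact: codom_f.
Qed.

Lemma FI_lt_factor n m (f : hom n m) : (n < m)%N -> exists f' : hom n.+1 m, f = comp f' (FI_lift n).
Proof.
move=> /(FI_missing f)[y fy].
pose g x := oapp (FI_inj f) y (unlift ord0 x).
have gi : injective g.
  rewrite /g => a b; case: (unliftP ord0 a) => [i|] ->; case: (unliftP ord0 b) => [j|] -> //=;
    rewrite ?liftK ?unlift_none /=.
  - by move=> /FI_inj_inj ->.
  - by move=> /eqP; rewrite (negPf (fy _)).
  - by move=> /esym/eqP; rewrite (negPf (fy _)).
exists (FI_mk gi (fun x => oapp (FI_lab f) 1%g (unlift ord0 x))).
by apply: FI_homP => x; rewrite !FI_E /g liftK //= mul1g.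
Qed.

(** Automorphisms of the target can push the image off the new point here, and onto it in
    [FI_move_succ]. These normal forms allow induction on the degree of the target. *)
Lemma FI_move_lift n m (f : hom n m.+1) : (n < m.+1)%N ->
  exists (g : hom m.+1 m.+1) f', comp g f = comp (FI_lift m) f'.
Proof.
move=> /(FI_missing f)[y fy]; have [|f' E] := @FI_lift_factor _ _ (comp (FI_tperm y ord0) f).
  move=> x; rewrite !FI_E; apply: contra (fy x) => /eqP.
  by move=> /(canRL (tpermK _ _)) ->; rewrite tpermR.
by exists (FI_tperm y ord0), f'.
Qed.

Lemma FI_move_succ n m (f : hom n.+1 m.+1) :
  exists (g : hom m.+1 m.+1) f' (s : hom n.+1 n.+1), comp g f = comp (FI_succ f') s.
Proof.
pose g := FI_tperm (FI_inj f ord0) ord0.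
have [|n' [[e] [f' [s E]]]] := @FI_succ_factor _ _ (comp g f) ord0; first by rewrite !FI_E tpermL.
by subst n'; exists g, f', s.
Qed.

Lemma FI_hom0 m (f g : hom 0 m) : f = g.
Proof. by apply: FI_homP; case. Qed.

End Morphisms.

(** * Shift and difference *)

Section LinearFactor.
Variable k : comPzRingType.
Lemma linear_factor (X Y Z : lmodType k) (i : {linear Y -> Z}) (f : {linear X -> Z}) :
  (forall y, i y = 0 -> y = 0) -> (forall x, exists y, i y = f x) ->
  exists g : {linear X -> Y}, forall x, i (g x) = f x.
Proof.
move=> i0 fi; have ii : injective i.
  by move=> x y E; apply/eqP; rewrite -subr_eq0; apply/eqP/i0; rewrite linearB E subrr.
pose g x := sval (cid (fi x)).
have gE x : i (g x) = f x by rewrite /g; case: cid.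
have gL : linear g by move=> a x y; apply: ii; rewrite linearP !gE linearP.
by exists (mk_linear gL).
Qed.

Lemma linear_descent (X Y Z : lmodType k) (p : {linear X -> Y}) (f : {linear X -> Z}) :
  (forall y, exists x, p x = y) -> (forall x, p x = 0 -> f x = 0) ->
  exists g : {linear Y -> Z}, forall x, g (p x) = f x.
Proof.
move=> ps pf; pose l y := sval (cid (ps y)).
have lE y : p (l y) = y by rewrite /l; case: cid.
have gE x : f (l (p x)) = f x.
  by apply/eqP; rewrite -subr_eq0 -linearB; apply/eqP/pf; rewrite linearB lE subrr.
have gL : linear (fun y => f (l y)).
  by move=> a x y; rewrite -[in LHS](lE x) -[in LHS](lE y) -linearP gE linearP.
by exists (mk_linear gL).
Qed.
End LinearFactor.

Section QuotFactor.
Variables (k : comPzRingType) (C : category) (V W : left_module k C) (S : submodule V).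
Variables (f : lhom V W) (fS : forall x v, v \in S x -> f x v = 0).
Definition quot_factor_fun x : {linear quot_lmod (S x) -> W x} :=
  quot_lift (f := llin f x) (@fS x).
Fact quot_factor_nat x y (h : hom x y) (v : quot_mod S x) :
  quot_factor_fun y (lact h v) = lact h (quot_factor_fun x v).
Proof.
elim/quot_ind: v => v.
have -> : lact (l := quot_mod S) h (quot_pi _ v) = quot_pi _ (lact h v) by apply: quot_actE.
rewrite /quot_factor_fun quot_liftE [in RHS]quot_liftE; exact: lfun_nat.
Qed.
Definition quot_factor : lhom (quot_mod S) W :=
  @LHom k C (quot_mod S) W quot_factor_fun (fun x => linearP (quot_factor_fun x)) quot_factor_nat.
Lemma quot_factorE x v : quot_factor x (quot_hom S x v) = f x v.
Proof. exact: (quot_liftE (f := llin f x) (@fS x)). Qed.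
End QuotFactor.

Section Image.
Variables (k : comPzRingType) (C : category) (V W : left_module k C) (f : lhom V W).
Fact im_act x y (h : hom x y) v : v \in im (llin f x) -> lact h v \in im (llin f y).
Proof. by move=> /imE[u <-]; apply/imE; exists (lact h u); apply: lfun_nat. Qed.
Definition im_mod : submodule W := Submodule im_act.
Lemma im_modP x w : w \in im_mod x <-> exists v, f x v = w.
Proof. exact: imE. Qed.
Lemma coker_exact : exact_at f (quot_hom im_mod).
Proof. by move=> x w; rewrite quot_homP im_modP. Qed.
Lemma coker_ses : injective_hom f -> ses f (quot_hom im_mod).
Proof. by move=> fi; split=> //; [apply: coker_exact|apply: quot_hom_surj]. Qed.
End Image.

Section Shift.
Variables (k : comPzRingType) (gT : finGroupType).
Notation module := (left_module k (FI gT)).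
Notation hom n m := (@hom (FI gT) n m).
Notation comp f g := (@cmp (FI gT) _ _ _ f g).
Notation lift n := (@FI_lift gT n).

Section ShiftMod.
Variable V : module.
Fact shift_act1 n (v : V n.+1) : lact (l := V) (FI_succ (@idm (FI gT) n)) v = v.
Proof. by rewrite FI_succ_id lact1. Qed.
Fact shift_actM n m l (g : hom m l) (f : hom n m) (v : V n.+1) :
  lact (l := V) (FI_succ (comp g f)) v = lact (FI_succ g) (lact (FI_succ f) v).
Proof. by rewrite FI_succ_comp lactM. Qed.
Definition shift : module :=
  @LeftModule k (FI gT) (fun n => V n.+1) (fun n m f => lact (FI_succ f))
    shift_act1 shift_actM.

Fact to_shift_nat n m (f : hom n m) (v : V n) :
  lact (lift m) (lact f v) = lact (l := shift) f (lact (lift n) v).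
Proof. by rewrite /= -!lactM FI_succ_nat. Qed.
Definition to_shift : lhom V shift :=
  @LHom k (FI gT) V shift (fun n => lact (lift n)) (fun n => linearP (lact (lift n))) to_shift_nat.

Definition diff : module := quot_mod (im_mod to_shift).
Definition to_diff : lhom shift diff := quot_hom (im_mod to_shift).
Lemma to_diff_exact : exact_at to_shift to_diff.
Proof. exact: coker_exact. Qed.
Lemma to_diff_surj : surjective_hom to_diff.
Proof. exact: quot_hom_surj. Qed.
Lemma diff_ses : injective_hom to_shift -> ses to_shift to_diff.
Proof. exact: coker_ses. Qed.

(** Peeling one [FI_lift] off [f] at a time lowers [m - n], and for [m = n] the morphism is
    invertible. So injectivity of [to_shift] amounts to the absence of torsion. *)
Lemma to_shift_inj_act : injective_hom to_shift ->
  forall n m (f : hom n m) (v : V n), lact f v = 0 -> v = 0.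
Proof.
move=> ti n m; move: {2}(m - n)%N (erefl (m - n)%N) => d.
elim: d n => [|d IH] n dE f v fv.
  have nm : n = m by apply/eqP; rewrite eqn_leq (FI_hom_leq f) -subn_eq0 dE.
  subst m; have [g [_ gf]] := FI_end_inv f.
  by rewrite -(lact1 v) -gf lactM fv linear0.
have nm : (n < m)%N by rewrite -subn_gt0 dE.
have [f' fE] := FI_lt_factor f nm.
apply: (ti n); apply: (IH _ _ f'); first by rewrite subnS dE.
by rewrite /= -lactM -fE.
Qed.

Lemma to_shift_ker n m (f : hom n m) (v : V n) : to_shift n v = 0 -> (n < m)%N ->
  lact f v = 0.
Proof.
by move=> v0 /(FI_lt_factor f)[f' ->]; rewrite lactM -[lact _ v]/(to_shift n v) v0 linear0.
Qed.
End ShiftMod.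

Section ShiftHom.
Variables (V W : module) (f : lhom V W).
Definition shift_hom : lhom (shift V) (shift W) :=
  @LHom k (FI gT) (shift V) (shift W) (fun n => f n.+1) (fun n => @lfun_linear _ _ _ _ f n.+1)
    (fun n m h v => lfun_nat f (FI_succ h) v).
Lemma to_shift_hom n v : shift_hom n (to_shift V n v) = to_shift W n (f n v).
Proof. exact: (lfun_nat f (lift n) v). Qed.
Fact diff_hom_im n v : v \in im_mod (to_shift V) n ->
  lhom_comp (to_diff W) shift_hom n v = 0.
Proof.
move=> /im_modP[u <-]; rewrite -[LHS]/(to_diff W n (shift_hom n _)) to_shift_hom.
exact: (exact_comp0 (@to_diff_exact W) (f n u)).
Qed.
Definition diff_hom : lhom (diff V) (diff W) := quot_factor diff_hom_im.
Lemma diff_homE n v : diff_hom n (to_diff V n v) = to_diff W n (f n.+1 v).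
Proof. exact: (quot_factorE diff_hom_im). Qed.
End ShiftHom.

Lemma diff_hom_surj V W (f : lhom V W) : surjective_hom f -> surjective_hom (diff_hom f).
Proof.
move=> fs n w; have [w' <-] := to_diff_surj w.
have [v <-] := fs n.+1 w'; exists (to_diff V n v); exact: diff_homE.
Qed.

Lemma diff_exact A B D (i : lhom A B) (p : lhom B D) : exact_at i p ->
  surjective_hom p -> exact_at (diff_hom i) (diff_hom p).
Proof.
move=> ip ps n y; have [{y}y <-] := to_diff_surj y; split=> [|[x]]; last first.
  have [{x}x <-] := to_diff_surj x; rewrite diff_homE => <-.
  by rewrite diff_homE (exact_comp0 ip) lhom0E.
rewrite diff_homE => /to_diff_exact[d dE].
have [b bE] := ps n d.
have /ip[a aE] : p n.+1 (y - to_shift B n b) = 0.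
  rewrite lhomB -[p n.+1 (to_shift B n b)]/(shift_hom p n (to_shift B n b)).
  by rewrite to_shift_hom bE dE subrr.
exists (to_diff A n a); rewrite diff_homE aE.
rewrite -[RHS]subr0 -(exact_comp0 (@to_diff_exact B) b); exact: lhomB.
Qed.

(** Snake lemma: the kernel of [to_shift D] maps onto the kernel of [diff_hom i]. *)
Lemma diff_ses3 A B D (i : lhom A B) (p : lhom B D) : ses i p ->
  injective_hom (to_shift D) -> ses (diff_hom i) (diff_hom p).
Proof.
move=> [ii ip ps] Di; split; [|exact: diff_exact|exact: diff_hom_surj].
move=> n x; have [{x}x <-] := to_diff_surj x; rewrite diff_homE => /to_diff_exact[b bE].
have /ip[a aE] : p n b = 0.
  apply: (Di n); rewrite -to_shift_hom -[LHS]/(p n.+1 (to_shift B n b)) bE.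
  exact: (exact_comp0 ip (x : A n.+1)).
apply/to_diff_exact; exists a; apply: (injective_homP ii).
by rewrite -bE -aE; apply: (to_shift_hom i a).
Qed.

Lemma to_shift_inj_sub A B (i : lhom A B) : injective_hom i ->
  injective_hom (to_shift B) -> injective_hom (to_shift A).
Proof.
move=> ii Bi n a a0; apply/(ii n)/(Bi n).
by rewrite -to_shift_hom a0; apply: (lhom0E i n.+1).
Qed.

Lemma to_shift_inj_ext A B D (i : lhom A B) (p : lhom B D) : ses i p ->
  injective_hom (to_shift A) -> injective_hom (to_shift D) -> injective_hom (to_shift B).
Proof.
move=> [ii ip ps] Ai Di n b b0.
have /ip[a aE] : p n b = 0 by apply: (Di n); rewrite -to_shift_hom b0; apply: (lhom0E p n.+1).
rewrite -aE (Ai n a) ?lhom0E //; apply: (ii n.+1).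
by rewrite -[LHS]/(shift_hom i n (to_shift A n a)) to_shift_hom aE.
Qed.

(** In the shift, the action of a morphism that misses the new point lands in the image of
    [to_shift] and dies in the difference. One that hits it acts through [FI_succ f'], where [f']
    starts one degree lower. *)
Lemma diff_generated_lt d V : generated_lt d.+1 V -> generated_lt d (diff V).
Proof.
move=> gV s x ds; have [{x}v <-] := to_diff_surj x.
elim: (gV s.+1 v ds) => [|n f u w ns _ IH].
  rewrite -[to_diff V s 0]/(to_diff V s (0 : shift V s)) lhom0E; exact: Decomposable0.
rewrite -[X in decomposable X]/(to_diff V s ((lact f u : shift V s) + w)) lhomD.
apply: decomposableD => //.
have [/existsP[x /eqP fx]|/existsPn H] := boolP [exists x, FI_inj f x == ord0].
  have [n' [e [f' [t ->]]]] := FI_succ_factor fx; subst n; rewrite lactM.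
  rewrite -[X in to_diff V s X]/(lact (l := shift V) f' (lact t u)) lfun_nat.
  exact: decomposable_act.
have [|f' ->] := @FI_lift_factor _ _ _ f; first by move=> x; apply: H.
rewrite lactM -[X in to_diff V s X]/(to_shift V s (lact f' u)).
rewrite (exact_comp0 (@to_diff_exact V)); exact: Decomposable0.
Qed.

Lemma shift_generated_lt d V : generated_lt d V -> generated_lt d (shift V).
Proof.
move=> gV; apply: (generated_lt_ext (@to_diff_exact V) (@to_diff_surj V) gV).
by case: d gV => [|d] gV s x ds; [apply: (diff_generated_lt (d := 0)) => // t v _; apply: gV|apply: (diff_generated_lt gV); apply: ltnW].
Qed.
End Shift.

(** * Modules isomorphic to M(W) *)

Section Representatives.
Variables (gT : finGroupType) (n s : nat).
Notation hom n m := (@hom (FI gT) n m).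
Notation comp f g := (@cmp (FI gT) _ _ _ f g).

(** A representative of the orbit of [f] under automorphisms of the source: the result of [pick]
    depends only on the predicate, which is constant on the orbit. The default is never reached, as
    [f] itself qualifies. *)
Definition FI_repr (f : hom n s) : hom n s :=
  odflt f [pick h : FI_hom gT n s | [exists t : FI_hom gT n n, (f : FI_hom gT n s) == FI_comp h t]].

Lemma FI_reprP (f : hom n s) : exists t, f = comp (FI_repr f) t.
Proof.
rewrite /FI_repr; case: pickP => [h /existsP[t /eqP E]|/(_ f)/existsP H] /=; first by exists t.
by case: H; exists (@idm (FI gT) n); rewrite -[FI_comp _ _]/(comp f (idm _)) cmpm1.
Qed.

Lemma FI_repr_comp (f : hom n s) (t : hom n n) : FI_repr (comp f t) = FI_repr f.
Proof.
rewrite /FI_repr (@eq_pick _ _ (fun h : FI_hom gT n s => [exists t : FI_hom gT n n, (f : FI_hom gT n s) == FI_comp h t])).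
  case: pickP => [//|/(_ f)/existsP[]]; exists (@idm (FI gT) n).
  by apply/eqP; rewrite -[RHS]/(comp f (idm _)) cmpm1.
have [t' [tt' t't]] := FI_end_inv t.
move=> h; apply/existsP/existsP => -[u /eqP E].
  exists (comp u t'); apply/eqP; rewrite -[RHS]/(comp h (comp u t')) cmpA.
  by rewrite -[comp h u]E -cmpA tt' cmpm1.
exists (comp u t); apply/eqP; rewrite -[RHS]/(comp h (comp u t)) cmpA.
by rewrite -[comp h u]E.
Qed.
End Representatives.

Section BasicLike.
Variables (k : comPzRingType) (gT : finGroupType).
Notation module := (left_module k (FI gT)).
Notation hom n m := (@hom (FI gT) n m).
Notation comp f g := (@cmp (FI gT) _ _ _ f g).
Notation lift n := (@FI_lift gT n).
Implicit Types V W K : module.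

(* [V] is isomorphic to [M(V n)]: the [c] are the coefficient maps of the
   decomposition of [M(V n) s] as a sum of copies of [V n], indexed by [hom n s]
   modulo [hom n n]. *)
Record basic_like (n : nat) V : Prop := BasicLike {
  basic_like_lt : forall s, (s < n)%N -> forall v : V s, v = 0;
  basic_like_gen : generated_lt n.+1 V;
  basic_like_coef : forall s (h : hom n s), exists c : {linear V s -> V n},
    (forall w, c (lact h w) = w) /\
    (forall (f : hom n s) w, (forall t, f <> comp h t) -> c (lact f w) = 0) }.

Lemma generated_ind n V s (P : V s -> Prop) :
  (forall s, (s < n)%N -> forall v : V s, v = 0) -> generated_lt n.+1 V ->
  P 0 -> (forall x y, P x -> P y -> P (x + y)) ->
  (forall (f : hom n s) w, P (lact f w)) -> forall v, P v.
Proof.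
move=> V0 gV; elim/ltn_ind: s P => s IH P P0 PD PL v.
case: (ltngtP s n) => [sn|ns|E].
- by rewrite (V0 s sn v).
- elim: (gV s v ns) => // m f u w ms _ Pw; apply: (PD) => //.
  (* The intermediate generator is itself reduced to degree [n], for the predicate pulled back along
     [f]; hence the induction is over all [P]. *)
  apply: (IH m ms (fun u => P (lact f u))) => [|x y Px Py|g x].
  + by rewrite linear0.
  + by rewrite linearD; apply: PD.
  + by rewrite -lactM; apply: PL.
- by subst s; rewrite -[v]lact1; apply: PL.
Qed.

Lemma basic_like_ext n V s (U : lmodType k) (f g : {linear V s -> U}) : basic_like n V ->
  (forall (h : hom n s) w, f (lact h w) = g (lact h w)) -> f =1 g.
Proof.
move=> [V0 gV _] fg v; move: v; apply: (generated_ind V0 gV) => // [|x y]; first by rewrite !linear0.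
by rewrite !linearD => -> ->.
Qed.

Section Coef.
Variables (n : nat) (V : module) (bV : basic_like n V).
Definition coef s (h : hom n s) : {linear V s -> V n} := sval (cid (basic_like_coef bV h)).
Lemma coefK s (h : hom n s) w : coef h (lact h w) = w.
Proof. by rewrite /coef; case: cid => c []. Qed.
Lemma coef_lact s (h : hom n s) (t : hom n n) (w : V n) : coef h (lact (comp h t) w) = lact t w.
Proof. by rewrite lactM coefK. Qed.
Lemma coef0 s (h f : hom n s) w : (forall t, f <> comp h t) -> coef h (lact f w) = 0.
Proof. by rewrite /coef; case: cid => c [_ H] /= ne; apply: H. Qed.

Lemma coef_comp s t (g : hom s t) (h : hom n s) x : coef (comp g h) (lact g x) = coef h x.
Proof.
apply: (basic_like_ext (f := coef (comp g h) \o lact g) bV) => f w.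
rewrite -[LHS]/(coef _ (lact g _)) -lactM.
have [[t' ->]|/forallNP H] := pselect (exists t', f = comp h t').
  by rewrite cmpA !coef_lact.
by rewrite !coef0 // => t'; rewrite -cmpA => /FI_monic; apply: H.
Qed.

Lemma coef_unfactor s t (g : hom s t) (h : hom n t) x :
  (forall h', h <> comp g h') -> coef h (lact g x) = 0.
Proof.
move=> gh; apply: (basic_like_ext (f := coef h \o lact g) (g := \0) bV) => f w.
rewrite -[LHS]/(coef _ (lact g _)) -lactM coef0 // => t' E.
have [u [t'u _]] := FI_end_inv t'.
by apply: (gh (comp f u)); rewrite cmpA E -cmpA t'u cmpm1.
Qed.

Lemma coef_sum s (v : V s) :
  v = \sum_(h : FI_hom gT n s | FI_repr h == h) lact (h : hom n s) (coef h v).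
Proof.
move: v; apply: (generated_ind (basic_like_lt bV) (basic_like_gen bV)) => [|x y Ex Ey|f w].
- by rewrite big1 // => h _; rewrite !linear0.
- rewrite {1}Ex {1}Ey -big_split; apply: eq_bigr => h _; by rewrite !linearD.
- have [t tE] := FI_reprP f.
  rewrite (bigD1 (FI_repr f : FI_hom gT n s)) /=; last first.
    by apply/eqP; have := FI_repr_comp (FI_repr f) t; rewrite -tE => <-.
  have cE : coef (FI_repr f) (lact f w) = lact t w by rewrite {2}tE coef_lact.
  rewrite cE -lactM -tE big1 ?addr0 // => h /andP[/eqP hE /eqP hf].
  rewrite coef0 ?linear0 // => t' E; apply: hf.
  by rewrite E FI_repr_comp.
Qed.

Lemma coef_eq0 s (v : V s) : (forall h, coef h v = 0) -> v = 0.
Proof. by move=> c0; rewrite (coef_sum v) big1 // => h _; rewrite c0 linear0. Qed.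

Lemma coef_in (S : submodule V) s (v : V s) : (forall h, coef h v \in S n) -> v \in S s.
Proof.
move=> cS; rewrite (coef_sum v); apply: rpred_sum => h _.
by apply: sec_act; apply: cS.
Qed.
End Coef.

Lemma coef_hom n V W (bV : basic_like n V) (bW : basic_like n W) (f : lhom V W)
  s (h : hom n s) v : f n (coef bV h v) = coef bW h (f s v).
Proof.
apply: (basic_like_ext (f := llin f n \o coef bV h) (g := coef bW h \o llin f s) bV) => g w.
rewrite -[LHS]/(f n (coef bV h _)) -[RHS]/(coef bW h (f s _)) lfun_nat.
have [[t ->]|/forallNP H] := pselect (exists t, g = comp h t).
  by rewrite !coef_lact lfun_nat.
by rewrite !coef0 // lhom0E.
Qed.

(** Coefficient maps commute with [g], so the coefficients of an element of [K] lie in [K]. Both the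
    coefficient maps and the decomposition [coef_sum] thus restrict from [V] to [K]. *)
Lemma basic_like_ker n K V W (f : lhom K V) (g : lhom V W) : ses f g ->
  basic_like n V -> basic_like n W -> basic_like n K.
Proof.
move=> [fi fg gs] bV bW.
have K0 s : (s < n)%N -> forall x : K s, x = 0.
  by move=> sn x; apply: (fi s); rewrite (basic_like_lt bV sn (f s x)).
have ci s (h : hom n s) x : exists y, llin f n y = (coef bV h \o llin f s) x.
  apply/(fg n (coef bV h (f s x))).
  by rewrite (coef_hom bV bW) (exact_comp0 fg) linear0.
have cE s (h : hom n s) : exists c : {linear K s -> K n}, forall x, f n (c x) = coef bV h (f s x).
  by have [c cE] := linear_factor (fi n) (ci s h); exists c.
split=> // [s x ns|s h].
  have -> : x = \sum_(h : FI_hom gT n s | FI_repr h == h)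
      lact (h : hom n s) (sval (cid (cE s h)) x).
    apply: (injective_homP fi); rewrite (coef_sum bV (f s x)).
    rewrite -[RHS]/(llin f s _) linear_sum; apply: eq_bigr => h _ /=.
    by rewrite lfun_nat; case: cid => c ->.
  elim/big_ind: _ => [|u v|h _]; [exact: Decomposable0|exact: decomposableD|].
  exact: decomposable_act.
have [c cE'] := cE s h; exists c; split=> [w|f' w ne]; apply: (injective_homP fi).
  by rewrite cE' lfun_nat coefK.
by rewrite cE' lfun_nat coef0 // lhom0E.
Qed.

(** The coefficient at [h] is induced by that of [V] at [FI_succ h], which kills the image of
    [to_shift], since [FI_succ h] hits the new point. *)
Lemma basic_like_diff n V : basic_like n.+1 V -> basic_like n (diff V).
Proof.
move=> bV; split.
- move=> s sn x; have [{x}v <-] := to_diff_surj x.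
  by rewrite (basic_like_lt bV _ (v : V s.+1)) // (lhom0E (to_diff V) s).
- exact/diff_generated_lt/basic_like_gen.
- move=> s h.
  pose c0 : {linear shift V s -> diff V n} := llin (to_diff V) n \o coef bV (FI_succ h).
  have [|v /to_diff_exact[u <-]|c cE] := @linear_descent _ _ _ _ (llin (to_diff V) s) c0.
  + exact: to_diff_surj.
  + rewrite -[LHS]/(to_diff V n (coef bV (FI_succ h) (lact (lift s) u))).
    rewrite coef_unfactor ?(lhom0E (to_diff V) n) // => h' /(congr1 (fun p => FI_inj p ord0)).
    by rewrite !FI_SE.
  exists c; split=> [w|f w ne]; have [{w}w <-] := to_diff_surj w.
    rewrite -lfun_nat; apply: etrans (cE _) _.
    by rewrite -[LHS]/(to_diff V n (coef bV _ (lact (FI_succ h) w))) coefK.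
  rewrite -lfun_nat; apply: etrans (cE _) _.
  rewrite -[LHS]/(to_diff V n (coef bV _ (lact (FI_succ f) w))).
  rewrite coef0 ?(lhom0E (to_diff V) n) // => t E.
  by have [t' [_ E']] := FI_succ_comp_inv E; apply: (ne t').
Qed.

Lemma basic_like0_diff V : basic_like 0 V -> forall s (x : diff V s), x = 0.
Proof.
move=> bV s x; apply: generated_lt0; apply: diff_generated_lt; exact: basic_like_gen.
Qed.

Lemma basic_like_to_shift n V : basic_like n V -> injective_hom (to_shift V).
Proof.
move=> bV s v v0; apply: (coef_eq0 (bV := bV)) => h.
by rewrite -(coef_comp bV (lift s)) -[lact _ v]/(to_shift V s v) v0 linear0.
Qed.

(** * Free modules *)

Section FreeMod.
Variables (A : Type) (deg : A -> nat).
Definition free_basis s := {a : A & hom (deg a) s}.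
Definition free_basis_act s t (f : hom s t) (b : free_basis s) : free_basis t :=
  existT _ (projT1 b) (comp f (projT2 b)).
Definition free_act s t (f : hom s t) := free_map k (free_basis_act f).
Fact free_act1 s u : free_act (@idm (FI gT) s) u = u.
Proof.
apply: (free_ext (g := idfun)) => -[a f].
rewrite /free_act free_map_delta; congr (delta k (existT _ a _)).
exact: (cmp1m (c := FI gT)).
Qed.
Fact free_actM s t l (g : hom t l) (f : hom s t) u :
  free_act (comp g f) u = free_act g (free_act f u).
Proof.
apply: (free_ext (g := free_act g \o free_act f)) => -[a h].
rewrite -[RHS]/(free_act g (free_act f _)) /free_act !free_map_delta.
by congr (delta k (existT _ a _)); apply/esym/(cmpA (c := FI gT)).
Qed.
(** The direct sum over [A] of the representable modules k[Hom([deg a], -)]. *)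
Definition free_mod : module :=
  @LeftModule k (FI gT) (fun s => free_lmod k (free_basis s)) free_act free_act1 free_actM.
Definition free_elt s (a : A) (f : hom (deg a) s) : free_mod s := delta k (existT _ a f).
Definition free_gen a : free_mod (deg a) := free_elt (idm (deg a : FI gT)).

Lemma free_lact s t (g : hom s t) a (f : hom (deg a) s) :
  lact g (free_elt f) = free_elt (comp g f).
Proof. exact: free_map_delta. Qed.
Lemma free_eltE s a (f : hom (deg a) s) : free_elt f = lact f (free_gen a).
Proof. by rewrite free_lact cmpm1. Qed.

Lemma free_mod_ext s (U : lmodType k) (f g : {linear free_mod s -> U}) :
  (forall a (h : hom (deg a) s), f (free_elt h) = g (free_elt h)) -> f =1 g.
Proof. by move=> fg; apply: free_ext => -[a h]; apply: fg. Qed.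

Lemma free_mod_ind s (P : free_mod s -> Prop) : P 0 ->
  (forall x y, P x -> P y -> P (x + y)) -> (forall c a (h : hom (deg a) s), P (c *: free_elt h)) ->
  forall v, P v.
Proof.
move=> P0 PD PE v; have [S vS] := free_supp v; rewrite (free_deltaE vS).
elim/big_ind: _ => // -[a h] _; exact: PE.
Qed.

Section FreeHom.
Variables (W : module) (w : forall a, W (deg a)).
Definition free_hom_fun s : {linear free_mod s -> W s} :=
  free_lift (fun b : free_basis s => lact (projT2 b) (w (projT1 b))).
Fact free_hom_nat s t (f : hom s t) (u : free_mod s) :
  free_hom_fun t (lact f u) = lact f (free_hom_fun s u).
Proof.
apply: (free_mod_ext (f := free_hom_fun t \o lact f) (g := lact f \o free_hom_fun s)) => a h.
rewrite -[LHS]/(free_hom_fun t (lact f _)) -[RHS]/(lact f (free_hom_fun s _)) free_lact.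
by rewrite /free_hom_fun /free_elt !free_lift_delta /= lactM.
Qed.
Definition free_mod_hom : lhom free_mod W :=
  @LHom k (FI gT) free_mod W free_hom_fun (fun s => linearP (free_hom_fun s)) free_hom_nat.
Lemma free_mod_homE s a (f : hom (deg a) s) : free_mod_hom s (free_elt f) = lact f (w a).
Proof. exact: free_lift_delta. Qed.
End FreeHom.

Lemma free_mod_projective : projective free_mod.
Proof.
move=> W U p f ps; pose w a : W (deg a) := sval (cid (ps _ (f _ (free_gen a)))).
have wE a : p _ (w a) = f _ (free_gen a) by rewrite /w; case: cid.
exists (free_mod_hom w); apply: lhomP => s.
apply: (free_mod_ext (f := llin p s \o llin (free_mod_hom w) s) (g := llin f s)) => a h.
rewrite -[LHS]/(p s (free_mod_hom w s _)) -[RHS]/(f s _) free_mod_homE.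
by rewrite lfun_nat wE -lfun_nat -free_eltE.
Qed.

Lemma free_mod_generated_lt d : (forall a, (deg a < d)%N) -> generated_lt d free_mod.
Proof.
move=> degd s v ds; elim/free_mod_ind: v => [|x y|c a h].
- exact: Decomposable0.
- exact: decomposableD.
- apply: decomposableZ; rewrite free_eltE; apply: decomposable_act.
  exact: leq_trans (degd a) ds.
Qed.
End FreeMod.

Lemma free_mod_basic_like n (A : Type) : basic_like n (free_mod (fun _ : A => n)).
Proof.
split.
- move=> s sn v; elim/free_mod_ind: v => [//|x y -> ->|c a h]; first by rewrite addr0.
  by have := FI_hom_leq h; rewrite leqNgt sn.
- by apply: free_mod_generated_lt.
move=> s h.
(* The coefficient at [h] sends a basis element [comp h t] to [t], unique by [FI_monic], and all
   other basis elements to 0. *)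
pose c : {linear free_mod (fun _ : A => n) s -> free_mod (fun _ : A => n) n} :=
  free_lift (fun b : free_basis (fun _ : A => n) s =>
    if pselect (exists t, projT2 b = comp h t) is left E
    then free_elt (deg := fun _ : A => n) (a := projT1 b) (sval (cid E)) else 0).
have cE (f : hom n s) (a : A) t : f = comp h t ->
  c (free_elt (deg := fun _ => n) (a := a) f) = free_elt (deg := fun _ => n) (a := a) t.
  move=> E; rewrite /c /free_elt free_lift_delta /=; case: pselect => [E'|[]]; last by exists t.
  by case: cid => t' /= /esym; rewrite E => /FI_monic ->.
have c0 (f : hom n s) (a : A) : (forall t, f <> comp h t) ->
  c (free_elt (deg := fun _ => n) (a := a) f) = 0.
  by move=> H; rewrite /c /free_elt free_lift_delta /=; case: pselect => // -[t E]; case: (H t E).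
exists c; split=> [w|f w H].
  apply: (free_mod_ext (deg := fun _ => n) (f := c \o lact h) (g := idfun)) => a t.
  by rewrite -[LHS]/(c (lact h _)) free_lact (cE _ _ t).
apply: (free_mod_ext (deg := fun _ => n) (f := c \o lact f) (g := \0)) => a t.
rewrite -[LHS]/(c (lact f _)) free_lact c0 // => t' E.
have [u [tu _]] := FI_end_inv t.
by apply: (H (comp t' u)); rewrite cmpA -E -cmpA tu cmpm1.
Qed.

(** All free generators are placed in degree [n], so that the cover is itself of the form M(W) with
    W in degree [n], and its kernel can be compared degree by degree. *)
Definition degree_cover n V : lhom (free_mod (fun _ : V n => n)) V :=
  free_mod_hom (deg := fun _ : V n => n) (fun v => v).

Lemma degree_cover_surj n V : (forall s, (s < n)%N -> forall v : V s, v = 0) ->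
  generated_lt n.+1 V -> surjective_hom (degree_cover n V).
Proof.
move=> V0 gV s v; move: v; apply: (generated_ind V0 gV) => [|x y [u <-] [u' <-]|f w].
- by exists 0; rewrite lhom0E.
- by exists (u + u'); rewrite lhomD.
- by exists (free_elt (deg := fun _ => n) (a := w) f); rewrite free_mod_homE.
Qed.

(** The kernel of [degree_cover] is again generated in degree [n], so all its elements above degree
    [n] are decomposable; up to degree [n] the free module has no nonzero decomposable element. *)
Lemma basic_like_tor1 n V : basic_like n V -> tor1_vanish V.
Proof.
move=> bV.
have fg := ker_ses (degree_cover_surj (basic_like_lt bV) (basic_like_gen bV)).
have bU := free_mod_basic_like n (V n).
have bK := basic_like_ker fg bU bV.
apply: (tor1_vanishP fg (@free_mod_projective _ _)) => s x dx.
case: (leqP s n) => sn; last exact: basic_like_gen bK _ _ sn.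
suff -> : x = 0 by apply: Decomposable0.
apply: (ses_inj fg); elim: dx => // m f u v ms _ ->.
by rewrite (basic_like_lt bU (leq_trans ms sn) u) linear0 addr0.
Qed.

Lemma basic_like_tor n V j : basic_like n V -> tor_vanish j V.
Proof.
elim: j V => [|j IH] V bV; first exact: basic_like_tor1 bV.
have fg := ker_ses (degree_cover_surj (basic_like_lt bV) (basic_like_gen bV)).
apply: (tor_vanish_syzygy fg (@free_mod_projective _ _)).
exact/IH/(basic_like_ker fg (free_mod_basic_like n (V n)) bV).
Qed.

(** Above degree [n] the free cover is decomposable, hence by Tor_1 so is the kernel: it is
    generated in degree [n]. Coefficient maps of the cover then send kernel to kernel and descend to
    [V]. *)
Lemma tor1_basic_like n V : (forall s, (s < n)%N -> forall v : V s, v = 0) ->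
  generated_lt n.+1 V -> tor1_vanish V -> basic_like n V.
Proof.
move=> V0 gV tV; split=> // s h.
have := ker_ses (degree_cover_surj V0 gV).
set i := sub_mod_incl _; set p := degree_cover n V => ip.
have bU := free_mod_basic_like n (V n).
have K0 t : (t < n)%N -> forall v : sub_mod (ker_mod p) t, v = 0.
  by move=> tn v; apply: (ses_inj ip); rewrite (basic_like_lt bU tn (i t v)).
have gK : generated_lt n.+1 (sub_mod (ker_mod p)).
  by move=> t v nt; apply: (tV _ _ _ _ ip); apply: (basic_like_gen bU).
have c0 u : p s u = 0 -> p n (coef bU h u) = 0.
  move=> /(ses_exact ip)[v <-]; move: v; apply: (generated_ind K0 gK) => [|x y Ex Ey|f w].
  - by rewrite !(lhom0E, linear0).
  - by rewrite lhomD linearD lhomD Ex Ey addr0.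
  rewrite lfun_nat; have [[t ->]|/forallNP H] := pselect (exists t, f = comp h t).
    by rewrite coef_lact lfun_nat (exact_comp0 (ses_exact ip)) linear0.
  by rewrite coef0 // lhom0E.
have [||c cE] := @linear_descent _ _ _ _ (llin p s) (llin p n \o coef bU h).
- exact: ses_surj ip s.
- exact: c0.
exists c; split=> [w|f w H]; have [{w}u <-] := ses_surj ip w; rewrite -lfun_nat.
  by apply: etrans (cE _) _; rewrite /= coefK.
by apply: etrans (cE _) _; rewrite -[LHS]/(p n (coef bU h (lact f u))) coef0 // lhom0E.
Qed.

End BasicLike.

(** * Filtrations *)

Lemma free_lift_linear_r (k : comPzRingType) (X : Type) (V U : lmodType k) (F : X -> V -> U)
  (FL : forall x, linear (F x)) (u : free_lmod k X) :
  linear (fun v => free_lift (F^~ v) u).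
Proof.
move=> a v v'; have [A uA] := free_supp u.
rewrite /= !(free_lift_funE _ uA) scaler_sumr -big_split; apply: eq_bigr => x _ /=.
by rewrite FL scalerDr !scalerA mulrC.
Qed.

Lemma pure_ind (k : comPzRingType) (C : category) (N : right_module k C) (V : left_module k C)
  (P : tensor N V -> Prop) : P 0 -> (forall t u, P t -> P u -> P (t + u)) ->
  (forall x (n : N x) (v : V x), P (pure n v)) -> forall t, P t.
Proof.
move=> P0 PD PP; elim/quot_ind => u; have [A uA] := free_supp u.
rewrite (free_deltaE uA) linear_sum; elim/big_ind: _ => // -[x [n v]] _.
rewrite linearZ_LR -[X in _ *: X]/(pure n v).
have pL a : a *: pure n v = pure (a *: n) v.
  by rewrite -[a *: n]addr0 pureL -[X in _ + X]/(mk_linear (pureL v) 0) linear0 addr0.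
by rewrite pL.
Qed.

Section Iso.
Variables (k : comPzRingType) (C : category).
Implicit Types V W : left_module k C.

Lemma bij_hom V W (f : lhom V W) : injective_hom f -> surjective_hom f ->
  forall x, bijective (f x).
Proof.
move=> fi fs x; exists (fun w => sval (cid (fs x w))) => [v|w]; case: cid => //= u uE.
exact: (injective_homP fi).
Qed.

Lemma liso_of V W (f : lhom V W) : injective_hom f -> surjective_hom f -> liso V W.
Proof. by move=> fi fs; exists f; apply: bij_hom. Qed.

Lemma liso_sym V W : liso V W -> liso W V.
Proof.
move=> [f fb].
have fi : injective_hom f by move=> x v fv; apply: (bij_inj (fb x)); rewrite fv lhom0E.
have fs x w : exists v, f x v = lhom_id W x w by have [g _ fg] := fb x; exists (g w).
exists (factor fi fs) => x; exists (f x) => v; first exact: (factorE fi fs).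
by apply: (injective_homP fi); rewrite factorE.
Qed.

Lemma liso_trans V W U : liso V W -> liso W U -> liso V U.
Proof. by move=> [f fb] [g gb]; exists (lhom_comp g f) => x; apply: (bij_comp (gb x) (fb x)). Qed.

Lemma liso_total V (S : submodule V) : (forall x v, v \in S x) -> liso (sub_mod S) V.
Proof.
move=> St; apply: (@liso_of _ _ (sub_mod_incl S)) => [x v v0|x v]; first exact: val_inj.
by exists (SubMk (St x v)).
Qed.

Lemma subquotient_ses V (S T : submodule V) : (forall x v, v \in S x -> v \in T x) ->
  exists (i : lhom (sub_mod S) (sub_mod T)) (p : lhom (sub_mod T) (subquotient T S)),
    ses i p /\ forall x v, sub_val (i x v) = sub_val v.
Proof.
move=> ST.
have ii : injective_hom (sub_mod_incl T) by move=> x v v0; apply: val_inj.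
have H x v : exists u, sub_mod_incl T x u = sub_mod_incl S x v.
  by exists (SubMk (ST _ _ (sub_valP v))).
exists (factor ii H), (quot_hom _); split; last by move=> x v; apply: (factorE ii H).
split; last exact: quot_hom_surj.
  move=> x v v0; apply: val_inj; rewrite -[LHS]/(sub_mod_incl S x v) -(factorE ii H).
  by rewrite v0 lhom0E.
move=> x w; rewrite quot_homP preimE; split=> [wS|[v <-]].
  by exists (SubMk wS); apply: (injective_homP ii); rewrite factorE.
by rewrite -[llin _ x _]/(sub_mod_incl T x _) factorE; apply: sub_valP.
Qed.
End Iso.

Section Basic.
Variables (k : comPzRingType) (gT : finGroupType) (n : nat).
Notation hom n m := (@hom (FI gT) n m).
Notation comp f g := (@cmp (FI gT) _ _ _ f g).
Notation fh s := (free_hom k (n : FI gT) s).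

Section FreeCoef.
Variables (s : nat) (h : hom n s).
Definition free_coef_fun : {linear free_lmod k (hom n s) -> free_lmod k (hom n n)} :=
  free_lift (fun f => if pselect (exists t, f = comp h t) is left E
    then delta k (sval (cid E)) else 0).
Lemma free_coefE t : free_coef_fun (delta k (comp h t)) = delta k t.
Proof.
rewrite /free_coef_fun free_lift_delta; case: pselect => [E|[]]; last by exists t.
by case: cid => t' /= /FI_monic ->.
Qed.
Lemma free_coef0 f : (forall t, f <> comp h t) -> free_coef_fun (delta k f) = 0.
Proof.
move=> H; rewrite /free_coef_fun free_lift_delta; case: pselect => // -[t E].
by case: (H t E).
Qed.
Fact free_coef_nat (t : hom n n) u :
  free_coef_fun (ract (r := fh s) (x := tt) (y := tt) t u) =
  ract (r := fh n) (x := tt) (y := tt) t (free_coef_fun u).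
Proof.
apply: (free_ext (f := free_coef_fun \o ract (r := fh s) (x := tt) (y := tt) t)
  (g := ract (r := fh n) (x := tt) (y := tt) t \o free_coef_fun)) => f.
rewrite -[LHS]/(free_coef_fun (free_map k _ (delta k f))).
rewrite -[RHS]/(free_map k _ (free_coef_fun (delta k f))) free_map_delta.
have [[t' ->]|/forallNP H] := pselect (exists t', f = comp h t').
  by rewrite free_coefE free_map_delta -cmpA free_coefE.
rewrite !free_coef0 ?linear0 // => t' E; have [t2 [tu _]] := FI_end_inv t.
by apply: (H (comp t' t2)); rewrite cmpA -E -cmpA tu cmpm1.
Qed.
Definition free_coef : rhom (fh s) (fh n) :=
  @RHom k _ (fh s) (fh n) (fun _ => free_coef_fun) (fun _ => linearP free_coef_fun)
    (fun _ _ => free_coef_nat).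
End FreeCoef.

Variable W : left_module k (end_cat (n : FI gT)).
Notation pd f w := (@pure k (end_cat (n : FI gT)) (fh _) W tt (delta k f) w).

Lemma basic_lact s t (g : hom s t) (f : hom n s) w :
  lact (l := basic W) g (pd f w) = pd (comp g f) w.
Proof.
rewrite -[LHS]/(tensor_map _ _ _) tensor_mapE.
by rewrite -[X in pure X _]/(free_map k _ _) free_map_delta.
Qed.

Lemma basic_ind s (P : basic W s -> Prop) : P 0 -> (forall t u, P t -> P u -> P (t + u)) ->
  (forall (f : hom n s) w, P (pd f w)) -> forall t, P t.
Proof.
move=> P0 PD PP; apply: pure_ind => // -[] u w; have [A uA] := free_supp u.
rewrite (free_deltaE uA) -[pure _ _]/(mk_linear (pureL (N := fh s) (V := W) (x := tt) w) _).
rewrite linear_sum; elim/big_ind: _ => // f _; rewrite linearZ_LR.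
rewrite -[X in P X]/(_ *: pd (f : hom n s) w).
rewrite -[pd _ _]/(mk_linear (pureR (N := fh s) (V := W) (x := tt) _) w) -linearZ_LR.
exact: PP.
Qed.

(** The coefficient map at [h] is induced by the projection of k[Hom([n],[s])] to its summand
    spanned by the orbit of [h], a copy of kG_n. *)
Lemma basic_basic_like : basic_like n (basic W).
Proof.
split.
- move=> s sn v; move: v; apply: basic_ind => [//|t u -> ->|f w]; first by rewrite addr0.
  by have := FI_hom_leq f; rewrite leqNgt sn.
- move=> s v ns; move: v; apply: basic_ind => [|t u|f w].
  + exact: Decomposable0.
  + exact: decomposableD.
  + by rewrite -[f]cmpm1 -basic_lact; apply: decomposable_act.
move=> s h; pose c := tensor_map (free_coef h) (lhom_id W); exists c; split=> [w|f w H].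
  move: w; apply: basic_ind => [|x y|t w]; first by rewrite !linear0.
    by move=> Ex Ey; rewrite (linearD (lact h)) (linearD c) Ex Ey.
  by rewrite basic_lact /c tensor_mapE -[X in pure X _]/(free_coef_fun h _) free_coefE.
move: w; apply: basic_ind => [|x y|t w]; first by rewrite !linear0.
  by move=> Ex Ey; rewrite (linearD (lact f)) (linearD c) Ex Ey addr0.
rewrite basic_lact /c tensor_mapE -[X in pure X _]/(free_coef_fun h _) free_coef0; last first.
  move=> t' E; have [u [tu _]] := FI_end_inv t.
  by apply: (H (comp t' u)); rewrite cmpA -E -cmpA tu cmpm1.
by rewrite -[pure _ _]/(mk_linear (pureL (N := fh n) (V := W) (x := tt) _) 0) linear0.
Qed.
End Basic.

Section BasicIso.
Variables (k : comPzRingType) (gT : finGroupType) (n : nat) (V : left_module k (FI gT)).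
Notation hom n m := (@hom (FI gT) n m).
Notation fh s := (free_hom k (n : FI gT) s).

Definition degree_part : left_module k (end_cat (n : FI gT)) :=
  @LeftModule k (end_cat (n : FI gT)) (fun _ => V n) (fun _ _ f => lact (l := V) f)
    (fun _ v => lact1 (l := V) (x := n) v)
    (fun _ _ _ g f v => lactM (l := V) (x := n) (y := n) (z := n) g f v).

Section Eval.
Variable s : nat.
Definition eval_fun (x : end_cat (n : FI gT)) (u : fh s x) (v : degree_part x) : V s :=
  free_lift (fun f : hom n s => lact f v) u.
Fact eval_L x v : linear (fun u => @eval_fun x u v).
Proof. exact: linearP. Qed.
Fact eval_R x u : linear (@eval_fun x u).
Proof. exact: (free_lift_linear_r (F := fun (f : hom n s) v => lact f v) (fun f => linearP (lact f))). Qed.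
Fact eval_B (x y : end_cat (n : FI gT)) (f : Defs.hom x y) (u : fh s y) (v : degree_part x) :
  eval_fun (ract f u) v = eval_fun u (lact f v).
Proof.
apply: (free_ext (f := free_lift (fun f : hom n s => lact f v) \o ract (r := fh s) f)
  (g := free_lift (fun g : hom n s => lact g (lact (l := degree_part) f v)))) => g.
rewrite free_lift_delta -[LHS]/(free_lift _ (free_map k _ (delta k g))) free_map_delta.
by rewrite free_lift_delta lactM.
Qed.
Definition eval : {linear basic degree_part s -> V s} := tensor_lift eval_L eval_R eval_B.
Lemma evalE (f : hom n s) (v : V n) :
  eval (@pure _ _ (fh s) degree_part tt (delta k f) v) = lact f v.
Proof. by rewrite /eval tensor_liftE /eval_fun free_lift_delta. Qed.
End Eval.

Fact eval_nat s t (g : hom s t) x : eval t (lact g x) = lact g (eval s x).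
Proof.
move: x; apply: basic_ind => [|x y|f w]; first by rewrite !linear0.
  by move=> Ex Ey; rewrite (linearD (lact g)) !(linearD (eval _)) linearD Ex Ey.
by rewrite basic_lact !evalE lactM.
Qed.
Definition eval_hom : lhom (basic degree_part) V :=
  @LHom k (FI gT) (basic degree_part) V eval (fun s => linearP (eval s)) eval_nat.

(** Injectivity of the evaluation is checked on coefficients, that is in degree [n], where every
    tensor has the form [delta k (idm _)] tensored with some [v]. *)
Lemma basic_like_liso : basic_like n V -> liso V (basic degree_part).
Proof.
move=> bV; apply: liso_sym; have bB := basic_basic_like degree_part.
apply: (@liso_of _ _ _ _ eval_hom) => [s x x0|s v].
  apply: (coef_eq0 (bV := bB)) => h.
  have : eval_hom n (coef bB h x) = 0 by rewrite (coef_hom bB bV) x0 linear0.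
  have /(_ (coef bB h x))[v ->] : forall x, exists v, x = @pure _ _ (fh n) degree_part tt (delta k (idm _)) v.
    apply: basic_ind => [|y z [v ->] [w ->]|f w].
    - by exists 0; rewrite -[RHS]/(mk_linear (pureR (N := fh n) (V := degree_part) (x := tt) _) 0) linear0.
    - by exists (v + w); rewrite -[RHS]/(mk_linear (pureR (N := fh n) (V := degree_part) (x := tt) _) (v + w)) linearD.
    - exists (lact (l := V) f w).
      rewrite -[lact f w]/(lact (l := degree_part) (x := tt) (y := tt) f w) -pureB.
      by rewrite -[X in _ = pure X _]/(free_map k _ (delta k _)) free_map_delta cmp1m.
  rewrite -[LHS]/(eval n _) evalE lact1 => ->.
  by rewrite -[LHS]/(mk_linear (pureR (N := fh n) (V := degree_part) (x := tt) _) 0) linear0.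
move: v; apply: (generated_ind (basic_like_lt bV) (basic_like_gen bV)) => [|x y [u <-] [v <-]|f w].
- by exists 0; rewrite lhom0E.
- by exists (u + v); rewrite lhomD.
- by exists (@pure _ _ (fh s) degree_part tt (delta k f) w); apply: evalE.
Qed.
End BasicIso.

Section Devissage.
Variables (k : comPzRingType) (gT : finGroupType).
Notation module := (left_module k (FI gT)).
Notation hom n m := (@hom (FI gT) n m).
Notation comp f g := (@cmp (FI gT) _ _ _ f g).
Implicit Types V : module.

Section Trunc.
Variables (V : module) (d : nat).
Definition trunc_gen s (v : V s) := exists m (f : hom m s) (u : V m), (m < d)%N /\ v = lact f u.
Fact trunc_act s t (f : hom s t) (v : V s) :
  v \in span (@trunc_gen s) -> lact f v \in span (@trunc_gen t).
Proof.
move=> /spanE H; apply/spanE => S SP; apply/(preimE (lact f) S v)/H => w [m [g [u [md ->]]]].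
by apply/preimE/SP; exists m, (comp f g), u; rewrite lactM.
Qed.
Definition trunc : submodule V := Submodule trunc_act.

Lemma trunc_ind s (S : submodClosed (V s)) :
  (forall m (f : hom m s) (u : V m), (m < d)%N -> lact f u \in S) ->
  forall v, v \in trunc s -> v \in S.
Proof. by move=> SP v /spanE; apply=> w [m [f [u [md ->]]]]; apply: SP. Qed.

Lemma trunc_lact m s (f : hom m s) (u : V m) : (m < d)%N -> lact f u \in trunc s.
Proof. by move=> md; apply/spanE => S; apply; exists m, f, u. Qed.

Lemma trunc_lt s (v : V s) : (s < d)%N -> v \in trunc s.
Proof. by move=> sd; rewrite -[v]lact1; apply: trunc_lact. Qed.

Lemma trunc_generated_lt : generated_lt d (sub_mod trunc).
Proof.
move=> s v ds.
(* Decomposability must be witnessed inside the submodule, so what is propagated along the span is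
   the existence of a decomposable element of [sub_mod trunc] with the given value. *)
have P0 : exists2 w : sub_mod trunc s, decomposable w & sub_val w = 0.
  by exists 0 => //; apply: Decomposable0.
have PL a x y : (exists2 w : sub_mod trunc s, decomposable w & sub_val w = x) ->
   (exists2 w : sub_mod trunc s, decomposable w & sub_val w = y) ->
   exists2 w : sub_mod trunc s, decomposable w & sub_val w = a *: x + y.
  move=> [w dw <-] [w' dw' <-]; exists (a *: w + w').
    by apply: decomposableD => //; apply: decomposableZ.
  exact: (linearP (sub_incl (trunc s))).
have : sub_val v \in mk_submod P0 PL.
  move: (sub_valP v); apply: trunc_ind => m f u md; apply/mk_submodE.
  exists (lact (l := sub_mod trunc) f (SubMk (trunc_lt u md))) => //.
  by apply: decomposable_act; apply: leq_trans md ds.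
by move=> /mk_submodE[w dw /val_inj <-].
Qed.

Lemma trunc_total : generated_lt d V -> forall s v, v \in trunc s.
Proof.
move=> gV; elim/ltn_ind => s IH v; case: (ltnP s d) => [/trunc_lt //|ds].
elim: (gV s v ds) => [|m f u w ms _ wT]; first exact: rpred0.
by apply: rpredD => //; apply: sec_act; apply: IH.
Qed.
End Trunc.

Lemma trunc0 V s (v : V s) : v \in trunc V 0 s <-> v = 0.
Proof.
split=> [|->]; last exact: rpred0.
have PL a (x y : V s) : x = 0 -> y = 0 -> a *: x + y = 0 by move=> -> ->; rewrite scaler0 addr0.
move=> vT; apply/(mk_submodE (P := fun v => v = 0) erefl PL).
exact: trunc_ind vT.
Qed.

Lemma truncS V d s (v : V s) : v \in trunc V d s -> v \in trunc V d.+1 s.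
Proof. by apply: trunc_ind => m f u md; apply: trunc_lact; apply: ltnW. Qed.

(** Below degree [d] the modules [A] and [B] agree, and from [d] on [A] is decomposable, so
    decomposable elements of [B] coming from [A] are images of decomposable ones. Hence Tor_1 of [D]
    vanishes and [D] is M(W); then Tor_2 of [D] vanishes too, which gives Tor_1 of [A]. *)
Lemma tor1_devissage d A B D (i : lhom A B) (p : lhom B D) : ses i p ->
  tor1_vanish B -> generated_lt d A -> generated_lt d.+1 B ->
  (forall s, (s < d)%N -> forall v : D s, v = 0) ->
  @tor1_vanish k gT A /\ basic_like d D.
Proof.
move=> ip tB gA gB D0.
have bD : basic_like d D.
  apply: tor1_basic_like => //; first exact: generated_lt_surj (ses_surj ip) gB.
  apply: (tor1_vanish_quot (ses_exact ip) (ses_surj ip) tB) => s x dx.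
  case: (ltnP s d) => [sd|ds]; last by exists x => //; apply: gA.
  elim: dx => [|m f u w ms _ [y dy yE]].
    by exists 0; [apply: Decomposable0|rewrite lhom0E].
  have /(ses_exact ip)[u' u'E] : p m u = 0 by apply: D0; apply: ltn_trans ms sd.
  exists (lact f u' + y); first exact: DecomposableS.
  by rewrite lhomD lfun_nat u'E yE.
by split=> //; apply: (tor_vanish_sub (j := 0) ip tB); apply: basic_like_tor bD.
Qed.

Lemma tor1_sharp_filtered d V : generated_lt d V -> tor1_vanish V -> sharp_filtered V.
Proof.
(* With [r = d] the truncation is already everything at index [d] and the last quotient is zero;
   this covers [d = 0] without a predecessor. *)
move=> gV tV; exists d, (trunc V).
have gV' : generated_lt d.+1 V by move=> s v ds; apply: gV; apply: ltnW.
have key i : (i <= d)%N -> tor1_vanish (sub_mod (trunc V i.+1)) ->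
  tor1_vanish (sub_mod (trunc V i)) /\ basic_like i (subquotient (trunc V i.+1) (trunc V i)).
  move=> id tT; have [j [p [jp jE]]] := subquotient_ses (@truncS V i).
  apply: (tor1_devissage jp) => //; try exact: trunc_generated_lt.
  move=> s si x; have [{x}x <-] := ses_surj jp x; apply/(ses_exact jp).
  exists (SubMk (trunc_lt (sub_val x) si)); apply: val_inj; exact: jE.
(* Descending induction: [m] counts the steps down from index [d.+1], where the truncation is all of
   [V]. *)
have key2 m : (m <= d.+1)%N -> tor1_vanish (sub_mod (trunc V (d.+1 - m))).
  elim: m => [_|m IH md].
    rewrite subn0; apply: (tor_vanish_iso (j := 0)) tV; exact/liso_total/trunc_total.
  have dm : (d.+1 - m = (d.+1 - m.+1).+1)%N by rewrite -subSn.
  apply: (proj1 (key (d.+1 - m.+1)%N _ _)); first by rewrite subSS leq_subr.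
  by rewrite -dm; apply/IH/ltnW.
split=> [s v|s v|i id s v|i id].
- exact: trunc0.
- exact: trunc_total.
- exact: truncS.
- exists (degree_part i (subquotient (trunc V i.+1) (trunc V i))).
  apply: basic_like_liso; apply: (proj2 (key i id _)).
  have := key2 (d - i)%N (leq_trans (leq_subr _ _) (leqnSn _)).
  by rewrite subSn ?leq_subr // subKn.
Qed.

Lemma sharp_filtered_tor1 V : sharp_filtered V -> tor1_vanish V.
Proof.
move=> [r [F [F0 Fr FS FW]]].
have key i : (i <= r.+1)%N -> tor1_vanish (sub_mod (F i)).
  elim: i => [_|i IH ir].
    apply: (tor_vanish_zero 0) => s [v vF]; apply: val_inj => /=; exact/F0.
  have [j [p [jp _]]] := subquotient_ses (FS i ir).
  apply: (tor_vanish_ext (j := 0) jp); first by apply: IH; apply: ltnW.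
  have [W WE] := FW i ir; apply: (tor_vanish_iso (j := 0) WE).
  exact: basic_like_tor1 (basic_basic_like W).
by apply: (tor_vanish_iso (j := 0)) (key r.+1 (leqnn _)); apply/liso_sym/liso_total.
Qed.
End Devissage.

(** * Tor and the difference *)

Section Difference.
Variables (k : comPzRingType) (gT : finGroupType).
Notation module := (left_module k (FI gT)).
Notation hom n m := (@hom (FI gT) n m).
Notation comp f g := (@cmp (FI gT) _ _ _ f g).
Notation lift n := (@FI_lift gT n).
Implicit Types V : module.

Lemma quot_trunc_lt V d s (v : quot_mod (trunc V d) s) : (s < d)%N -> v = 0.
Proof.
by move=> sd; have [u <-] := quot_hom_surj v; apply/quot_homP/trunc_lt.
Qed.

(** Both claims hold for M(W) and pass to extensions. For the second, the sequence of differences is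
    exact because the top quotient, being some M(W), embeds in its shift. *)
Lemma tor1_diff d V : generated_lt d V -> tor1_vanish V ->
  injective_hom (to_shift V) /\ tor1_vanish (diff V).
Proof.
elim: d V => [|d IH] V gV tV.
  have V0 := generated_lt0 gV; split=> [s v _|]; first exact: V0.
  apply: (tor_vanish_zero 0) => s x; have [u <-] := to_diff_surj x.
  by rewrite (V0 _ (u : V s.+1)) (lhom0E (to_diff V) s).
have ses := quot_ses (trunc V d).
have [tA bD] := tor1_devissage ses tV (@trunc_generated_lt _ _ V d) gV
  (fun s sd v => quot_trunc_lt v sd).
have [Ai tdA] := IH _ (@trunc_generated_lt _ _ V d) tA.
have Di := basic_like_to_shift bD.
split; first exact: to_shift_inj_ext ses Ai Di.
apply: (tor_vanish_ext (j := 0) (diff_ses3 ses Di) tdA).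
case: d {IH gV ses tA Ai tdA} bD Di => [|d] bD _.
  exact/(tor_vanish_zero 0)/basic_like0_diff.
exact: basic_like_tor1 (basic_like_diff bD).
Qed.

Lemma tor1_shift d V : generated_lt d V -> tor1_vanish V -> tor1_vanish (shift V).
Proof.
move=> gV tV; have [Vi tD] := tor1_diff gV tV.
exact: (tor_vanish_ext (j := 0) (diff_ses Vi) tV tD).
Qed.

Lemma tor1_tor d V j : generated_lt d V -> tor1_vanish V -> tor_vanish j V.
Proof.
elim: d V => [|d IH] V gV tV; first exact/tor_vanish_zero/generated_lt0.
have ses := quot_ses (trunc V d).
have [tA bD] := tor1_devissage ses tV (@trunc_generated_lt _ _ V d) gV
  (fun s sd v => quot_trunc_lt v sd).
apply: (tor_vanish_ext ses); last exact: basic_like_tor bD.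
exact: IH (@trunc_generated_lt _ _ V d) tA.
Qed.

(** There is only one morphism from 0 to [s], so generation makes its action surjective and the
    hypothesis on [to_shift] makes it injective; the coefficient map is its inverse. *)
Lemma generated_lt1_basic_like V : generated_lt 1 V -> injective_hom (to_shift V) ->
  basic_like 0 V.
Proof.
move=> gV Vi; split=> // s h.
have hs (v : V s) : exists w, lact h w = v.
  have V0 t : (t < 0)%N -> forall u : V t, u = 0 by [].
  move: v; apply: (generated_ind V0 gV) => [|x y [u <-] [w <-]|f w].
  - by exists 0; rewrite linear0.
  - by exists (u + w); rewrite linearD.
  - by exists w; rewrite (FI_hom0 h f).
have [c cE] := linear_factor (i := lact h) (f := idfun) (@to_shift_inj_act _ _ _ Vi _ _ h) hs.
exists c; split=> [w|f w /(_ (idm _))].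
  apply/eqP; rewrite -subr_eq0; apply/eqP/(@to_shift_inj_act _ _ _ Vi _ _ h).
  by rewrite linearB cE subrr.
by rewrite (FI_hom0 f (comp h (idm _))).
Qed.

(** As [V] vanishes in degree [e], [to_diff] identifies [V e.+1] with [diff V e]. A morphism [h] is
    brought to the form [FI_succ h'] by automorphisms on both sides, and its coefficient is that of
    [diff V] at [h'], corrected by them. *)
Lemma diff_basic_like_inv e V : (forall s, (s < e.+1)%N -> forall v : V s, v = 0) ->
  generated_lt e.+2 V -> basic_like e (diff V) -> basic_like e.+1 V.
Proof.
move=> V0 gV bD; split=> // -[|s] h; first by have := FI_hom_leq h.
have [g [h' [t gh]]] := FI_move_succ h.
have [t' [tt' t't]] := FI_end_inv t.
have Di : forall x : shift V e, to_diff V e x = 0 -> x = 0.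
  move=> x /to_diff_exact[y <-]; rewrite (V0 e _ y) // (lhom0E (to_shift V) e) //.
have [|c0 c0E] := linear_factor (i := llin (to_diff V) e) (f := coef bD h') Di.
  by move=> x; apply: to_diff_surj.
pose c : {linear V s.+1 -> V e.+1} :=
  lact (l := V) t' \o (c0 \o (llin (to_diff V) s \o lact (l := V) g)).
have cE v : c v = lact (l := V) t' (c0 (to_diff V s (lact g v))) by [].
exists c; split=> [w|f w H]; rewrite cE -lactM.
  suff -> : c0 (to_diff V s (lact (comp g h) w)) = lact t w by rewrite -lactM t't lact1.
  apply/eqP; rewrite -subr_eq0; apply/eqP/Di; rewrite (lhomB (to_diff V)).
  rewrite -[to_diff V e (c0 _)]/(llin (to_diff V) e (c0 _)) c0E gh lactM.
  rewrite -[X in to_diff V s X]/(lact (l := shift V) h' (lact (l := V) t w)).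
  by rewrite lfun_nat coefK subrr.
suff -> : c0 (to_diff V s (lact (comp g f) w)) = 0 by rewrite linear0.
apply: Di; rewrite -[to_diff V e (c0 _)]/(llin (to_diff V) e (c0 _)) c0E.
have [/existsP[x /eqP fx]|/existsPn H'] := boolP [exists x, FI_inj (comp g f) x == ord0].
  have [n' [[e'] [f' [u gf]]]] := FI_succ_factor fx; subst n'.
  rewrite gf lactM -[X in to_diff V s X]/(lact (l := shift V) f' (lact (l := V) u w)).
  rewrite lfun_nat coef0 // => v E; have [g' [_ g'g]] := FI_end_inv g.
  apply: (H (comp (comp t' (FI_succ v)) u)).
  apply: (@FI_monic _ _ _ _ g).
  by rewrite gf E FI_succ_comp !cmpA gh -(cmpA _ t t') tt' cmpm1.
have [|f' ->] := @FI_lift_factor _ _ _ (comp g f); first by move=> x; apply: H'.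
rewrite lactM -[X in to_diff V s X]/(to_shift V s (lact f' w)).
by rewrite (exact_comp0 (@to_diff_exact _ _ V)) linear0.
Qed.

(** The obstacle is that the top quotient [Q] might have torsion, so that the difference need not
    preserve the left end of the sequence. Right exactness already yields Tor_1 of [diff Q]; then
    [diff Q], and with it [Q], is some M(W). Now the differences form an exact sequence, and
    induction applies to [A]. *)
Lemma tor1_of_diff d V : generated_lt d V -> injective_hom (to_shift V) ->
  tor1_vanish (diff V) -> tor1_vanish V.
Proof.
elim: d V => [|d IH] V gV Vi tD; first exact/(tor_vanish_zero 0)/generated_lt0.
case: d IH gV => [|e] IH gV; first exact: basic_like_tor1 (generated_lt1_basic_like gV Vi).
have ses := quot_ses (trunc V e.+1); move: ses.
set A := sub_mod _; set Q := quot_mod _; set i := sub_mod_incl _; set p := quot_hom _ => ses.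
have gA : generated_lt e.+1 A by apply: trunc_generated_lt.
have Q0 s (se : (s < e.+1)%N) (v : Q s) : v = 0 by apply: quot_trunc_lt se.
have tDQ : tor1_vanish (diff Q).
  apply: (tor1_vanish_quot (diff_exact (ses_exact ses) (ses_surj ses))) tD _.
    exact: diff_hom_surj (ses_surj ses).
  move=> s x dx; case: (ltnP s e) => [se|es].
    (* Below degree [e] the difference of [Q] is zero, so that of [A] maps onto that of [V] and
       decompositions can be lifted. *)
    have iS m : (m <= s)%N -> forall y, exists z, diff_hom i m z = y.
      move=> ms y; have [{y}y <-] := to_diff_surj y.
      have /(ses_exact ses)[z zE] : p m.+1 y = 0 by apply: Q0; apply: leq_ltn_trans ms se.
      by exists (to_diff A m z); rewrite diff_homE zE.
    elim: dx => [|m f u w ms _ [y dy yE]].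
      by exists 0; [apply: Decomposable0|rewrite lhom0E].
    have [z zE] := iS m (ltnW ms) u; exists (lact f z + y); first exact: DecomposableS.
    by rewrite lhomD lfun_nat zE yE.
  by exists x => //; apply: (diff_generated_lt gA).
have gQ : generated_lt e.+2 Q := generated_lt_surj (ses_surj ses) gV.
have bDQ : basic_like e (diff Q).
  apply: tor1_basic_like => //; last exact: diff_generated_lt.
  move=> s se x; have [{x}x <-] := to_diff_surj x.
  by rewrite (Q0 s.+1 se (x : Q s.+1)) (lhom0E (to_diff Q) s).
have bQ := diff_basic_like_inv Q0 gQ bDQ.
have tA : tor1_vanish A.
  apply: IH => //; first exact: to_shift_inj_sub (ses_inj ses) Vi.
  apply: (tor_vanish_sub (j := 0) (diff_ses3 ses (basic_like_to_shift bQ))) => //.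
  exact: (basic_like_tor 1 bDQ).
exact: (tor_vanish_ext (j := 0) ses tA (basic_like_tor1 bQ)).
Qed.

(** * Commutation of the difference with the shift *)

Section DiffShift.
Definition FI_swap s : hom s.+2 s.+2 := FI_tperm gT ord0 (fintype.lift ord0 ord0).
Lemma FI_swap_injE s x : FI_inj (FI_swap s) x = tperm ord0 (fintype.lift ord0 ord0) x.
Proof. by rewrite /FI_swap FI_E. Qed.
Lemma FI_swap_labE s x : FI_lab (FI_swap s) x = 1%g.
Proof. by rewrite /FI_swap FI_E. Qed.
Definition FI_swapE := (FI_SE, FI_swap_injE, FI_swap_labE).
Lemma FI_swap_lift s : comp (FI_swap s) (FI_succ (lift s)) = lift s.+1.
Proof.
apply: FI_homP => x; case: (unliftP ord0 x) => [i|] ->; rewrite !FI_swapE ?mulg1 //.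
  by rewrite tpermD // -(inj_eq val_inj).
by rewrite tpermL.
Qed.
Lemma FI_swap_lift' s : comp (FI_swap s) (lift s.+1) = FI_succ (lift s).
Proof. by rewrite -FI_swap_lift cmpA FI_tpermK cmp1m. Qed.
Lemma FI_swap_succ s t (f : hom s t) :
  comp (FI_swap t) (FI_succ (FI_succ f)) = comp (FI_succ (FI_succ f)) (FI_swap s).
Proof.
have D n (i : 'I_n) : tperm ord0 (fintype.lift ord0 ord0) (fintype.lift ord0 (fintype.lift ord0 i))
  = fintype.lift ord0 (fintype.lift ord0 i) by rewrite tpermD // -(inj_eq val_inj).
apply: FI_homP => x; case: (unliftP ord0 x) => [i|] ->.
- case: (unliftP ord0 i) => [j|] ->; first by rewrite !(FI_swapE, D).
  by rewrite !(FI_swapE, tpermR).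
- by rewrite !(FI_swapE, tpermL).
- case: (unliftP ord0 i) => [j|] ->; first by rewrite !(FI_swapE, D) mul1g mulg1.
  by rewrite !(FI_swapE, tpermR).
- by rewrite !(FI_swapE, tpermL).
Qed.

(** Both sides are quotients of [V s.+2] by the image of [V s.+1], under an inclusion missing one of
    the two new points; [FI_swap] exchanges these points. *)
Lemma diff_shift V : liso (diff (shift V)) (shift (diff V)).
Proof.
have fn s t (h : hom s t) (v : shift (shift V) s) : lact (l := V) (FI_swap t) (lact h v)
    = lact (l := shift (shift V)) h (lact (l := V) (FI_swap s) v).
  rewrite -[LHS]/(lact (l := V) (FI_swap t) (lact (l := V) (FI_succ (FI_succ h)) v)).
  by rewrite -lactM FI_swap_succ lactM.
pose f : lhom (shift (shift V)) (shift (shift V)) :=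
  @LHom k (FI gT) (shift (shift V)) (shift (shift V)) (fun s => lact (l := V) (FI_swap s))
    (fun s => linearP (lact (l := V) (FI_swap s))) fn.
pose g := lhom_comp (shift_hom (to_diff V)) f.
have gE s v : g s v = to_diff V s.+1 (lact (FI_swap s) v) by [].
have gk s v : g s v = 0 <-> v \in im_mod (to_shift (shift V)) s.
  rewrite gE im_modP; split=> [/to_diff_exact[u uE]|[u <-]].
    have vE : v = lact (l := V) (FI_swap s) (lact (l := V) (FI_swap s) v).
      by rewrite -lactM FI_tpermK lact1.
    exists u; rewrite vE -uE -[RHS]/(lact (l := V) _ (lact (l := V) (lift s.+1) u)).
    by rewrite -lactM FI_swap_lift'.
  apply/to_diff_exact; exists u.
  by rewrite -[RHS]/(lact _ (lact (FI_succ (lift s)) u)) -lactM FI_swap_lift.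
have gS s v : v \in im_mod (to_shift (shift V)) s -> g s v = 0 by move=> /gk.
apply: (@liso_of _ _ _ _ (quot_factor gS)) => s x.
  by have [{x}x <-] := quot_hom_surj x; rewrite quot_factorE => /gk /quot_homP.
have [v vE] := to_diff_surj (x : diff V s.+1).
exists (to_diff (shift V) s (lact (l := V) (FI_swap s) v)).
rewrite quot_factorE gE -lactM FI_tpermK lact1; exact: vE.
Qed.

Lemma shift_liso V W : liso V W -> liso (shift V) (shift W).
Proof. by move=> [f fb]; exists (shift_hom f) => s; apply: fb. Qed.

Lemma diff_iter_shift N V : liso (diff (iter N (@shift k gT) V)) (iter N (@shift k gT) (diff V)).
Proof.
elim: N => [|N IH]; first by exists (lhom_id _) => s; exists id.
exact: liso_trans (diff_shift _) (shift_liso IH).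
Qed.
End DiffShift.
End Difference.

(** * Noetherianity *)

Section NoetherianModules.
Variable k : comPzRingType.
Implicit Types M N : lmodType k.

Lemma submodB M (S : submodClosed M) x y : x \in S -> y \in S -> x - y \in S.
Proof. by move=> xS yS; rewrite -scaleN1r rpredD ?rpredZ. Qed.

Definition lfg M (S : submodClosed M) := exists s : seq M,
  (forall x, x \in s -> x \in S) /\
  forall T : submodClosed M, (forall x, x \in s -> x \in T) -> forall x, x \in S -> x \in T.
Definition lnoetherian M := forall S : submodClosed M, lfg S.

Lemma lnoetherian_surj M N (f : {linear M -> N}) : (forall y, exists x, f x = y) ->
  lnoetherian M -> lnoetherian N.
Proof.
move=> fs nM S; have [s [sS sg]] := nM (preim_submod f S).
exists [seq f x | x <- s]; split=> [y /mapP[x xs ->]|T sT y yS].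
  exact/preimE/sS.
have [x xE] := fs y; rewrite -xE; apply/preimE.
apply: sg => [z zs|]; first by apply/preimE/sT/map_f.
by apply/preimE; rewrite xE.
Qed.

Lemma noetherian_lnoetherian : noetherian k -> lnoetherian (k^o : lmodType k).
Proof.
move=> nk S; have [s sE] := nk S; exists s; split=> [x xs|T sT x].
  by rewrite sE; apply/spanE => T; apply.
by rewrite sE => /spanE; apply.
Qed.

Section Submod2.
Variables (M : lmodType k) (S T : submodClosed M).
Fact submodI_closed a x y : x \in S /\ x \in T -> y \in S /\ y \in T ->
  a *: x + y \in S /\ a *: x + y \in T.
Proof. by move=> [xS xT] [yS yT]; split; rewrite rpredD ?rpredZ. Qed.
Definition submodI : submodClosed M :=
  mk_submod (P := fun x => x \in S /\ x \in T) (conj (rpred0 S) (rpred0 T)) submodI_closed.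
Lemma submodIE x : x \in submodI <-> x \in S /\ x \in T.
Proof. exact: mk_submodE. Qed.
End Submod2.

Lemma span_cons M (x : M) l y : y \in span (fun z => z \in x :: l) ->
  exists (a : k) y', y' \in span (fun z => z \in l) /\ y = a *: x + y'.
Proof.
pose P y := exists (a : k) y', y' \in span (fun z => z \in l) /\ y = a *: x + y'.
have P0 : P 0 by exists 0, 0; rewrite rpred0 scale0r addr0.
have PL a u v : P u -> P v -> P (a *: u + v).
  move=> [b [u' [u'l ->]]] [c [v' [v'l ->]]]; exists (a * b + c), (a *: u' + v').
  by rewrite rpredD ?rpredZ // scalerDr scalerDl scalerA addrACA.
move=> /spanE/(_ (mk_submod P0 PL)) H; apply/(mk_submodE P0 PL)/H => z; rewrite inE => /orP[/eqP ->|zl].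
  by apply/(mk_submodE P0 PL); exists 1, 0; rewrite rpred0 scale1r addr0.
apply/(mk_submodE P0 PL); exists 0, z; rewrite scale0r add0r; split=> //.
by apply/spanE => S; apply.
Qed.

(** Induction on the generators: the coefficients at [x] of elements of [S] form an ideal. Lifts of
    its generators, together with generators of the part of [S] inside the span of [l], generate
    [S]. *)
Lemma fg_lnoetherian M (l : seq M) : noetherian k ->
  (forall x, x \in span (fun z => z \in l)) -> lnoetherian M.
Proof.
move=> /noetherian_lnoetherian nk lM S.
have : forall x, x \in S -> x \in span (fun z => z \in l) by [].
elim: l {lM} S => [|x l IH] S Sl.
  exists [::]; split=> // T _ y /Sl /spanE; exact.
pose P (a : k^o) := exists y, y \in span (fun z => z \in l) /\ (a : k) *: x + y \in S.
have P0 : P 0 by exists 0; rewrite scale0r addr0 !rpred0.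
have PL (a : k) u v : P u -> P v -> P (a *: u + v).
  move=> [y [yl yS]] [z [zl zS]]; exists (a *: y + z); rewrite rpredD ?rpredZ //; split=> //.
  rewrite -[(a *: u + v : k)]/(a * u + v) scalerDl -scalerA addrACA -scalerDr.
  by rewrite rpredD ?rpredZ.
have [s [sI sg]] := nk (mk_submod P0 PL).
have [z zE] : exists z : k -> M, forall a, P a -> exists y,
    [/\ y \in span (fun z => z \in l), z a = a *: x + y & z a \in S].
  have H a : exists z, P a -> exists y,
      [/\ y \in span (fun z => z \in l), z = a *: x + y & z \in S].
    have [[y [yl yS]]|nP] := pselect (P a); last by exists 0.
    by exists (a *: x + y) => _; exists y.
  by exists (fun a => sval (cid (H a))) => a; case: cid.
have [|t [tS tg]] := IH (submodI S (span (fun z => z \in l))).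
  by move=> y /submodIE[].
exists ([seq z a | a <- s] ++ t); split=> [y|T sT].
  rewrite mem_cat => /orP[/mapP[a /sI/mk_submodE/zE[y' [_ _ ?]] -> //]|/tS/submodIE[]//].
have zT a : a \in s -> z a \in T by move=> sa; apply: sT; rewrite mem_cat map_f.
have tT y : y \in t -> y \in T by move=> yt; apply: sT; rewrite mem_cat yt orbT.
(* The coefficients realized by elements lying in both [S] and [T]; this ideal contains all the
   generators chosen for [P]. *)
pose Q (a : k^o) := exists y, [/\ y \in span (fun z => z \in l), (a : k) *: x + y \in S & (a : k) *: x + y \in T].
have Q0 : Q 0 by exists 0; rewrite scale0r addr0 !rpred0.
have QL (a : k) u v : Q u -> Q v -> Q (a *: u + v).
  move=> [y [yl yS yT]] [y' [y'l y'S y'T]]; exists (a *: y + y').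
  rewrite -[(a *: u + v : k)]/(a * u + v) scalerDl -scalerA addrACA -scalerDr.
  by split; rewrite rpredD ?rpredZ.
move=> v vS; have [a [y [yl vE]]] := span_cons (Sl v vS).
have Pa : P a by exists y; rewrite -vE.
have [y' [y'l y'S y'T]] : Q a.
  apply/(mk_submodE Q0 QL)/sg; last by apply/mk_submodE.
  move=> b bs; apply/mk_submodE; have [|y' [y'l bE bS]] := zE b; first by apply/(mk_submodE P0 PL)/sI.
  by exists y'; rewrite -bE bS zT.
have : v - (a *: x + y') \in T.
  apply: (tg T tT); apply/submodIE; split; first exact: submodB.
  by rewrite vE opprD addrACA subrr add0r submodB.
by move=> H; rewrite -[v](subrK (a *: x + y')) rpredD.
Qed.
End NoetherianModules.

Section Noetherian.
Variables (k : comPzRingType) (gT : finGroupType).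
Notation module := (left_module k (FI gT)).
Notation hom n m := (@hom (FI gT) n m).
Notation comp f g := (@cmp (FI gT) _ _ _ f g).
Notation lift n := (@FI_lift gT n).
Implicit Types V W : module.
Notation elt V := {n : nat & V n}.

Definition fg_sub V (X : submodule V) := exists s : seq (elt V),
  (forall p, p \in s -> projT2 p \in X (projT1 p)) /\
  forall S : submodule V, (forall p, p \in s -> projT2 p \in S (projT1 p)) ->
    forall n v, v \in X n -> v \in S n.
Definition noetherian_mod V := forall X : submodule V, fg_sub X.

Section MkSubmodule.
Variables (V : module) (P : forall n, V n -> Prop).
Hypotheses (P0 : forall n, P (0 : V n)) (PL : forall n a (x y : V n), P x -> P y -> P (a *: x + y))
  (PA : forall n m (f : hom n m) (v : V n), P v -> P (lact f v : V m)).
Fact mk_act n m (f : hom n m) (v : V n) :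
  v \in mk_submod (P0 n) (@PL n) -> lact f v \in mk_submod (P0 m) (@PL m).
Proof. by move=> /mk_submodE Pv; apply/mk_submodE/PA. Qed.
Definition mk_submodule : submodule V := Submodule mk_act.
Lemma mk_submoduleE n v : v \in mk_submodule n <-> P v.
Proof. exact: mk_submodE. Qed.
End MkSubmodule.

Section Meet.
Variables (V : module) (S T : submodule V).
Fact meet_ex : exists I : submodule V, forall n v, v \in I n <-> v \in S n /\ v \in T n.
Proof.
pose P n v := v \in S n /\ v \in T n.
have P0 n : P n 0 by split; apply: rpred0.
have PL n a x y : P n x -> P n y -> P n (a *: x + y).
  by move=> [xS xT] [yS yT]; split; rewrite rpredD ?rpredZ.
have PA n m (f : hom n m) v : P n v -> P m (lact f v) by move=> [vS vT]; split; apply: sec_act.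
by exists (mk_submodule P0 PL PA) => n v; apply: mk_submoduleE.
Qed.
Definition meet_mod := sval (cid meet_ex).
Lemma meetE n v : v \in meet_mod n <-> v \in S n /\ v \in T n.
Proof. by rewrite /meet_mod; case: cid => I /= H; apply: H. Qed.
End Meet.

Lemma fg_sub_inj V W (f : lhom V W) (X : submodule V) :
  (forall n v, v \in X n -> f n v = 0 -> v = 0) -> noetherian_mod W -> fg_sub X.
Proof.
move=> fi nW; have [s [sX sg]] := nW (im_mod (lhom_comp f (sub_mod_incl X))).
have [r rE] : exists r : elt W -> elt V, forall p, p \in s ->
    projT2 (r p) \in X (projT1 (r p)) /\ existT _ (projT1 (r p)) (f _ (projT2 (r p))) = p.
  have H (p : elt W) : exists q : elt V, p \in s ->
    projT2 q \in X (projT1 q) /\ existT (fun n => W n) (projT1 q) (f _ (projT2 q)) = p.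
    have [ps|ps] := boolP (p \in s); last by exists (existT _ 0%N (0 : V 0%N)).
    move: (sX p ps); case: p {ps} => n w /im_modP[v vE].
    exists (existT _ n (sub_val v)) => _; split; first exact: sub_valP.
    by congr existT; apply: vE.
  by exists (fun p => sval (cid (H p))) => p; case: cid.
exists [seq r p | p <- s]; split=> [q /mapP[p ps ->]|S sS n v vX]; first by case: (rE p ps).
(* The image of the intersection with [X], rather than that of [S], is used because [f] is injective
   only on [X]. *)
have : f n v \in im_mod (lhom_comp f (sub_mod_incl (meet_mod S X))) n.
  apply: sg => [p ps|]; last by apply/im_modP; exists (SubMk vX).
  have [rX <-] := rE p ps; apply/im_modP => /=.
  have rSX : projT2 (r p) \in meet_mod S X (projT1 (r p)).
    by apply/meetE; split=> //; apply/sS/map_f.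
  by exists (SubMk rSX).
move=> /im_modP[[u uSX] /= uE]; have /meetE[uS uX] := uSX.
suff <- : u = v by [].
by apply/eqP; rewrite -subr_eq0; apply/eqP/fi; rewrite ?submodB // lhomB uE subrr.
Qed.

(** * The shift of M(W) projected back to M(W) *)

Section BasicLikeNoetherian.
Variables (d : nat) (V : module) (bV : basic_like d V).
Hypotheses (nD : noetherian_mod (diff V)) (nd : lnoetherian (V d)) (n0 : lnoetherian (V 0%N)).

(* A complement of [V] in [shift V], spanned by the maps hitting the new point. *)
Definition hitting n (y : shift V n) := forall h : hom d n, coef bV (comp (lift n) h) y = 0.
Fact hitting0 n : hitting (0 : shift V n).
Proof. by move=> h; rewrite linear0. Qed.
Fact hittingL n a (x y : shift V n) : hitting x -> hitting y -> hitting (a *: x + y).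
Proof. by move=> Hx Hy h; rewrite linearP Hx Hy scaler0 addr0. Qed.
Fact hittingA n m (f : hom n m) (y : shift V n) : hitting y -> hitting (lact f y).
Proof.
move=> Hy h.
have [[h' E]|/forallNP H] := pselect (exists h', comp (lift m) h = comp (FI_succ f) h'); last first.
  exact: coef_unfactor.
have [|h2 h2E] := @FI_lift_factor _ _ _ h'.
  move=> x; apply/eqP => h'x; have := congr1 (fun p => FI_inj p x) E.
  by rewrite !FI_SE h'x FI_succ0.
by rewrite E coef_comp h2E.
Qed.
Definition hit : submodule (shift V) := mk_submodule hitting0 hittingL hittingA.

Lemma hitB n a (x y : V n.+1) (u v : V n) : x - to_shift V n u \in hit n -> y - to_shift V n v \in hit n ->
  a *: x + y - to_shift V n (a *: u + v) \in hit n.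
Proof.
by move=> xu yv; rewrite lhomL opprD addrACA -scalerBr rpredD ?rpredZ.
Qed.

Lemma hit_to_shift n (x : V n) : to_shift V n x \in hit n -> x = 0.
Proof.
by move=> /mk_submoduleE H; apply: (coef_eq0 (bV := bV)) => h; rewrite -(coef_comp bV (lift n)) H.
Qed.

Lemma hit_split n (y : shift V n) : exists x, y - to_shift V n x \in hit n.
Proof.
move: y; apply: (generated_ind (basic_like_lt bV) (basic_like_gen bV)) => [|x y [u Hu] [v Hv]|f w].
- by exists 0; rewrite lhom0E subr0 rpred0.
- by exists (u + v); rewrite lhomD opprD addrACA rpredD.
have [[f' ->]|/forallNP H] := pselect (exists f', f = comp (lift n) f').
  by exists (lact f' w); rewrite lactM subrr rpred0.
exists 0; rewrite lhom0E subr0; apply/mk_submoduleE => h; apply: coef0 => t.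
by rewrite -cmpA; apply: H.
Qed.

Section Step.
Variable X : submodule V.
Definition retr n (v : V n) := exists x : V n.+1, x \in X n.+1 /\ x - to_shift V n v \in hit n.
Fact retr0 n : retr (0 : V n).
Proof. by exists 0; rewrite lhom0E subr0 !rpred0. Qed.
Fact retrL n a (u v : V n) : retr u -> retr v -> retr (a *: u + v).
Proof.
move=> [x [xX xu]] [y [yX yv]]; exists (a *: x + y); split; last exact: hitB.
by rewrite rpredD ?rpredZ.
Qed.
Fact retrA n m (f : hom n m) (v : V n) : retr v -> retr (lact f v).
Proof.
move=> [x [xX xv]]; exists (lact (FI_succ f) x); split; first exact: sec_act.
rewrite lfun_nat -[lact (FI_succ f) x]/(lact (l := shift V) f x) -linearB.
exact: (@sec_act _ _ _ hit _ _ f _ xv).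
Qed.
(* The image of [X] shifted under the projection of [shift V] to [V] along [hit]. *)
Definition retract : submodule V := mk_submodule retr0 retrL retrA.

Lemma retract_incl n v : v \in X n -> v \in retract n.
Proof.
move=> vX; apply/mk_submoduleE; exists (lact (lift n) v); split; first exact: sec_act.
by rewrite subrr rpred0.
Qed.

Definition shift_sub : submodule (shift V) :=
  @Submodule k (FI gT) (shift V) (fun n => X n.+1) (fun n m f v => @sec_act _ _ _ X _ _ (FI_succ f) v).
End Step.

(** The shift of [X] is controlled by its projection [retract X] and by its part inside [hit], which
    embeds in [diff V]. Degree 0 is lost under the shift, so generators of [X 0] are added
    separately. *)
Lemma fg_retract X : fg_sub (retract X) -> fg_sub X.
Proof.
move=> [s [sX sg]].
have [r rE] : exists r : elt V -> elt V, forall p, p \in s ->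
    projT2 (r p) \in X (projT1 (r p)) /\ exists v : V (projT1 p).+1,
    r p = existT _ (projT1 p).+1 v /\ v - to_shift V _ (projT2 p) \in hit (projT1 p).
  have H (p : elt V) : exists q : elt V, p \in s ->
    projT2 q \in X (projT1 q) /\ exists v : V (projT1 p).+1,
    q = existT (fun n => V n) (projT1 p).+1 v /\ v - to_shift V _ (projT2 p) \in hit (projT1 p).
    have [ps|ps] := boolP (p \in s); last by exists (existT _ 0%N (0 : V 0%N)).
    have /mk_submoduleE[x [xX xE]] := sX p ps.
    by exists (existT _ (projT1 p).+1 x) => _; split=> //; exists x.
  by exists (fun p => sval (cid (H p))) => p; case: cid.
have [|t [tX tg]] := @fg_sub_inj _ _ (to_diff V) (meet_mod (shift_sub X) hit) _ nD.
  move=> n v /meetE[_ vN] /to_diff_exact[x xE]; rewrite -xE (hit_to_shift (x := x)) ?lhom0E //.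
  by rewrite xE.
have [q [qX qg]] := n0 (X 0%N).
exists ([seq r p | p <- s] ++ [seq existT (fun n => V n) (projT1 p).+1 (projT2 p) | p <- t]
  ++ [seq existT (fun n => V n) 0%N x | x <- q]); split.
  move=> p; rewrite !mem_cat => /or3P[] /mapP[y ys ->].
  - by case: (rE y ys).
  - by have /meetE[] := tX y ys.
  - exact: qX.
move=> S HS.
have rS p : p \in s -> projT2 (r p) \in S (projT1 (r p)).
  by move=> ps; apply: HS; rewrite mem_cat map_f.
have tS p : p \in t -> projT2 p \in S (projT1 p).+1.
  move=> pt; apply: (HS (existT (fun n => V n) (projT1 p).+1 (projT2 p))).
  by rewrite !mem_cat (map_f (fun p => existT (fun n => V n) (projT1 p).+1 (projT2 p)) pt) orbT.
have qS x : x \in q -> x \in S 0%N.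
  move=> xq; apply: (HS (existT (fun n => V n) 0%N x)).
  by rewrite !mem_cat (map_f (fun x => existT (fun n => V n) 0%N x) xq) !orbT.
case=> [|n] v vX; first exact: qg qS _ vX.
have [x xv] := hit_split (v : shift V n).
have : x \in retract (meet_mod S X) n.
  apply: sg => [p ps|]; last by apply/mk_submoduleE; exists v.
  have [rX [w [wE wp]]] := rE p ps; apply/mk_submoduleE; exists w; split=> //.
  by have := rS p ps; rewrite wE in rX * => /= wS; apply/meetE.
move=> /mk_submoduleE[w [/meetE[wS wX] wx]].
have -> : v = w + (v - w) by rewrite addrC subrK.
rewrite rpredD //; apply: (tg (shift_sub S) tS); apply/meetE; split; first exact: submodB.
suff -> : v - w = (v - to_shift V n x) - (w - to_shift V n x) by apply: submodB.
by rewrite opprB addrA subrK.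
Qed.

Lemma fg_iter_retract a X : fg_sub (iter a retract X) -> fg_sub X.
Proof. by elim: a => // a IH /fg_retract. Qed.

Lemma iter_retract_mono X a b n v : (a <= b)%N -> v \in iter a retract X n -> v \in iter b retract X n.
Proof.
move=> /subnK <-; elim: (b - a)%N => // c IH vX.
by rewrite addSn iterS; apply/retract_incl/IH.
Qed.

(** The iterated retracts increase, and in degree [d] they become constant from some [a] on. All
    coefficients of elements of any of them lie in this stable part, so the [a]-th retract is
    generated in degree [d], and [fg_retract] leads back to [X]. *)
Lemma basic_like_noetherian_step : noetherian_mod V.
Proof.
move=> X; pose P v := exists a, v \in iter a retract X d.
have P0 : P 0 by exists 0%N; rewrite rpred0.
have PL a u v : P u -> P v -> P (a *: u + v).
  move=> [b ub] [c vc]; exists (maxn b c).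
  by rewrite rpredD ?rpredZ //; [apply: (iter_retract_mono (leq_maxl b c))|apply: (iter_retract_mono (leq_maxr b c))].
have [s [sP sg]] := nd (mk_submod P0 PL).
have [a aE] : exists a, forall x, x \in s -> x \in iter a retract X d.
  have {sg} : forall x, x \in s -> P x by move=> x /sP/mk_submodE.
  elim: {sP} s => [|y s IH] sP; first by exists 0%N.
  have [|a aE] := IH; first by move=> x xs; apply: sP; rewrite inE xs orbT.
  have [b bE] := sP y (mem_head _ _); exists (maxn a b) => x; rewrite inE => /orP[/eqP ->|xs].
    exact: (iter_retract_mono (leq_maxr a b)) bE.
  exact: (iter_retract_mono (leq_maxl a b)) (aE x xs).
(* Each degree by which [n] drops costs one more retraction, so [b] varies in the induction. *)
have cP n : forall b (x : V n) h, x \in iter b retract X n -> P (coef bV h x).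
  elim: n => [|n IH] b x h xX.
    have d0 : d = 0%N by apply/eqP; rewrite -leqn0; apply: FI_hom_leq h.
    have [g [hg gh]] : exists g : hom 0 d, comp h g = idm _ /\ comp g h = idm _.
      by case: d / (esym d0) h => h; apply: FI_end_inv.
    by exists b; rewrite -[x]lact1 -hg lactM coefK; apply: sec_act.
  have := FI_hom_leq h; rewrite leq_eqVlt => /orP[/eqP dn|dn].
    have [g [hg gh]] : exists g : hom n.+1 d, comp h g = idm _ /\ comp g h = idm _.
      by case: _ / dn h => h; apply: FI_end_inv.
    by exists b; rewrite -[x]lact1 -hg lactM coefK; apply: sec_act.
  have [g [h' gh]] := FI_move_lift h dn.
  rewrite -(coef_comp bV g) gh.
  have [v gv] := hit_split (lact g x : shift V n).
  have vX : v \in iter b.+1 retract X n.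
    by apply/mk_submoduleE; exists (lact g x); split=> //; apply: sec_act.
  move/mk_submoduleE/(_ h')/eqP: gv; rewrite linearB subr_eq0 => /eqP ->.
  by rewrite -[to_shift V n v]/(lact (lift n) v) coef_comp; apply: (IH b.+1).
apply: (@fg_iter_retract a); exists [seq existT (fun n => V n) d x | x <- s]; split.
  by move=> p /mapP[x xs ->]; apply: aE.
move=> S sS n v vX; apply: (@coef_in _ _ _ _ bV S) => h.
apply: (sg (S d)) => [x xs|]; last by apply/mk_submodE/(cP _ a).
exact: (sS (existT (fun n => V n) d x) (map_f _ xs)).
Qed.
End BasicLikeNoetherian.

Lemma zero_noetherian V : (forall n (v : V n), v = 0) -> noetherian_mod V.
Proof. by move=> V0 X; exists [::]; split=> // S _ n v _; rewrite (V0 n v) rpred0. Qed.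

Lemma basic_like_noetherian d V : basic_like d V -> lnoetherian (V d) -> noetherian_mod V.
Proof.
elim: d V => [|d IH] V bV nd.
  by apply: (basic_like_noetherian_step bV) => //; apply/zero_noetherian/basic_like0_diff.
apply: (basic_like_noetherian_step bV) => //.
  apply: IH (basic_like_diff bV) _.
  exact: (lnoetherian_surj (f := llin (to_diff V) d) (@to_diff_surj _ _ V d)).
move=> S; exists [::]; split=> // T _ x _.
by rewrite (basic_like_lt bV (ltn0Sn d) x) rpred0.
Qed.
End Noetherian.

(** * Finitely generated modules *)

Section FinitelyGenerated.
Variables (k : comPzRingType) (gT : finGroupType).
Notation module := (left_module k (FI gT)).
Notation hom n m := (@hom (FI gT) n m).
Notation lift n := (@FI_lift gT n).
Implicit Types V W : module.
Notation elt V := {n : nat & V n}.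

Lemma elt_bound V (l : seq (elt V)) : exists N, forall p, p \in l -> (projT1 p < N)%N.
Proof.
elim: l => [|q l [N lN]]; first by exists 0%N.
exists (maxn N (projT1 q).+1) => p; rewrite inE => /orP[/eqP ->|/lN pN].
  by rewrite leq_max leqnn orbT.
by rewrite leq_max pN.
Qed.

Lemma fg_generated_lt V : finitely_generated V -> exists d, generated_lt d V.
Proof.
move=> [l lV]; have [d ld] := elt_bound l; exists d => n v dn.
pose P n (v : V n) := (d <= n)%N -> decomposable v.
have P0 m : P m 0 by move=> _; apply: Decomposable0.
have PL m a x y : P m x -> P m y -> P m (a *: x + y).
  by move=> Px Py dm; apply: decomposableD; [apply/decomposableZ/Px|apply: Py].
have PA m m' (f : hom m m') x : P m x -> P m' (lact f x).
  move=> Px dm'; have := FI_hom_leq f; rewrite leq_eqVlt => /orP[/eqP mm'|mm'].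
    by apply: decomposable_lact; apply: Px; rewrite mm'.
  exact: decomposable_act.
have /mk_submoduleE : v \in mk_submodule P0 PL PA n; last exact.
by apply: lV => p /ld pd; apply/mk_submoduleE => dp; move: (leq_trans pd dp); rewrite ltnn.
Qed.

Lemma fg_surj V W (f : lhom V W) : surjective_hom f -> finitely_generated V ->
  finitely_generated W.
Proof.
move=> fs [l lV]; exists [seq existT (fun n => W n) (projT1 p) (f _ (projT2 p)) | p <- l].
move=> S lS n w; have [v <-] := fs n w; apply/(preimE (llin f n)).
apply: (lV (preim_mod f S)) => p pl; apply/preimE.
exact: (lS (existT (fun n => W n) (projT1 p) (f _ (projT2 p))) (map_f _ pl)).
Qed.

Lemma fg_sub_mod V (X : submodule V) : fg_sub X -> finitely_generated (sub_mod X).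
Proof.
move=> [l [lX lg]].
have [r rE] : exists r : elt V -> elt (sub_mod X), forall p, p \in l ->
    existT _ (projT1 (r p)) (sub_val (projT2 (r p))) = p.
  have H (p : elt V) : exists q : elt (sub_mod X), p \in l ->
      existT (fun n => V n) (projT1 q) (sub_val (projT2 q)) = p.
    have [ps|ps] := boolP (p \in l); last by exists (existT _ 0%N (0 : sub_mod X 0%N)).
    by move: (lX p ps); case: p {ps} => n w wX; exists (existT _ n (SubMk wX)).
  by exists (fun p => sval (cid (H p))) => p; case: cid.
exists [seq r p | p <- l] => S lS n v.
have : sub_val v \in im_mod (lhom_comp (sub_mod_incl X) (sub_mod_incl S)) n.
  apply: lg => [p pl|]; last exact: sub_valP.
  move: (lS (r p) (map_f _ pl)) (rE p pl); case: (r p) => m u uS <-.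
  by apply/(@im_modP _ _ _ _ (lhom_comp (sub_mod_incl X) (sub_mod_incl S))); exists (SubMk uS).
by move=> /im_modP[[u uS] /= /val_inj <-].
Qed.

Section GeneratedSub.
Variables (V : module) (l : seq (elt V)).
Definition in_gen n (v : V n) := forall S : submodule V,
  (forall p, p \in l -> projT2 p \in S (projT1 p)) -> v \in S n.
Fact in_gen0 n : in_gen (0 : V n). Proof. by move=> S _; apply: rpred0. Qed.
Fact in_genL n a (x y : V n) : in_gen x -> in_gen y -> in_gen (a *: x + y).
Proof. by move=> Gx Gy S lS; rewrite rpredD ?rpredZ ?Gx ?Gy. Qed.
Fact in_genA n m (f : hom n m) (v : V n) : in_gen v -> in_gen (lact f v).
Proof. by move=> Gv S lS; apply/sec_act/Gv. Qed.
Definition gen_sub : submodule V := mk_submodule in_gen0 in_genL in_genA.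
Lemma gen_subE n v : v \in gen_sub n <-> in_gen v.
Proof. exact: mk_submoduleE. Qed.
End GeneratedSub.

Section One.
Variables (V : module) (q : elt V).
Notation M := (free_mod k gT (fun _ : unit => projT1 q)).
Definition one_hom : lhom M V := free_mod_hom (deg := fun _ : unit => projT1 q) (fun _ => projT2 q).

Lemma gen_sub_cons l n (v : V n) : v \in gen_sub (q :: l) n ->
  exists m y, y \in gen_sub l n /\ v = one_hom n m + y.
Proof.
pose P n v := exists m y, y \in gen_sub l n /\ v = one_hom n m + y.
have P0 m : P m 0 by exists 0, 0; rewrite rpred0 lhom0E addr0.
have PL m a x y : P m x -> P m y -> P m (a *: x + y).
  move=> [u [x' [x'l ->]]] [w [y' [y'l ->]]]; exists (a *: u + w), (a *: x' + y').
  by rewrite rpredD ?rpredZ // lhomL scalerDr addrACA.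
have PA m m' (f : hom m m') x : P m x -> P m' (lact f x).
  move=> [u [x' [x'l ->]]]; exists (lact f u), (lact f x').
  by rewrite linearD lfun_nat; split=> //; apply: sec_act.
move=> /gen_subE/(_ (mk_submodule P0 PL PA)) H; apply/(mk_submoduleE P0 PL PA)/H => p.
rewrite inE => /orP[/eqP ->|pl]; apply/mk_submoduleE.
  exists (free_gen k gT (fun _ : unit => projT1 q) tt), 0; rewrite rpred0; split=> //.
  by rewrite addr0 /free_gen free_mod_homE lact1.
exists 0, (projT2 p); rewrite lhom0E add0r; split=> //.
by apply/gen_subE => S; apply.
Qed.

Lemma one_noetherian : noetherian k -> noetherian_mod M.
Proof.
move=> nk; apply: (basic_like_noetherian (free_mod_basic_like k gT (projT1 q) unit)).
apply: (fg_lnoetherian (l := [seq free_elt k (deg := fun _ : unit => projT1 q) (a := tt)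
  (f : hom (projT1 q) (projT1 q)) | f <- enum {: FI_hom gT (projT1 q) (projT1 q)}]) nk).
apply: free_mod_ind => [|x y|c [] h]; [exact: rpred0|exact: rpredD|].
apply/rpredZ/spanE => S; apply; apply: map_f; exact: mem_enum.
Qed.
End One.

(** The induction of [fg_lnoetherian] again, with the ideal of coefficients replaced by a submodule
    of the free module on one generator. *)
Lemma fg_noetherian V : noetherian k -> finitely_generated V -> noetherian_mod V.
Proof.
move=> nk [l lV] X.
have : forall n v, v \in X n -> v \in gen_sub l n.
  by move=> n v _; apply/gen_subE => S lS; apply: lV.
elim: l {lV} X => [|q l IH] X Xl.
  by exists [::]; split=> // S _ n v /Xl/gen_subE; apply.
pose P n (m : free_mod k gT (fun _ : unit => projT1 q) n) :=
  exists y, y \in gen_sub l n /\ one_hom q n m + y \in X n.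
have P0 n : @P n 0 by exists 0; rewrite lhom0E addr0 !rpred0.
have PL n a x y : @P n x -> P n y -> P n (a *: x + y).
  move=> [u [ul uX]] [w [wl wX]]; exists (a *: u + w).
  by rewrite rpredD ?rpredZ // lhomL addrACA -scalerDr rpredD ?rpredZ.
have PA n m (f : hom n m) x : @P n x -> P m (lact f x).
  move=> [u [ul uX]]; exists (lact f u); rewrite lfun_nat -linearD.
  by split; apply: sec_act.
have [s [sX sg]] := one_noetherian nk (mk_submodule P0 PL PA).
have [r rE] : exists r : elt (free_mod k gT (fun _ : unit => projT1 q)) -> elt V,
    forall p, p \in s -> exists y, [/\ y \in gen_sub l (projT1 p),
      r p = existT _ (projT1 p) (one_hom q _ (projT2 p) + y) &
      one_hom q _ (projT2 p) + y \in X (projT1 p)].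
  have H (p : elt (free_mod k gT (fun _ : unit => projT1 q))) : exists z : elt V,
    p \in s -> exists y, [/\ y \in gen_sub l (projT1 p),
      z = existT (fun n => V n) (projT1 p) (one_hom q _ (projT2 p) + y) &
      one_hom q _ (projT2 p) + y \in X (projT1 p)].
    have [ps|ps] := boolP (p \in s); last by exists q.
    have /mk_submoduleE[y [yl yX]] := sX p ps.
    by exists (existT _ (projT1 p) (one_hom q _ (projT2 p) + y)) => _; exists y.
  by exists (fun p => sval (cid (H p))) => p; case: cid.
have [|t [tX tg]] := IH (meet_mod X (gen_sub l)); first by move=> n v /meetE[].
exists ([seq r p | p <- s] ++ t); split=> [p|S HS].
  rewrite mem_cat => /orP[/mapP[z zs ->]|/tX/meetE[] //].
  by have [y [_ -> ?]] := rE z zs.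
have tS p : p \in t -> projT2 p \in S (projT1 p) by move=> pt; apply: HS; rewrite mem_cat pt orbT.
pose Q n (m : free_mod k gT (fun _ : unit => projT1 q) n) :=
  exists y, [/\ y \in gen_sub l n, one_hom q n m + y \in X n & one_hom q n m + y \in S n].
have Q0 n : @Q n 0 by exists 0; rewrite lhom0E addr0 !rpred0.
have QL n a x y : @Q n x -> Q n y -> Q n (a *: x + y).
  move=> [u [ul uX uS]] [w [wl wX wS]]; exists (a *: u + w).
  by rewrite lhomL addrACA -scalerDr; split; rewrite rpredD ?rpredZ.
have QA n m (f : hom n m) x : @Q n x -> Q m (lact f x).
  move=> [u [ul uX uS]]; exists (lact f u); rewrite lfun_nat -linearD.
  by split; apply: sec_act.
move=> n v vX; have [m [y [yl vE]]] := gen_sub_cons (Xl n v vX).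
have [y' [y'l y'X y'S]] : Q n m.
  apply/(mk_submoduleE Q0 QL QA)/sg; last first.
    by apply/mk_submoduleE; exists y; rewrite -vE.
  move=> p ps; apply/mk_submoduleE; have [z [zl zE zX]] := rE p ps.
  exists z; split=> //; have : r p \in [seq r p | p <- s] ++ t by rewrite mem_cat map_f.
  by move/HS; rewrite zE.
rewrite -[v](subrK (one_hom q n m + y')) rpredD //.
apply: (tg S tS); apply/meetE; split; first exact: submodB.
by rewrite vE opprD addrACA subrr add0r submodB.
Qed.

Lemma fg_cover V : finitely_generated V -> exists (r : nat) (deg : 'I_r -> nat)
  (f : lhom (free_mod k gT deg) V), surjective_hom f.
Proof.
move=> [l lV]; pose t i := tnth (in_tuple l) i.
pose f := free_mod_hom (deg := fun i => projT1 (t i)) (fun i => projT2 (t i)).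
exists (size l), (fun i => projT1 (t i)), f => n v; apply/im_modP; apply: lV => p.
move=> /(tnthP (in_tuple l))[i ->]; apply/im_modP.
by exists (free_gen k gT (fun i => projT1 (t i)) i); rewrite free_mod_homE lact1.
Qed.

Lemma fg_free_mod r (deg : 'I_r -> nat) : finitely_generated (free_mod k gT deg).
Proof.
exists [seq existT (fun n => free_mod k gT deg n) (deg i) (free_gen k gT deg i) | i <- enum 'I_r].
move=> S HS n; apply: free_mod_ind => [|x y|c a h]; [exact: rpred0|exact: rpredD|].
rewrite rpredZ // free_eltE; apply: sec_act.
exact: (HS (existT (fun n => free_mod k gT deg n) (deg a) (free_gen k gT deg a)) (map_f _ (mem_enum _ _))).
Qed.

(** What a generator in degree [n] contributes to the shift through morphisms hitting the new point:
    its translates under automorphisms, finitely many as the group is finite, now in degree [n - 1].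
    Nothing can be hit from degree 0. *)
Definition shift_gens V n : V n -> seq (elt (shift V)) :=
  match n with
  | 0 => fun _ => [::]
  | n'.+1 => fun v => [seq existT (fun m => shift V m) n' (lact (l := V) (s : hom n'.+1 n'.+1) v)
      | s <- enum {: FI_hom gT n'.+1 n'.+1}]
  end.

Lemma fg_shift V : finitely_generated V -> finitely_generated (shift V).
Proof.
move=> [l lV]; exists ([seq existT (fun m => shift V m) (projT1 p) (to_shift V _ (projT2 p)) | p <- l]
  ++ flatten [seq shift_gens (projT2 p) | p <- l]) => S HS.
pose P n (v : V n) := forall s (f : hom n s.+1), (lact (l := V) f v : shift V s) \in S s.
have P0 n : P n 0 by move=> s f; rewrite linear0; apply: (rpred0 (S s)).
have PL n a x y : P n x -> P n y -> P n (a *: x + y).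
  move=> Px Py s f; rewrite linearP.
  by apply: (rpredD (V := shift V s)); [apply: (rpredZ (V := shift V s))|]; [apply: Px|apply: Py].
have PA n m (f : hom n m) v : P n v -> P m (lact f v).
  by move=> Pv s g; rewrite -lactM; apply: Pv.
move=> n v; have /mk_submoduleE/(_ n (idm _)) : (v : V n.+1) \in mk_submodule P0 PL PA n.+1; last by rewrite lact1.
apply: lV => p pl; apply/mk_submoduleE => s f.
have [/existsP[x /eqP fx]|/existsPn H] := boolP [exists x, FI_inj f x == ord0].
  have H : forall q, q \in shift_gens (projT2 p) -> projT2 q \in S (projT1 q).
    move=> q qp; apply: HS; rewrite mem_cat; apply/orP; right; apply/flattenP.
    by exists (shift_gens (projT2 p)) => //; apply: map_f.
  case: p x f fx {pl} H => m u x f /= fx H.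
  have [n' [e [f' [t E]]]] := FI_succ_factor fx; subst m.
  rewrite E lactM -[lact (FI_succ f') _]/(lact (l := shift V) f' (lact (l := V) t u)).
  apply: sec_act; apply: (H (existT (fun m => shift V m) n' (lact (l := V) t u))).
  by apply: (map_f (fun s => existT (fun m => shift V m) n' (lact (l := V) (s : hom n'.+1 n'.+1) u))); rewrite mem_enum.
have [|f' ->] := @FI_lift_factor _ _ _ f; first by move=> x; apply: H.
rewrite lactM -[lact (lift _) _]/(to_shift V s (lact f' (projT2 p))) lfun_nat; apply: sec_act.
apply: (HS (existT (fun m => shift V m) (projT1 p) (to_shift V _ (projT2 p)))).
by rewrite mem_cat (map_f (fun p => existT (fun m => shift V m) (projT1 p) (to_shift V _ (projT2 p))) pl).
Qed.

Lemma fg_diff V : finitely_generated V -> finitely_generated (diff V).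
Proof. by move=> /fg_shift; apply: fg_surj; apply: to_diff_surj. Qed.

Lemma fg_iter_shift N V : finitely_generated V -> finitely_generated (iter N (@shift k gT) V).
Proof. by elim: N => // N IH /IH/fg_shift. Qed.

Lemma iter_shift_generated_lt N d V : generated_lt d V -> generated_lt d (iter N (@shift k gT) V).
Proof. by elim: N => // N IH /IH/shift_generated_lt. Qed.

Definition inj_from N V := forall s (v : V s), (N <= s)%N -> to_shift V s v = 0 -> v = 0.

(** The kernel of [to_shift] is killed by every morphism that raises the degree; being finitely
    generated, it vanishes above the degrees of its generators. *)
Lemma fg_inj_from V : noetherian k -> finitely_generated V -> exists N, inj_from N V.
Proof.
move=> nk fV; have [l [lK lg]] := fg_noetherian nk fV (ker_mod (to_shift V)).
have [N lN] := elt_bound l; exists N => s v Ns v0.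
pose P n (v : V n) := to_shift V n v = 0 /\ ((N <= n)%N -> v = 0).
have P0 n : P n 0 by rewrite /P lhom0E.
have PL n a x y : P n x -> P n y -> P n (a *: x + y).
  move=> [x0 xN] [y0 yN]; split=> [|Nn]; first by rewrite lhomL x0 y0 scaler0 addr0.
  by rewrite xN // yN // scaler0 addr0.
have PA n m (f : hom n m) x : P n x -> P m (lact f x).
  move=> [x0 xN]; split=> [|Nm]; first by rewrite lfun_nat x0 linear0.
  have := FI_hom_leq f; rewrite leq_eqVlt => /orP[/eqP nm|nm]; last exact: to_shift_ker.
  by rewrite xN ?linear0 // nm.
have /mk_submoduleE[_] : v \in mk_submodule P0 PL PA s; last exact.
apply: lg; last exact/kerE.
move=> p pl; apply/mk_submoduleE; split; first exact/kerE/lK.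
by rewrite leqNgt lN.
Qed.

Lemma inj_from_shift N V : inj_from N V -> inj_from N.-1 (shift V).
Proof.
move=> iV s v Ns v0; apply: (iV s.+1); first by move: Ns; case: (N).
rewrite -[LHS]/(lact (lift s.+1) v) -FI_swap_lift lactM.
by rewrite -[lact (FI_succ _) v]/(to_shift (shift V) s v) v0 linear0.
Qed.

Lemma inj_from_iter N M V : inj_from N V -> inj_from (N - M) (iter M (@shift k gT) V).
Proof.
move=> iV; elim: M => [|M IH]; first by rewrite subn0.
by rewrite subnS; apply: inj_from_shift.
Qed.

(** The difference of a large shift is the shift of the difference, which has smaller generation
    degree. The conclusion is about all large [M], as the bound from induction must be combined with
    the one that removes torsion. *)
Lemma iter_shift_tor1 V : noetherian k -> finitely_generated V ->
  exists N, forall M, (N <= M)%N -> tor1_vanish (iter M (@shift k gT) V).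
Proof.
move=> nk fV; have [d gV] := fg_generated_lt fV.
elim: d V fV gV => [|d IH] V fV gV.
  exists 0%N => M _; apply/(tor_vanish_zero 0)/generated_lt0.
  exact: iter_shift_generated_lt.
have [N1 HN1] := IH _ (fg_diff fV) (diff_generated_lt gV).
have [N2 HN2] := fg_inj_from nk fV.
exists (maxn N1 N2) => M; rewrite geq_max => /andP[N1M N2M].
apply: (tor1_of_diff (iter_shift_generated_lt (N := M) gV)).
  move=> s v; apply: (inj_from_iter (M := M) HN2).
  by move: N2M; rewrite -subn_eq0 => /eqP ->.
exact: (tor_vanish_iso (j := 0) (diff_iter_shift M V) (HN1 M N1M)).
Qed.
End FinitelyGenerated.

(** * Vanishing of Ext *)

Lemma homology_is_zeroP (k : comPzRingType) (V W U : lmodType k) (f : {linear V -> W})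
  (g : {linear W -> U}) :
  is_zero (homology f g) <-> forall w, g w = 0 -> exists v, f v = w.
Proof.
split=> [H w gw|H].
  have wk : w \in ker g by apply/kerE.
  have /quot_pi_eq0/preimE/imE // := H (quot_pi _ (SubMk wk)).
apply: quot_ind => x; apply/quot_pi_eq0.
by apply/preimE/imE/H/kerE/sub_valP.
Qed.

Section ExtAcyclic.
Variables (k : comPzRingType) (C : category).
Implicit Types T V A B D : left_module k C.

Section Resolution.
Variables (T : left_module k C) (P : resolution T).

Definition ext_acyclic V := forall i (c : lhom (P i) V), lhom_comp c (res_d P i) = 0 ->
  exists b : lhom (P i.-1) V, lhom_comp b (res_out P i) = c.

Lemma res_out_d i : lhom_comp (res_out P i) (res_d P i) = 0.
Proof.
case: i => [|i]; apply: lhomP => x v //=.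
rewrite -[LHS]/(res_d P i x (res_d P i.+1 x v)); by apply/res_exactS; exists v.
Qed.

Lemma lhom_comp0 V W U (f : lhom W U) : lhom_comp f (0 : Hom V W) = 0.
Proof. by apply: lhomP => x v; apply: lhom0E. Qed.

(** Exactness of Ext^(i-1)(T, D) -> Ext^i(T, A) -> Ext^i(T, B): a class that dies in [B] comes from
    [D], where all classes vanish. *)
Lemma ext_injective A B D (f : lhom A B) (g : lhom B D) i (a : lhom (P i) A) :
  ses f g -> ext_acyclic D ->
  (exists b, lhom_comp b (res_out P i) = lhom_comp f a) ->
  exists a', lhom_comp a' (res_out P i) = a.
Proof.
move=> [fi fg gs] aD [b bE].
case: i a b bE => [|j] a b bE.
  exists 0; rewrite lhom_comp0; apply: lhomP => x v; apply/esym/(fi x).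
  by rewrite -[LHS]/(lhom_comp f a x v) -bE; apply: lhom0E.
have [|e eE] := aD j (lhom_comp g b).
  apply: lhomP => x v; rewrite -[LHS]/(g x (lhom_comp b (res_d P j) x v)).
  by rewrite (lhom_eqE bE) /= (exact_comp0 fg).
have [e' e'E] := @res_proj _ _ _ P _ _ _ g e gs.
have H x v : exists u, f x u = (b - lhom_comp e' (res_out P j) : Hom _ _) x v.
  apply/fg; rewrite lhomB; apply/eqP; rewrite subr_eq0; apply/eqP.
  by rewrite -[LHS]/(lhom_comp g b x v) -eE -e'E.
exists (factor fi H); apply: lhomP => x v; apply: (injective_homP fi).
rewrite -[LHS]/(f x (factor fi H x (res_d P j x v))) factorE.
rewrite -[RHS]/(lhom_comp f a x v) -bE /=.
rewrite -[LHS]/(b x _ - e' x (lhom_comp (res_out P j) (res_d P j) x v)).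
by rewrite res_out_d lhom0E subr0.
Qed.

Lemma ext_acyclic_quot A B D (f : lhom A B) (g : lhom B D) : ses f g ->
  ext_acyclic A -> ext_acyclic B -> ext_acyclic D.
Proof.
move=> [fi fg gs] aA aB i c cd.
have [c' c'E] := @res_proj _ _ _ P _ _ _ g c gs.
have H x v : exists u, f x u = lhom_comp c' (res_d P i) x v.
  apply/fg; rewrite -[LHS]/(lhom_comp (lhom_comp g c') (res_d P i) x v) c'E cd //.
have [|b bE] := aA i.+1 (factor fi H).
  apply: lhomP => x v; apply: (fi x); rewrite factorE.
  rewrite -[LHS]/(c' x (lhom_comp (res_out P i.+1) (res_d P i.+1) x v)).
  by rewrite res_out_d lhom0E.
have [|e eE] := aB i (c' - lhom_comp f b : Hom _ _).
  apply: lhomP => x v; rewrite -[LHS]/(lhom_comp c' (res_d P i) x v - f x (lhom_comp b (res_d P i) x v)).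
  by rewrite (lhom_eqE bE) factorE subrr.
exists (lhom_comp g e); apply: lhomP => x v.
rewrite -[LHS]/(g x (lhom_comp e (res_out P i) x v)) eE.
rewrite -[LHS]/(g x (c' x v - f x (b x v))) lhomB (exact_comp0 fg) subr0.
exact: (lhom_eqE c'E).
Qed.

End Resolution.

Lemma Ext_is_zeroP T V i : is_zero (Ext i T V) <->
  forall c : lhom (std_resolution T i) V, lhom_comp c (res_d (std_resolution T) i) = 0 ->
  exists b, lhom_comp b (res_out (std_resolution T) i) = c.
Proof. exact: homology_is_zeroP. Qed.

End ExtAcyclic.

Section IteratedShift.
Variables (k : comPzRingType) (gT : finGroupType).
Notation module := (left_module k (FI gT)).
Notation hom n m := (@hom (FI gT) n m).
Notation shiftn N V := (iter N (@shift k gT) V).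
Implicit Types T V W : module.

Fixpoint to_shiftn N V : lhom V (shiftn N V) :=
  if N is N'.+1 then lhom_comp (to_shift (shiftn N' V)) (to_shiftn N' V) else lhom_id V.

Fixpoint shiftn_hom N V W (f : lhom V W) : lhom (shiftn N V) (shiftn N W) :=
  if N is N'.+1 then shift_hom (shiftn_hom N' f) else f.

Lemma to_shiftn_nat N V W (f : lhom V W) :
  lhom_comp (shiftn_hom N f) (to_shiftn N V) = lhom_comp (to_shiftn N W) f.
Proof.
apply: lhomP => s v /=; elim: N => //= N IH.
by rewrite -[LHS]/(shift_hom (shiftn_hom N f) s (to_shift _ s (to_shiftn N V s v)))
  to_shift_hom IH.
Qed.

Lemma shiftn_hom_comp N V W U (g : lhom W U) (f : lhom V W) :
  shiftn_hom N (lhom_comp g f) = lhom_comp (shiftn_hom N g) (shiftn_hom N f).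
Proof. by elim: N => //= N ->; apply: lhomP. Qed.

Lemma shiftn_hom0 N V W : shiftn_hom N (0 : Hom V W) = 0.
Proof. by elim: N => //= N ->; apply: lhomP. Qed.

Lemma shiftn_exact N V W U (f : lhom V W) (g : lhom W U) : exact_at f g ->
  exact_at (shiftn_hom N f) (shiftn_hom N g).
Proof. by move=> fg; elim: N => //= N IH s w; apply: (IH s.+1). Qed.

Lemma shiftn_zero N M T : (forall s, (M <= s)%N -> forall v : T s, v = 0) ->
  forall s, (M <= s + N)%N -> forall v : shiftn N T s, v = 0.
Proof.
move=> T0; elim: N => [|N IH] s; first by rewrite addn0; apply: T0.
by rewrite addnS -addSn => /IH.
Qed.

Section Homotopy.
Variables (T : module) (P : resolution T) (N : nat).
Hypothesis TN : to_shiftn N T = 0.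

Lemma res_exact i : exact_at (res_d P i.+1) (res_d P i).
Proof. by move=> s w; apply: res_exactS. Qed.

(* [P -> shiftn N P] lifts the zero map [T -> shiftn N T], hence is null-homotopic. *)
Lemma to_shiftn_homotopy i : exists (h : lhom (P i) (shiftn N (P i.+1)))
  (h' : lhom (P i.-1) (shiftn N (P i))),
  to_shiftn N (P i) = lhom_comp (shiftn_hom N (res_d P i)) h + lhom_comp h' (res_out P i) :> Hom _ _.
Proof.
elim: i => [|i [h [h' E]]].
  have ex : exact_at (shiftn_hom N (res_d P 0)) (shiftn_hom N (res_aug P)).
    by apply: shiftn_exact => s w; apply: res_exact0.
  have [|h hE] := lift_exact (h := to_shiftn N (P 0)) (@res_proj _ _ _ P 0) ex.
    move=> s u; rewrite -[LHS]/(lhom_comp (shiftn_hom N (res_aug P)) (to_shiftn N (P 0)) s u).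
    by rewrite to_shiftn_nat TN.
  by exists h, 0; rewrite hE lhom_comp0 addr0.
have ex : exact_at (shiftn_hom N (res_d P i.+1)) (shiftn_hom N (res_d P i)).
  exact/shiftn_exact/res_exact.
have [|h2 h2E] := lift_exact (h := to_shiftn N (P i.+1) - lhom_comp h (res_d P i) : Hom _ _) (@res_proj _ _ _ P i.+1) ex.
  move=> s u; rewrite lhomB.
  rewrite -[X in X - _]/(lhom_comp (shiftn_hom N (res_d P i)) (to_shiftn N (P i.+1)) s u).
  rewrite to_shiftn_nat -[X in X - _]/(to_shiftn N (P i) s (res_d P i s u)) E.
  rewrite -[LHS]/(shiftn_hom N (res_d P i) s (h s (res_d P i s u)) +
    h' s (lhom_comp (res_out P i) (res_d P i) s u) - shiftn_hom N (res_d P i) s (h s (res_d P i s u))).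
  by rewrite res_out_d lhom0E addr0 subrr.
by exists h2, h; rewrite h2E -[res_out P i.+1]/(res_d P i) subrK.
Qed.

(** So Ext(T, V) -> Ext(T, Sigma^N V) is zero: by naturality [c] followed by the shift map is the
    shift map of [P i] followed by the shifted [c], and of the homotopy only the term through
    [res_out] survives. *)
Lemma to_shiftn_cocycle V i (c : lhom (P i) V) : lhom_comp c (res_d P i) = 0 ->
  exists b, lhom_comp b (res_out P i) = lhom_comp (to_shiftn N V) c.
Proof.
move=> cd; have [h [h' E]] := to_shiftn_homotopy i.
exists (lhom_comp (shiftn_hom N c) h').
rewrite -to_shiftn_nat E; apply: lhomP => s v.
rewrite -[RHS]/(shiftn_hom N c s (shiftn_hom N (res_d P i) s (h s v) + h' s (res_out P i s v))).
rewrite lhomD -[X in X + _]/(lhom_comp (shiftn_hom N c) (shiftn_hom N (res_d P i)) s (h s v)).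
by rewrite -shiftn_hom_comp cd shiftn_hom0 add0r.
Qed.
End Homotopy.

Lemma shiftn_tor1 N d V : generated_lt d V -> tor1_vanish V -> tor1_vanish (shiftn N V).
Proof.
by move=> gV tV; elim: N => //= N; apply: tor1_shift (iter_shift_generated_lt (N := N) gV).
Qed.

Lemma tor1_ext_acyclic d M T (P : resolution T) V : generated_lt d V -> tor1_vanish V ->
  (forall s, (M <= s)%N -> forall v : T s, v = 0) -> ext_acyclic P V.
Proof.
move=> gV tV T0; elim: d V gV tV => [|d IH] V gV tV i c cd.
  by exists 0; apply: lhomP => s v; rewrite (generated_lt0 gV (c s v)).
have TM : to_shiftn M T = 0.
  by apply: lhomP => s v; apply: (shiftn_zero T0); apply: leq_addl.
have : exists b, lhom_comp b (res_out P i) = lhom_comp (to_shiftn M V) c.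
  exact: to_shiftn_cocycle.
(* The shifts are undone one at a time; each step is injective on Ext by the outer induction,
   applied to the difference of the [M]-fold shift. *)
elim: M {T0 TM} => [|M IHM] H; first by case: H => b bE; exists b; rewrite bE; apply: lhomP.
apply: IHM; have gM := iter_shift_generated_lt (N := M) gV.
have [Vi tD] := tor1_diff gM (shiftn_tor1 (N := M) gV tV).
apply: (ext_injective (diff_ses Vi)); last by rewrite lhom_compA.
by apply: IH tD; apply: diff_generated_lt.
Qed.

(** Each shift adds a difference, and differences are decomposable from degree [d] on. Hence the
    cokernel of V -> Sigma^N V is generated in degrees less than [d], one better than [V]. *)
Lemma to_shiftn_generated N d V : generated_lt d.+1 V ->
  forall s (w : shiftn N V s), (d <= s)%N ->
  exists (v : V s) (x : shiftn N V s), decomposable x /\ w = to_shiftn N V s v + x.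
Proof.
move=> gV; elim: N => [|N IH] s w ds.
  by exists w, 0; rewrite addr0; split=> //; apply: Decomposable0.
have gD := diff_generated_lt (iter_shift_generated_lt (N := N) gV).
have [x dx xE] := decomposable_lift (@to_diff_surj _ _ (shiftn N V)) (gD s (to_diff _ s w) ds).
have /to_diff_exact[u uE] : to_diff (shiftn N V) s (w - x) = 0 by rewrite lhomB xE subrr.
have [v [y [dy yE]]] := IH s u ds.
exists v, (to_shift _ s y + x); split.
  by apply: decomposableD => //; apply: decomposable_hom.
by rewrite addrA -[to_shiftn N.+1 V s v]/(to_shift _ s (to_shiftn N V s v)) -lhomD -yE uE subrK.
Qed.

Lemma to_shiftn_inj N V : injective_hom (to_shift V) -> injective_hom (to_shiftn N V).
Proof.
move=> Vi; elim: N => [|N IH] s v //= v0; apply: IH.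
have i0 : inj_from 0 V by move=> t u _; apply: Vi.
exact: (inj_from_iter (M := N) i0) (leq0n _) v0.
Qed.
End IteratedShift.

Section Characterization.
Variables (k : comPzRingType) (gT : finGroupType).
Hypothesis nk : noetherian k.
Notation module := (left_module k (FI gT)).
Notation hom n m := (@hom (FI gT) n m).
Notation kG s := (kGl gT k s).
Notation stdres s := (std_resolution (kG s)).
Implicit Types V : module.

Lemma kGl_zero s m : m != s -> forall v : kG s m, v = 0.
Proof.
move=> ms v; have [A vA] := free_supp v; rewrite (free_deltaE vA) big1 // => -[f fm] _.
by rewrite fm in ms.
Qed.

(** An element killed by [to_shift] is killed by every morphism that raises the degree, so it
    generates a quotient of kG_s. *)
Lemma kGl_hom s V (v : V s) : to_shift V s v = 0 ->
  exists f : lhom (kG s) V, exists x, f s x = v.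
Proof.
move=> v0; pose f m : {linear kG s m -> V m} := free_lift (fun b => lact (val b) v).
have fn m m' (a : hom m m') u : f m' (lact a u) = lact a (f m u).
  apply: (free_ext (f := f m' \o lact (l := kG s) a) (g := lact a \o f m)) => -[b ms].
  rewrite -[LHS]/(f m' (kGl_act k s a (delta k _))) -[RHS]/(lact a (f m (delta k _))).
  rewrite /kGl_act /f !free_lift_delta -[RHS]lactM.
  case/orP: (orbN (m' == s)) => m's.
    by rewrite (insubT (fun _ => m' == s) m's) [oapp _ _ _]/= free_lift_delta.
  rewrite (@insubN _ (fun _ => m' == s) _ _ m's) [oapp _ _ _]/= linear0.
  apply/esym/to_shift_ker => //; rewrite ltn_neqAle eq_sym m's /=.
  by rewrite -(eqP ms); apply: FI_hom_leq a.
exists (@LHom k (FI gT) (kG s) V f (fun m => linearP (f m)) fn).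
exists (delta k (exist (fun _ => s == s) (FI_id gT s) (eqxx s))).
by rewrite -[LHS]/(f s _) /f free_lift_delta; apply: (lact1 (l := V)).
Qed.

Lemma ext0_inj V : (forall s, is_zero (Ext 0 (kG s) V)) -> injective_hom (to_shift V).
Proof.
move=> E s v v0; have [f [x <-]] := kGl_hom v0.
have [u <-] := res_surj (stdres s) x.
have /Ext_is_zeroP/(_ (lhom_comp f (res_aug (stdres s)))) := E s.
case=> [|b].
  apply: lhomP => t w; rewrite -[LHS]/(f t (res_aug (stdres s) t (res_d (stdres s) 0 t w))).
  have -> : res_aug (stdres s) t (res_d (stdres s) 0 t w) = 0 by apply/res_exact0; exists w.
  exact: lhom0E.
by rewrite lhom_comp0 => /lhom_eqE/(_ _ u) /= <-.
Qed.

Lemma ext_acyclic_tor1 V : finitely_generated V -> (forall s, ext_acyclic (stdres s) V) ->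
  tor1_vanish V.
Proof.
move=> fV; have [d gV] := fg_generated_lt fV.
elim: d V fV gV => [|d IH] V fV gV aV; first exact/(tor_vanish_zero 0)/generated_lt0.
have Vi : injective_hom (to_shift V).
  by apply: ext0_inj => s; apply/Ext_is_zeroP => c; apply: (aV s 0%N).
have [N tN] := iter_shift_tor1 nk fV.
have {}tN := tN N (leqnn N).
have ses := coker_ses (to_shiftn_inj (N := N) Vi).
set D := quot_mod _ in ses.
have gD : generated_lt d D.
  move=> s x ds; have [{x}w <-] := quot_hom_surj x.
  have [v [x [dx ->]]] := to_shiftn_generated gV w ds.
  rewrite lhomD (exact_comp0 (ses_exact ses)) add0r; exact: decomposable_hom.
have fD : finitely_generated D := fg_surj (ses_surj ses) (fg_iter_shift N fV).
have aD s : ext_acyclic (stdres s) D.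
  apply: (ext_acyclic_quot ses (aV s)).
  have kG0 m : (s.+1 <= m)%N -> forall v : kG s m, v = 0.
    by move=> sm; apply: kGl_zero; rewrite gtn_eqF.
  exact: (tor1_ext_acyclic (iter_shift_generated_lt (N := N) gV) tN kG0).
have tD := IH _ fD gD aD.
(* Tor_1 of [V] sits between Tor_2 of the cokernel and Tor_1 of the shift, both zero. *)
exact: (tor_vanish_sub (j := 0) ses tN (tor1_tor 1 gD tD)).
Qed.

(** The descent in [j] uses a finitely generated free cover, whose kernel is finitely generated by
    noetherianity. The way back from the kernel to [V] goes through Ext, where vanishing for kernel
    and cover passes to the quotient. *)
Lemma tor_vanish_tor1 j V : finitely_generated V -> tor_vanish j V -> tor1_vanish V.
Proof.
elim: j V => [|j IH] V fV tV; first exact: tV.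
have [r [deg [p ps]]] := fg_cover fV.
have ip := ker_ses ps.
have pP : projective (free_mod k gT deg) by apply: free_mod_projective.
have fP : finitely_generated (free_mod k gT deg) by apply: fg_free_mod.
have fK : finitely_generated (sub_mod (ker_mod p)).
  exact/fg_sub_mod/fg_noetherian.
have tK := IH _ fK (tV _ _ _ _ ip pP).
apply: ext_acyclic_tor1 => // s.
have kG0 m : (s.+1 <= m)%N -> forall v : kG s m, v = 0.
  by move=> sm; apply: kGl_zero; rewrite gtn_eqF.
have [d gK] := fg_generated_lt fK; have [e gP] := fg_generated_lt fP.
apply: (ext_acyclic_quot ip); first exact: tor1_ext_acyclic gK tK kG0.
exact: tor1_ext_acyclic gP (tor_vanish_proj 0 pP) kG0.
Qed.

End Characterization.

(** * Comparison with Tor, and torsion modules *)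

Section TorCriterion.
Variables (k : comPzRingType) (gT : finGroupType).
Notation module := (left_module k (FI gT)).
Notation hom n m := (@hom (FI gT) n m).
Implicit Types V W : module.

Lemma trunc_decomposable V s (v : V s) : v \in trunc V s s <-> decomposable v.
Proof.
have PL a (x y : V s) : decomposable x -> decomposable y -> decomposable (a *: x + y).
  by move=> dx dy; apply: decomposableD => //; apply: decomposableZ.
split=> [vT|].
  apply/(mk_submodE (Decomposable0 V s) PL); move: vT; apply: trunc_ind => m f u ms.
  exact/mk_submodE/decomposable_act.
elim=> [|n f u w ns _ wT]; first exact: rpred0.
by apply: rpredD => //; apply: trunc_lact.
Qed.

(** * The tensor product with kG_s *)

Section Coinvariants.
Variables (s : nat) (V : module).
Notation N := (kGr gT k s).
Definition kGr_unit : N s := delta k (exist (fun _ => s == s) (FI_id gT s) (eqxx s)).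

Lemma ract_kGr_unit n (f : hom n s) (ns : n == s) :
  ract f kGr_unit = delta k (exist (fun _ => n == s) f ns).
Proof.
rewrite -[LHS]/(kGr_act k s f kGr_unit) /kGr_act /kGr_unit free_lift_delta.
rewrite (insubT (fun _ => n == s) ns) /=; congr (delta k _); apply: val_inj.
exact: (cmp1m (c := FI gT)).
Qed.

Lemma ract_kGr_unit0 n (f : hom n s) : n != s -> ract f kGr_unit = 0.
Proof.
move=> ns; rewrite -[LHS]/(kGr_act k s f kGr_unit) /kGr_act /kGr_unit free_lift_delta.
by rewrite (@insubN _ (fun _ => n == s) _ _ ns).
Qed.

Lemma tensor_kGr_surj (t : tensor N V) : exists v : V s, t = pure kGr_unit v.
Proof.
move: t; apply: pure_ind => [|t u [v ->] [w ->]|n u v].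
- by exists 0; rewrite -[RHS]/(mk_linear (pureR (V := V) kGr_unit) 0) linear0.
- by exists (v + w); rewrite -[RHS]/(mk_linear (pureR (V := V) kGr_unit) (v + w)) linearD.
have [A uA] := free_supp u; rewrite (free_deltaE uA).
rewrite -[pure _ _]/(mk_linear (pureL (N := N) v) _) linear_sum.
elim/big_ind: _ => [|t t' [w ->] [w' ->]|[f ns] _].
- by exists 0; rewrite -[RHS]/(mk_linear (pureR (V := V) kGr_unit) 0) linear0.
- by exists (w + w'); rewrite -[RHS]/(mk_linear (pureR (V := V) kGr_unit) (w + w')) linearD.
rewrite linearZ_LR; set a := (X in X *: _); exists (a *: lact (l := V) f v).
rewrite -[RHS]/(mk_linear (pureR (V := V) kGr_unit) (a *: lact (l := V) f v)) linearZ_LR /=.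
by rewrite -pureB ract_kGr_unit.
Qed.

Definition coinv_fun n (u : N n) (v : V n) : quot_lmod (trunc V s s) :=
  free_lift (fun b => quot_pi _ (lact (l := V) (val b) v)) u.
Fact coinv_L n v : linear (fun u => @coinv_fun n u v).
Proof. exact: linearP. Qed.
Fact coinv_R n u : linear (@coinv_fun n u).
Proof.
apply: (free_lift_linear_r (F := fun b v => quot_pi (trunc V s s) (lact (l := V) (val b) v))).
by move=> b a x y; rewrite !linearP.
Qed.
Fact coinv_B n m (f : hom n m) (u : N m) (v : V n) :
  coinv_fun (ract f u) v = coinv_fun u (lact f v).
Proof.
apply: (free_ext (f := free_lift (fun b => quot_pi (trunc V s s) (lact (l := V) (val b) v)) \o ract (r := N) f)
  (g := free_lift (fun b => quot_pi (trunc V s s) (lact (l := V) (val b) (lact f v))))) => -[g ms].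
rewrite -[LHS]/(free_lift _ (kGr_act k s f (delta k _))) /kGr_act !free_lift_delta.
rewrite -[lact (\val _) _]lactM.
case/orP: (orbN (n == s)) => ns.
  by rewrite (insubT (fun _ => n == s) ns) [oapp _ _ _]/= free_lift_delta.
rewrite (@insubN _ (fun _ => n == s) _ _ ns) [oapp _ _ _]/= linear0.
apply/esym/quot_pi_eq0/trunc_lact; rewrite ltn_neqAle ns /=.
by rewrite -(eqP ms); apply: FI_hom_leq f.
Qed.

(** The map induced by [coinv_fun], to V_s modulo decomposable elements, shows that nothing else is
    killed. *)
Lemma pure_kGr_eq0 (v : V s) : pure kGr_unit v = 0 <-> decomposable v.
Proof.
split=> [v0|].
  apply/trunc_decomposable/quot_pi_eq0.
  have <- : tensor_lift coinv_L coinv_R coinv_B (pure kGr_unit v) = quot_pi _ v.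
    by rewrite tensor_liftE /coinv_fun /kGr_unit free_lift_delta [val _]/= (lact1 (l := V)).
  by rewrite v0 linear0.
elim=> [|n f u w ns _ IH].
  by rewrite -[LHS]/(mk_linear (pureR (V := V) kGr_unit) 0) linear0.
rewrite -[LHS]/(mk_linear (pureR (V := V) kGr_unit) (lact f u + w)) linearD /= IH addr0.
rewrite -pureB ract_kGr_unit0 ?ltn_eqF //.
by rewrite -[LHS]/(mk_linear (pureL (N := N) u) 0) linear0.
Qed.
End Coinvariants.

Lemma Tor_is_zeroP V (P : resolution V) i s : is_zero (Tor_of P (kGr gT k s) i.+1) <->
  forall v : P i.+1 s, decomposable (res_d P i s v) ->
  exists w, decomposable (v - res_d P i.+1 s w).
Proof.
have mapE U W (f : lhom U W) u : tensor_map (rhom_id (kGr gT k s)) f (pure (kGr_unit s) u)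
  = pure (kGr_unit s) (f s u) by rewrite tensor_mapE.
rewrite /Tor_of homology_is_zeroP; split=> [H v dv|H t].
  have [|t tE] := H (pure (kGr_unit s) v).
    by rewrite mapE; apply/pure_kGr_eq0.
  have [w wE] := tensor_kGr_surj t; exists w; apply/pure_kGr_eq0.
  rewrite -[LHS]/(mk_linear (pureR (V := P i.+1) (kGr_unit s)) (v - _)) linearB /=.
  by rewrite -mapE -wE tE subrr.
have [v ->] := tensor_kGr_surj t; rewrite mapE => /pure_kGr_eq0/H[w dw].
exists (pure (kGr_unit s) w); rewrite mapE; apply/eqP; rewrite eq_sym -subr_eq0; apply/eqP.
by have /pure_kGr_eq0 := dw; rewrite -[LHS]/(mk_linear (pureR (V := P i.+1) (kGr_unit s)) (v - _)) linearB.
Qed.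

(** The test is made on the presentation of [syzygy V i] by its cover. Elements of the kernel lift
    to the next cover, and the remaining differential has exactly the ambiguity of such lifts as its
    image. *)
Lemma tor1_syzygy V i : (forall s, is_zero (Tor i.+1 (kGr gT k s) V)) <-> tor1_vanish (syzygy V i).
Proof.
have ip := ker_ses (@cover_aug_surj k (FI gT) (syzygy V i)).
have augd s w : cover_aug (syzygy V i.+1) s (std_d V i.+1 s w) = 0.
  by apply/std_d_ker; exists w.
split=> [H|tV s].
  apply: (tor1_vanishP ip (@cover_projective _ _ _)) => s x dx.
  have [u uE] := cover_aug_surj (V := syzygy V i.+1) x.
  have /Tor_is_zeroP/(_ u)[] := H s.
    by rewrite -[X in decomposable X]/(sub_mod_incl _ s (cover_aug (syzygy V i.+1) s u)) uE.
  move=> w /(decomposable_hom (cover_aug (syzygy V i.+1))).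
  by rewrite lhomB augd subr0 uE.
apply/Tor_is_zeroP => v dv.
have /decomposable_lift : decomposable (cover_aug (syzygy V i.+1) s v) by apply: (tV _ _ _ _ ip).
move=> /(_ _ _ (@cover_aug_surj k (FI gT) (syzygy V i.+1)))[y dy yE].
have /std_d_ker[w wE] : cover_aug (syzygy V i.+1) s (v - y) = 0 by rewrite lhomB yE subrr.
by exists w; rewrite [res_d _ _ _ _]wE opprB addrC subrK.
Qed.

Lemma tor_vanish_syzygyE V i j : tor_vanish j (syzygy V i) <-> tor_vanish (i + j) V.
Proof.
elim: i j => [|i IH] j //; rewrite addSnnS -IH.
have ip := ker_ses (@cover_aug_surj k (FI gT) (syzygy V i)).
have pr := @cover_projective k (FI gT) (syzygy V i).
by split=> [|H]; [apply: tor_vanish_syzygy ip pr|apply: H ip pr].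
Qed.

Lemma tor_vanishP V i : (forall s, is_zero (Tor i.+1 (kGr gT k s) V)) <-> tor_vanish i V.
Proof. by rewrite tor1_syzygy -[tor1_vanish _]/(tor_vanish 0 _) tor_vanish_syzygyE addn0. Qed.
End TorCriterion.

Section TorsionModules.
Variables (k : comPzRingType) (gT : finGroupType).
Notation module := (left_module k (FI gT)).
Notation hom n m := (@hom (FI gT) n m).
Notation comp f g := (@cmp (FI gT) _ _ _ f g).

Lemma kGl_fg s : finitely_generated (kGl gT k s).
Proof.
pose u : kGl gT k s s := delta k (exist (fun _ => s == s) (FI_id gT s) (eqxx s)).
exists [:: existT (fun n => kGl gT k s n) s u] => S HS n v.
have [A vA] := free_supp v; rewrite (free_deltaE vA); apply: rpred_sum => -[f ns] _.
apply: rpredZ; suff -> : delta k (exist (fun _ => n == s) f ns) = lact (l := kGl gT k s) f u.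
  by apply: sec_act; apply: (HS (existT (fun n => kGl gT k s n) s u)); apply: mem_head.
rewrite -[RHS]/(kGl_act k s f u) /kGl_act /u free_lift_delta.
rewrite (insubT (fun _ => n == s) ns) /=; congr (delta k _).
apply: val_inj; apply/esym; exact: (cmpm1 (c := FI gT)).
Qed.

Lemma kGl_torsion s : torsion (kGl gT k s).
Proof.
move=> n v; exists n.+1, (@FI_lift gT n); split; first exact: ltnSn.
have [E|] := eqVneq n.+1 s; last by move=> ns; apply: kGl_zero.
by rewrite (kGl_zero (k := k) _ v) ?linear0 // -E ltn_eqF.
Qed.

(** Consequently an element killed by one morphism into degree [m0] is killed by all morphisms into
    degrees at least [m0], which bounds the degrees of a finitely generated torsion module. *)
Lemma FI_factor n m m0 (f0 : hom n m0) (f : hom n m) : (m0 <= m)%N -> exists g, f = comp g f0.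
Proof.
move=> m0m; move: {2}(m0 - n)%N (erefl (m0 - n)%N) => d.
elim: d n f0 f => [|d IH] n f0 f dE.
  have nm0 : n = m0 by apply/eqP; rewrite eqn_leq (FI_hom_leq f0) -subn_eq0 dE.
  subst m0; have [g [_ gf]] := FI_end_inv f0.
  by exists (comp f g); rewrite -cmpA gf cmpm1.
have nm0 : (n < m0)%N by rewrite -subn_gt0 dE.
have [f0' ->] := FI_lt_factor f0 nm0; have [f' ->] := FI_lt_factor f (leq_trans nm0 m0m).
have [|g ->] := IH _ f0' f'; first by rewrite subnS dE.
by exists g; rewrite cmpA.
Qed.

Lemma fg_torsion_bounded (T : module) : finitely_generated T -> torsion T ->
  exists M, forall s, (M <= s)%N -> forall v : T s, v = 0.
Proof.
move=> [l lT] tT.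
have [M HM] : exists M, forall p, p \in l -> forall m (f : hom (projT1 p) m), (M <= m)%N ->
    lact (l := T) f (projT2 p) = 0.
  elim: l {lT} => [|[n v] l [M HM]]; first by exists 0%N.
  have [m0 [f0 [_ f0v]]] := tT n v; exists (maxn M m0) => p; rewrite inE.
  move=> /orP[/eqP ->|pl] m f; rewrite geq_max => /andP[Mm m0m]; last exact: HM.
  by have [g ->] := FI_factor f0 f m0m; rewrite lactM f0v linear0.
exists M => s Ms v.
pose P n (v : T n) := forall m (f : hom n m), (M <= m)%N -> lact f v = 0.
have P0 n : P n 0 by move=> m f _; rewrite linear0.
have PL n a x y : P n x -> P n y -> P n (a *: x + y).
  by move=> Px Py m f Mm; rewrite linearP Px // Py // scaler0 addr0.
have PA n m (f : hom n m) x : P n x -> P m (lact f x).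
  by move=> Px m' g Mm'; rewrite -lactM; apply: Px.
have /mk_submoduleE/(_ s (idm _) Ms) : v \in mk_submodule P0 PL PA s; last by rewrite lact1.
by apply: lT => p pl; apply/mk_submoduleE => m f; apply: HM.
Qed.
End TorsionModules.

Theorem theorem3 (k : comPzRingType) (Hk : noetherian k) (gT : finGroupType)
    (V : left_module k (FI gT)) (fgV : finitely_generated V) :
  [<-> sharp_filtered V;
       forall i s : nat, (1 <= i)%N -> is_zero (Tor i (kGr gT k s) V);
       forall s : nat, is_zero (Tor 1 (kGr gT k s) V);
       exists2 i : nat, (1 <= i)%N & forall s : nat, is_zero (Tor i (kGr gT k s) V);
       forall i s : nat, is_zero (Ext i (kGl gT k s) V);
       forall (i : nat) (T : left_module k (FI gT)),
         finitely_generated T -> torsion T -> is_zero (Ext i T V)].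
Proof.
have [d gV] := fg_generated_lt fgV.
have tor1_Ext i T : tor1_vanish V -> finitely_generated T -> torsion T -> is_zero (Ext i T V).
  move=> tV fT tT; have [M TM] := fg_torsion_bounded fT tT.
  by apply/Ext_is_zeroP => c; apply: tor1_ext_acyclic gV tV TM i c.
have Ext_tor1 : (forall i s, is_zero (Ext i (kGl gT k s) V)) -> tor1_vanish V.
  by move=> EV; apply: ext_acyclic_tor1 => // s i; apply/Ext_is_zeroP.
tfae.
- move=> /sharp_filtered_tor1 tV [//|i] s _; move: s.
  exact/tor_vanishP/(tor1_tor i gV tV).
- by move=> TV s; apply: TV.
- by move=> TV; exists 1%N.
(* [tor_vanish j] is about Tor_(j+1), so i = 0 is discarded by the bound on i. *)
- move=> [[//|j] _ /tor_vanishP/(tor_vanish_tor1 Hk fgV) tV] i s.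
  by apply: tor1_Ext => //; [apply: kGl_fg|apply: kGl_torsion].
- by move=> /Ext_tor1 tV i T; apply: tor1_Ext.
- move=> EV; apply: (tor1_sharp_filtered gV); apply: Ext_tor1 => i s.
  by apply: EV; [apply: kGl_fg|apply: kGl_torsion].
Qed.
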